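(* Let $\mathcal{H}$ be a toric hyperplane arrangement on $T^n$ whose induced subdivision is a regular cell complex, with face poset $T_t$ and intersection poset $\mathcal{P}$. Then $$\Psi(T_t)^*=\varphi_t\bigl(\Psi(\mathcal{P}\cup\{\hat0\})\bigr).$$
   Context: $T^n=\mathbb{R}^n/\mathbb{Z}^n$; a toric hyperplane is the image of $\{\vec x:\vec a\cdot\vec x=b\}$, $\vec a\in\mathbb{Q}^n\setminus\{0\}$, $b\in\mathbb R$. The intersection poset $\mathcal{P}$: all connected components of all intersections of the hyperplanes (empty intersection $=T^n$) plus $\emptyset$, ordered by reverse inclusion; $\mathcal{P}\cup\{\hat0\}$ has a new minimum, ranks $\rho(\hat0)=0$, $\rho(x)=n-\dim x+1$, $\rho(\emptyset)=n+2$. $T_t$: cells of the subdivision plus empty face (rank 0) and the torus (rank $n+2$), ordered by closure containment, $i$-cells of rank $i+1$. $\mathbf{ab}$-index: for a poset $P$ with $\hat0,\hat1$, rank function, $\rho(\hat1)=N+1$, let $f_S$ ($S=\{s_1<\dots<s_{k-1}\}\subseteq\{1,\dots,N\}$) count chains $\hat0<x_1<\dots<x_{k-1}<\hat1$ with $\rho(x_j)=s_j$, $h_S=\sum_{T\subseteq S}(-1)^{|S-T|}f_T$, and $\Psi(P)=\sum_S h_Su_S\in\mathbb{Z}\langle\mathbf a,\mathbf b\rangle$ with $u_S=u_1\cdots u_N$, $u_i=\mathbf b$ if $i\in S$, else $\mathbf a$. The involution $^*$ reverses each $\mathbf{ab}$-monomial ($(u_1\cdots u_N)^*=u_N\cdots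 u_1$), extended linearly. Coproduct: for an $\mathbf{ab}$-monomial $u=u_1\cdots u_N$ and $k\ge1$, $\Delta^{k-1}(u)=\sum_{1\le i_1<\dots<i_{k-1}\le N}u_{(1)}\otimes\cdots\otimes u_{(k)}$ where $u_{(1)}=u_1\cdots u_{i_1-1}$, $u_{(j)}=u_{i_{j-1}+1}\cdots u_{i_j-1}$, $u_{(k)}=u_{i_{k-1}+1}\cdots u_N$ (so $\Delta^0=\mathrm{id}$); written $\sum_u u_{(1)}\otimes\cdots\otimes u_{(k)}$, extended linearly. Linear maps on monomials $v$: $\kappa(v)=(\mathbf a-\mathbf b)^m$ if $v=\mathbf a^m$, else $0$; $\eta(v)=2(\mathbf a-\mathbf b)^{m+k}$ if $v=\mathbf b^m\mathbf a^k$ ($m,k\ge0$), else $0$; $\lambda_t(v)=(\mathbf a-\mathbf b)^m$ if $v=\mathbf b^m$, $\lambda_t(v)=(\mathbf a-\mathbf b)^{m+1}$ if $v=\mathbf b^m\mathbf a$, else $0$. Define $\varphi_{t,1}=\kappa$ and for $k\ge2$, $\varphi_{t,k}(v)=\sum_v\kappa(v_{(1)})\,\mathbf b\,\eta(v_{(2)})\,\mathbf b\cdots\mathbf b\,\eta(v_{(k-1)})\,\mathbf b\,\lambda_t(v_{(k)})$ (coproduct into $k$ parts), and $\varphi_t=\sum_{k\ge1}\varphi_{t,k}$. *)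

(* Defs.v *)
From HB Require Import structures.
From mathcomp Require Import all_boot all_order all_algebra generic_quotient.
From mathcomp Require Import finmap.
From mathcomp.multinomials Require Import monalg.
From mathcomp Require Import all_classical all_reals topology normedtype convex.

Set Implicit Arguments.
Unset Strict Implicit.
Unset Printing Implicit Defensive.

Import Order.TTheory GRing.Theory Num.Theory.
Import numFieldNormedType.Exports.

Local Open Scope classical_set_scope.
Local Open Scope ring_scope.
Local Open Scope quotient_scope.

(* ab-words are sequences of booleans, with false for a and true for b. *)
Definition abpoly := {malg int[{fmonom bool}]}.

Definition abword (u : seq bool) : abpoly := << FMonom u >>.

Definition ab_a : abpoly := abword [:: false].
Definition ab_b : abpoly := abword [:: true].

Definition lin_ext (f : seq bool -> abpoly) (p : abpoly) : abpoly :=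
  \sum_(m <- msupp p) p@_m *: f m.

Definition ab_rev : abpoly -> abpoly := lin_ext (fun u => abword (rev u)).

(* cut_at u 0 [:: i_1; ...; i_(k-1)] lists the k words that are left when the
   letters of u at the (0-based, increasing) positions i_j are deleted. *)
Fixpoint cut_at (u : seq bool) (start : nat) (s : seq nat) : seq (seq bool) :=
  if s is i :: s' then drop start (take i u) :: cut_at u i.+1 s'
  else [:: drop start u].

(* The sum over all the terms u_(1) (x) ... (x) u_(k) of the (k-1)-fold
   coproduct of the word u of F [:: u_(1); ...; u_(k)]. *)
Definition coprod_sum (k : nat) (F : seq (seq bool) -> abpoly)
    (u : seq bool) : abpoly :=
  \sum_(I : {set 'I_(size u)} | #|I| == k.-1)
    F (cut_at u 0 [seq val i | i <- enum I]).

Definition kappa (v : seq bool) : abpoly :=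
  if v == nseq (size v) false then (ab_a - ab_b) ^+ size v else 0.

Definition eta (v : seq bool) : abpoly :=
  if `[< exists m k, v = nseq m true ++ nseq k false >]
  then 2%:R * (ab_a - ab_b) ^+ size v else 0.

Definition lambda_t (v : seq bool) : abpoly :=
  if `[< exists m, v = nseq m true \/ v = rcons (nseq m true) false >]
  then (ab_a - ab_b) ^+ size v else 0.

Definition phi_t_term (vs : seq (seq bool)) : abpoly :=
  match vs with
  | [::] => 0
  | [:: v] => kappa v
  | v :: w :: ws =>
      kappa v * (\prod_(x <- belast w ws) (ab_b * eta x))
      * ab_b * lambda_t (last w ws)
  end.

Definition phi_tk (k : nat) : abpoly -> abpoly :=
  lin_ext (coprod_sum k phi_t_term).

(* A word of length N has no decomposition into k parts when k > N + 1, so the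
   sum over all k >= 1 stops at k = N + 1. *)
Definition phi_t : abpoly -> abpoly :=
  lin_ext (fun u => \sum_(1 <= k < (size u).+2) phi_tk k (abword u)).

(* The data entering the ab-index: the elements of the poset form a set in a
   possibly larger type. *)
Record ranked_poset := RankedPoset {
  rp_type : choiceType;
  rp_elt : set rp_type;
  rp_le : rp_type -> rp_type -> Prop;
  rp_bot : rp_type;
  rp_top : rp_type;
  rp_rank : rp_type -> nat
}.

Section AbIndex.
Variable P : ranked_poset.

Definition rp_lt : rel (rp_type P) := fun x y => (x != y) && `[< rp_le x y >].

Definition rp_chains (s : seq nat) : set (seq (rp_type P)) :=
  [set c | [/\ forall x, x \in c -> rp_elt x,
               path rp_lt (rp_bot P) (rcons c (rp_top P)) &
               [seq rp_rank x | x <- c] = s]].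

Definition rp_N : nat := (rp_rank (rp_top P)).-1.

(* The index i : 'I_N stands for the rank i.+1. *)
Definition flag_f (S : {set 'I_rp_N}) : nat :=
  #|` fset_set (rp_chains [seq (val i).+1 | i <- enum S])|.

Definition flag_h (S : {set 'I_rp_N}) : int :=
  \sum_(T : {set 'I_rp_N} | T \subset S) (-1) ^+ #|S :\: T| * (flag_f T)%:Z.

Definition ab_index : abpoly :=
  \sum_(S : {set 'I_rp_N}) flag_h S *: abword [seq i \in S | i <- enum 'I_rp_N].

End AbIndex.

Section Torus.
Variables (R : realType) (n : nat).

Definition lattice_eq : rel 'rV[R]_n := fun x y =>
  `[< exists k : 'rV[int]_n, x - y = map_mx intr k >].

Lemma lattice_eq_refl : reflexive lattice_eq.
Proof. by move=> x; apply/asboolP; exists 0; rewrite subrr map_mx0. Qed.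

Lemma lattice_eq_sym : symmetric lattice_eq.
Proof.
have H x y : lattice_eq x y -> lattice_eq y x.
  move=> /asboolP[k kE]; apply/asboolP; exists (- k).
  by rewrite map_mxN -kE opprB.
by move=> x y; apply/idP/idP; exact: H.
Qed.

Lemma lattice_eq_trans : transitive lattice_eq.
Proof.
move=> y x z /asboolP[k kE] /asboolP[l lE]; apply/asboolP; exists (k + l).
by rewrite map_mxD -kE -lE addrA subrK.
Qed.

Canonical lattice_equiv :=
  EquivRel lattice_eq lattice_eq_refl lattice_eq_sym lattice_eq_trans.

Definition torus := quotient_topology {eq_quot lattice_equiv}.

HB.instance Definition _ := Topological.on torus.

Definition torus_proj (x : 'rV[R]_n) : torus := \pi_torus x.

Definition toric_hyperplane (h : set torus) : Prop :=
  exists (a : 'rV[rat]_n) (b : R),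
    a != 0 /\
    h = torus_proj @` [set x : 'rV[R]_n | \sum_(i < n) ratr (a 0 i) * x 0 i = b].

Definition toric_arrangement (H : set (set torus)) : Prop :=
  finite_set H /\ (forall h, H h -> toric_hyperplane h).

Definition affine_hull_dim (F : set 'rV[R]_n) (d : nat) : Prop :=
  exists (p : 'rV[R]_n) (V : {vspace 'rV[R]_n}),
    [/\ F p, (forall x, F x -> x - p \in V),
        (forall W : {vspace 'rV[R]_n},
           (forall x, F x -> x - p \in W) -> (V <= W)%VS)
      & \dim V = d].

(* Every flat is the image of an affine subspace of R^n and every cell is the
   image of a relatively open convex polyhedron; the dimension does not depend
   on the convex set F, by a Baire category argument. *)
Definition torus_dim (X : set torus) : nat :=
  xget 0%N [set d | exists F : set 'rV[R]_n,
    [/\ convex_set F, X = torus_proj @` F & affine_hull_dim F d]].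

Variable H : set (set torus).

Definition flats : set (set torus) :=
  [set X | exists2 S, S `<=` H &
     exists2 x, (\bigcap_(h in S) h) x &
       X = connected_component (\bigcap_(h in S) h) x].

Definition intersection_poset_elt : set (set torus) := flats `|` [set set0].

Definition intersection_rank (X : set torus) : nat :=
  if X == set0 then n.+2 else ((n - torus_dim X).+1)%N.

(* None is the adjoined minimum; the maximum is the empty set. *)
Definition intersection_poset_bot : ranked_poset :=
  {| rp_type := option (set torus);
     rp_elt := [set x | if x is Some X then intersection_poset_elt X else True];
     rp_le := fun x y => match x, y with
                         | None, _ => True
                         | Some _, None => False
                         | Some X, Some Y => Y `<=` X
                         end;
     rp_bot := None;
     rp_top := Some set0;
     rp_rank := fun x => if x is Some X then intersection_rank X else 0%N |}.

(* The cell through x is the connected component of x in the set of the points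
   that lie on exactly the same hyperplanes as x. *)
Definition toric_cells : set (set torus) :=
  [set C | exists x : torus,
     C = connected_component [set y | forall h, H h -> (h y <-> h x)] x].

End Torus.

Inductive face (X : Type) := EmptyFace | Cell of set X | WholeSpace.
Arguments EmptyFace {X}.
Arguments WholeSpace {X}.

HB.instance Definition _ (X : Type) := gen_eqMixin (face X).
HB.instance Definition _ (X : Type) := gen_choiceMixin (face X).

Definition toric_face_poset (R : realType) (n : nat)
    (H : set (set (torus R n))) : ranked_poset :=
  {| rp_type := face (torus R n);
     rp_elt := [set x | if x is Cell C then toric_cells H C else True];
     rp_le := fun x y => match x, y with
                         | EmptyFace, _ => True
                         | _, WholeSpace => True
                         | Cell C, Cell D => closure C `<=` closure D
                         | _, _ => False
                         end;
     rp_bot := EmptyFace;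
     rp_top := WholeSpace;
     rp_rank := fun x => match x with
                         | EmptyFace => 0%N
                         | Cell C => (torus_dim C).+1
                         | WholeSpace => n.+2
                         end |}.

Section RegularCellComplex.
Variables (R : realType) (X : topologicalType).

Definition closed_disk (d : nat) : set 'rV[R]_d :=
  [set x | \sum_(i < d) x 0 i ^+ 2 <= 1].

Definition open_disk (d : nat) : set 'rV[R]_d :=
  [set x | \sum_(i < d) x 0 i ^+ 2 < 1].

Arguments closed_disk : clear implicits.
Arguments open_disk : clear implicits.

(* The closure of C is a closed d-ball whose interior is C; f and g are mutually
   inverse homeomorphisms. *)
Definition ball_cell (d : nat) (C : set X) : Prop :=
  exists (f : 'rV[R]_d -> X) (g : X -> 'rV[R]_d),
    [/\ {within closed_disk d, continuous f},
        {within closure C, continuous g},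
        {in closed_disk d, cancel f g},
        f @` closed_disk d = closure C
      & f @` open_disk d = C].

(* A finite collection of closed balls in a Hausdorff space, whose interiors
   partition the space and whose boundaries are unions of members of the
   collection; cells collects the open cells. *)
Definition regular_cell_complex (cells : set (set X)) (dim : set X -> nat) :=
  [/\ hausdorff_space X, finite_set cells,
      \bigcup_(C in cells) C = setT, trivIset cells id
    & forall C, cells C ->
        ball_cell (dim C) C /\
        exists2 B, B `<=` cells &
          closure C `\` C = \bigcup_(E in B) closure E].

End RegularCellComplex.

(* Main.v *)
From HB Require Import structures.
Require Import Defs.
From mathcomp Require Import all_boot all_order all_algebra.
From mathcomp Require Import finmap zify lra.
From mathcomp.multinomials Require Import monalg.
From mathcomp Require Import all_classical all_reals topology normedtype convex.
From mathcomp Require Import interval_inference measure lebesgue_measure.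

(* Write c = a - b.  Both ab-indices are sums over chains of words in b and c, so
   that the reversed ab-index of T_t sums chains of cells from the largest cell
   downwards.  The coproduct kills c and sends b to 1 (x) 1; hence phi_t is
   given on words in b and c by a short recursion, with an auxiliary operator T
   for the part after the first cut.  Let Q(x) be the ab-index of the interval
   above the flat x and U(C) the chain sum of the cells below the cell C.
   By induction, T(Q(x)) is the sum of U(C) over the cells C that span x, once
   two Euler relations are known: the signed number of the cells of a flat x
   around a fixed cell is (-1)^(dim x), and the signed number of all the cells
   of x is 0, or 1 when x is a point.

   Both relations come from the fact that cutting a relatively open convex set
   by hyperplanes does not change its signed number of cells.  For the second
   one, pass to R^n and superpose on the periodic arrangement its image under a
   homothety of ratio 1/2: the signed number of cells modulo the lattice
   directions of the flat is unchanged, but it is also multiplied by the index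
   of 2 Lambda in Lambda, which is at least 2.

   Regularity enters only through this: no nonzero lattice vector joins two
   points of the closure of a cell of R^n, because the segment between them
   would project to a loop in a closed ball, and contracting that loop shows
   that its lift is closed. *)

Set Implicit Arguments.
Unset Strict Implicit.
Unset Printing Implicit Defensive.

Import Order.TTheory GRing.Theory Num.Theory.
Import numFieldNormedType.Exports.

Local Open Scope classical_set_scope.
Local Open Scope ring_scope.

(** * The operator phi_t on words *)


(** In the letters b and c the alternating sums h_S turn into plain chain counts, and the signs
    reappear only in T: on c^j b p its coefficients are 1 + (-1)^j and (-1)^j, where j + 1 is the
    codimension of the next flat. Resumming these signs is the task of the Euler relations. The
    obstacle is that those relations concern cells of the torus, while convexity is available only
    in R^n. Two faces around a point of R^n could be lifts of one cell, which would spoil the local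
    count; two pieces of a refined cell could be lattice translates of each other, which would spoil
    the global one. Freeness of the translations excludes both. Rationality of the normals serves
    twice: it makes the lifted hyperplanes locally finite, and it provides a nonzero lattice vector
    along every flat of positive dimension, which is why 2 Lambda is a proper subgroup of Lambda. *)

Definition ab_c : abpoly := ab_a - ab_b.

Lemma lin_extEw (f : seq bool -> abpoly) (d : {fset {fmonom bool}})
    (p : abpoly) : (msupp p `<=` d)%fset ->
  lin_ext f p = \sum_(m <- d) p@_m *: f m.
Proof.
move=> le_pd; rewrite /lin_ext (big_fset_incl _ le_pd) //= => m _ mp.
by rewrite mcoeff_outdom // scale0r.
Qed.

Lemma lin_ext_is_linear (f : seq bool -> abpoly) : linear (lin_ext f).
Proof.
move=> k p q; set d := (msupp p `|` msupp q)%fset.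
have dp : (msupp p `<=` d)%fset by apply: fsubsetUl.
have dq : (msupp q `<=` d)%fset by apply: fsubsetUr.
have dpq : (msupp (k *: p + q) `<=` d)%fset.
  apply: fsubset_trans (msuppD_le _ _) _; apply: fsetUSS => //.
  exact: msuppZ_le.
rewrite (lin_extEw f dp) (lin_extEw f dq) (lin_extEw f dpq).
rewrite scaler_sumr -big_split /=; apply: eq_bigr => m _.
by rewrite mcoeffD mcoeffZ scalerDl scalerA.
Qed.

HB.instance Definition _ (f : seq bool -> abpoly) :=
  GRing.isLinear.Build int abpoly abpoly _ (lin_ext f) (lin_ext_is_linear f).

Lemma lin_ext_word f u : lin_ext f (abword u) = f u.
Proof.
rewrite (@lin_extEw _ [fset (FMonom u)]%fset) ?msuppU_le //.
by rewrite big_seq_fset1 mcoeffUU scale1r.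
Qed.

Lemma abpoly_sum (p : abpoly) : p = \sum_(m <- msupp p) p@_m *: abword m.
Proof.
rewrite {1}(monalgE p); apply: eq_bigr => m _; apply/malgP => k.
by rewrite mcoeffZ !mcoeffU fmK mulr_natr.
Qed.

Lemma abword_cat u v : abword (u ++ v) = abword u * abword v.
Proof. by rewrite malgM_def fgmulUU mulr1 /= /mmul /= fmmulE. Qed.

Lemma abword_nil : abword [::] = 1.
Proof. by apply/malgP => k; rewrite mcoeffU mcoeff1 /mone /= fmoneE eq_sym. Qed.

Lemma abword_cons x u : abword (x :: u) = (if x then ab_b else ab_a) * abword u.
Proof. by rewrite -cat1s abword_cat; case: x. Qed.

Local Opaque ab_a ab_b fgmul fgadd fgopp fgscale.

Lemma ab_scalerAr (k : int) (p q : abpoly) : p * (k *: q) = k *: (p * q).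
Proof. by rewrite -(intz k) !scaler_int mulrzAr. Qed.

Lemma lin_ext_cons x f p :
  lin_ext f ((if x then ab_b else ab_a) * p) = lin_ext (fun u => f (x :: u)) p.
Proof.
rewrite {1}(abpoly_sum p) mulr_sumr linear_sum /lin_ext /=.
apply: eq_bigr => m _; rewrite -[RHS]/(p@_m *: f (x :: m)).
by rewrite ab_scalerAr linearZ /= -abword_cons lin_ext_word.
Qed.

Lemma lin_ext_add f g p :
  lin_ext (fun u => f u + g u) p = lin_ext f p + lin_ext g p.
Proof.
by rewrite /lin_ext -big_split; apply: eq_bigr => m _; rewrite scalerDr.
Qed.

Lemma lin_ext_mul q f p : lin_ext (fun u => q * f u) p = q * lin_ext f p.
Proof.
by rewrite /lin_ext mulr_sumr; apply: eq_bigr => m _; rewrite ab_scalerAr.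
Qed.

(** The split by whether 0 occurs is the form in which a sum over sets of positions follows the
    first letter of a word. *)
Fixpoint incs (n : nat) : seq (seq nat) :=
  if n is n'.+1 then
    [seq 0%N :: map S s | s <- incs n'] ++ [seq map S s | s <- incs n']
  else [:: [::]].

Definition vals n (I : {set 'I_n}) : seq nat := [seq val i | i <- enum I].

Lemma vals_sorted n (I : {set 'I_n}) : sorted ltn (vals I).
Proof.
rewrite /vals sorted_map; apply: (@subseq_sorted _ (relpre val ltn) _ _ (enum 'I_n)).
- by move=> x y z /=; exact: ltn_trans.
- by rewrite enumT; exact: filter_subseq.
- by rewrite -sorted_map val_enum_ord iota_ltn_sorted.
Qed.

Lemma mem_vals n (I : {set 'I_n}) k :
  (k \in vals I) = [exists i in I, val i == k].
Proof.
apply/mapP/exists_inP => [[i] | [i iI /eqP <-]].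
  by rewrite mem_enum => iI ->; exists i.
by exists i; rewrite ?mem_enum.
Qed.

Lemma mem_vals_val n (I : {set 'I_n}) (i : 'I_n) : (val i \in vals I) = (i \in I).
Proof. by rewrite mem_map ?mem_enum //; exact: val_inj. Qed.

Lemma mem_incs n s : (s \in incs n) = sorted ltn s && all (fun k => k < n)%N s.
Proof.
have succ_pred t : all (ltn 0) t -> t = map S (map predn t).
  by elim: t => //= k t IH /andP[k_gt0 /IH <-]; rewrite prednK.
elim: n s => [|n IH] s; first by case: s => //= k s; rewrite andbF.
rewrite /= mem_cat; apply/orP/andP => [[] /mapP[t] | [s_sorted s_lt]].
- rewrite IH => /andP[t_sorted t_lt] ->; split; last first.
    by rewrite /= all_map.
  by case: t t_sorted {t_lt} => //= k t; rewrite path_map.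
- rewrite IH => /andP[t_sorted t_lt] ->; rewrite all_map sorted_map.
  by split.
have shift t : all (ltn 0) t -> sorted ltn t -> all (fun k => k < n.+1)%N t ->
    map predn t \in incs n.
  move=> t_gt0; rewrite {1 2}(succ_pred t) // IH sorted_map all_map.
  by move=> t_sorted t_lt; apply/andP.
case: s s_sorted s_lt => [|[|k] s] ks_sorted ks_lt; [right|left|right].
- by apply/mapP; exists [::]; rewrite // IH.
- have s_gt0 : all (ltn 0) s by apply: order_path_min ks_sorted; exact: ltn_trans.
  apply/mapP; exists (map predn s); last by rewrite -succ_pred.
  by apply: shift => //; exact: path_sorted ks_sorted.
- have s_gt0 : all (ltn 0) (k.+1 :: s).
    rewrite /=; have := order_path_min ltn_trans ks_sorted.
    by apply: sub_all => i /=; exact: leq_ltn_trans.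
  by apply/mapP; exists (map predn (k.+1 :: s)); [exact: shift|rewrite -succ_pred].
Qed.

Lemma incs_uniq n : uniq (incs n).
Proof.
elim: n => //= n IH; have S_inj := inj_map succn_inj.
rewrite cat_uniq (map_inj_uniq S_inj) (@map_inj_uniq _ _ (fun s => 0%N :: map S s)).
  2: by move=> s t [] /S_inj.
rewrite IH /= andbT; apply/hasPn => _ /mapP[s _ ->]; apply/mapP => -[t _].
by case: s.
Qed.

Lemma perm_vals_incs n :
  perm_eq (codom (@vals n)) (incs n).
Proof.
apply: uniq_perm; [|exact: incs_uniq|].
  rewrite /codom /image_mem map_inj_uniq ?enum_uniq // => I J IJ; apply/setP => i.
  by rewrite -!mem_vals_val IJ.
move=> s; rewrite mem_incs; apply/codomP/andP => [[I ->]|[s_sorted s_lt]].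
  split; first exact: vals_sorted.
  by apply/allP => k; rewrite mem_vals => /exists_inP[i _ /eqP <-]; exact: ltn_ord.
exists [set i : 'I_n | val i \in s]%SET.
apply: (irr_sorted_eq ltn_trans ltnn s_sorted (vals_sorted _)) => k.
rewrite mem_vals; apply/idP/exists_inP => [ks | [i + /eqP <-]].
  by exists (Ordinal (allP s_lt _ ks)); rewrite ?inE.
by rewrite inE.
Qed.

Lemma sum_vals n (V : nmodType) (F : seq nat -> V) :
  \sum_(I : {set 'I_n}) F (vals I) = \sum_(s <- incs n) F s.
Proof. by rewrite -(perm_big _ (perm_vals_incs n)) /= big_image. Qed.

Lemma cut_atS x u k s : cut_at (x :: u) k.+1 (map S s) = cut_at u k s.
Proof. by elim: s k => //= i s IH k; rewrite IH. Qed.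

Lemma cut_at_neq_nil u k s : cut_at u k s != [::].
Proof. by case: s. Qed.

(** No cut falls on the first letter, which therefore joins the first part of the remaining word. *)
Lemma cut_at0 x u s :
  cut_at (x :: u) 0 (map S s)
  = (x :: head [::] (cut_at u 0 s)) :: behead (cut_at u 0 s).
Proof. by case: s => [|i s] //=; rewrite ?drop0 // cut_atS. Qed.

Lemma if_exprS (A : pzRingType) (b : bool) (c : A) m :
  (if b then 2%:R * c ^+ m.+1 else 0) = c * (if b then 2%:R * c ^+ m else 0).
Proof. by case: b; rewrite ?mulr0 // exprS !mulr_natl mulrnAr. Qed.

(** * Letter-by-letter recursions for the maps of the theorem *)

Section Words.
Variables (A : pzRingType) (b c : A).

(** These copies of [kappa], [eta], [lambda_t] and [phi_t_term] live in an arbitrary ring, where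
    nothing of the monoid algebra can unfold; at [ab_b] and [ab_c] they are the original maps by
    conversion. *)
Definition kappa_gen (v : seq bool) : A :=
  if v == nseq (size v) false then c ^+ size v else 0.

Definition eta_gen (v : seq bool) : A :=
  if `[< exists m k, v = nseq m true ++ nseq k false >]
  then 2%:R * c ^+ size v else 0.

Definition lambda_gen (v : seq bool) : A :=
  if `[< exists m, v = nseq m true \/ v = rcons (nseq m true) false >]
  then c ^+ size v else 0.

Definition phi_term_gen (vs : seq (seq bool)) : A :=
  match vs with
  | [::] => 0
  | [:: v] => kappa_gen v
  | v :: w :: ws =>
      kappa_gen v * (\prod_(x <- belast w ws) (b * eta_gen x))
      * b * lambda_gen (last w ws)
  end.

(* The state records what has been read of the current part of the word: [0]
   stands for a word in b^*, [1] for a word in b^* a, and [2] for a word that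
   can only be completed to a word on which lambda_gen vanishes. *)
Fixpoint tail_w (s : nat) (u : seq bool) : A :=
  match u with
  | [::] => if s is s'.+2 then 0 else 1
  | x :: u' => 2%:R * b * tail_w 0 u' +
      match s, x with
      | 0%N, true => c * tail_w 0 u'
      | 0%N, false => c * tail_w 1 u'
      | _, true => 0
      | _, false => c * tail_w 2 u'
      end
  end.

(** The first summand cuts at the first letter; the second keeps it in the first part, on which
    [kappa] vanishes unless every letter is a. *)
Fixpoint phi_w (u : seq bool) : A :=
  if u is x :: u' then b * tail_w 0 u' + (if x then 0 else c * phi_w u')
  else 1.

(** What [eta_gen] still contributes when v remains to be read of the current part. Once an a has
    been read only letters a may follow, so that the states 1 and 2 differ for [lambda_s] alone. *)
Definition eta_s (s : nat) (v : seq bool) : A :=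
  if s is 0%N then eta_gen v
  else if v == nseq (size v) false then 2%:R * c ^+ size v else 0.

Definition lambda_s (s : nat) (v : seq bool) : A :=
  match s with
  | 0%N => lambda_gen v
  | 1%N => (v == [::])%:R
  | _ => 0
  end.

Fixpoint tail_term (s : nat) (vs : seq (seq bool)) : A :=
  match vs with
  | [::] => 0
  | [:: v] => lambda_s s v
  | v :: ws => eta_s s v * b * tail_term 0 ws
  end.

Lemma lambda_s_cons s x v :
  lambda_s s (x :: v) =
  match s, x with
  | 0%N, true => c * lambda_s 0 v
  | 0%N, false => c * lambda_s 1 v
  | _, true => 0
  | _, false => c * lambda_s 2 v
  end.
Proof.
case: s => [|[|s]] /=; [|by case: x; rewrite ?mulr0|by case: x; rewrite ?mulr0].
rewrite /lambda_gen; case: x.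
  suff -> : `[< exists m, true :: v = nseq m true \/
                          true :: v = rcons (nseq m true) false >] =
            `[< exists m, v = nseq m true \/ v = rcons (nseq m true) false >].
    by case: ifP; rewrite ?mulr0 // exprS.
  apply: asbool_equiv_eq; split=> [[[|m] []] // [->]|[m []] ->].
  - by exists m; left.
  - by exists m; right.
  - by exists m.+1; left.
  - by exists m.+1; right.
suff -> : `[< exists m, false :: v = nseq m true \/
                        false :: v = rcons (nseq m true) false >] = (v == [::]).
  by case: eqP => [->|_]; rewrite ?mulr0 // expr1 mulr1.
apply/asboolP/eqP => [[[|m] []] //= [] //|->].
by exists 0%N; right.
Qed.

Lemma eta_s_cons s x v :
  eta_s s (x :: v) =
  match s, x with
  | 0%N, true => c * eta_s 0 v
  | 0%N, false => c * eta_s 1 v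
  | _, true => 0
  | _, false => c * eta_s 2 v
  end.
Proof.
have cnat d m := if_exprS d c m.
case: s => [|s] /=; last by case: x => //; rewrite eqseq_cons; exact: cnat.
rewrite /eta_gen; case: x.
  suff -> : `[< exists m k, true :: v = nseq m true ++ nseq k false >] =
            `[< exists m k, v = nseq m true ++ nseq k false >] by exact: cnat.
  apply: asbool_equiv_eq; split=> [[[|m] [k]]|[m [k]] ->].
  - by case: k.
  - by move=> [->]; exists m, k.
  - by exists m.+1, k.
suff -> : `[< exists m k, false :: v = nseq m true ++ nseq k false >] =
          (v == nseq (size v) false) by exact: cnat.
apply/asboolP/eqP => [[[|m] [[|k]]] //= [->]|->]; first by rewrite size_nseq.
by exists 0%N, (size v).+1.
Qed.

Lemma eta_s_nil s : eta_s s [::] = 2%:R.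
Proof.
case: s => [|s] /=; rewrite ?mulr1 // /eta_gen asboolT ?mulr1 //.
by exists 0%N, 0%N.
Qed.

Lemma lambda_s_nil s : lambda_s s [::] = if s is s'.+2 then 0 else 1.
Proof.
by case: s => [|[|s]] //=; rewrite /lambda_gen asboolT //; exists 0%N; left.
Qed.

Lemma tail_term_nil s vs : vs != [::] ->
  tail_term s ([::] :: vs) = 2%:R * b * tail_term 0 vs.
Proof.
case: vs => [//|v vs _].
by rewrite /= eta_s_nil.
Qed.

Lemma tail_term_cons s x v vs :
  tail_term s ((x :: v) :: vs) =
  match s, x with
  | 0%N, true => c * tail_term 0 (v :: vs)
  | 0%N, false => c * tail_term 1 (v :: vs)
  | _, true => 0
  | _, false => c * tail_term 2 (v :: vs)
  end.
Proof.
case: vs => [|w vs]; first exact: lambda_s_cons.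
have tailE r y : tail_term r (y :: w :: vs) =
  eta_s r y * b * tail_term 0 (w :: vs) by [].
rewrite !tailE eta_s_cons; move: (tail_term 0 (w :: vs)) => q.
by case: s => [|s]; case: x; rewrite ?mul0r ?mulrA.
Qed.

Lemma tail_wE s u :
  \sum_(t <- incs (size u)) tail_term s (cut_at u 0 t) = tail_w s u.
Proof.
elim: u s => [|x u IH] s; first by rewrite big_seq1 /= lambda_s_nil.
rewrite /incs -/incs big_cat /= !big_map; congr (_ + _).
  rewrite -IH mulr_sumr; apply: eq_bigr => t _.
  by rewrite [cut_at _ _ _]/= cut_atS tail_term_nil ?cut_at_neq_nil.
have cutE t : cut_at u 0 t = head [::] (cut_at u 0 t) :: behead (cut_at u 0 t).
  by case: t.
under eq_bigr do rewrite cut_at0 tail_term_cons -cutE.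
by case: s => [|s]; case: x; rewrite -?mulr_sumr ?IH // big1.
Qed.

Lemma phi_term_gen_cons v vs : vs != [::] ->
  phi_term_gen (v :: vs) = kappa_gen v * b * tail_term 0 vs.
Proof.
case: vs => // w ws _ /=; rewrite -!mulrA; congr (_ * _).
elim: ws w => [|w' ws IH] w /=; first by rewrite big_nil mul1r.
by rewrite big_cons -mulrA IH !mulrA.
Qed.

Lemma phi_wE u : \sum_(t <- incs (size u)) phi_term_gen (cut_at u 0 t) = phi_w u.
Proof.
elim: u => [|x u IH]; first by rewrite big_seq1 /= /kappa_gen eqxx.
rewrite /incs -/incs big_cat /= !big_map; congr (_ + _).
  rewrite -tail_wE mulr_sumr; apply: eq_bigr => t _.
  rewrite [cut_at _ _ _]/= cut_atS phi_term_gen_cons ?cut_at_neq_nil //.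
  by rewrite /kappa_gen eqxx mul1r.
have phi_cons v vs : phi_term_gen ((x :: v) :: vs) =
    if x then 0 else c * phi_term_gen (v :: vs).
  have kappa_cons : kappa_gen (x :: v) = if x then 0 else c * kappa_gen v.
    rewrite /kappa_gen /= eqseq_cons; case: x => //=.
    by case: ifP; rewrite ?mulr0 // exprS.
  case: vs => [|w vs]; first exact: kappa_cons.
  by rewrite !phi_term_gen_cons // kappa_cons; case: {kappa_cons} x; rewrite ?mul0r ?mulrA.
have cutE t : cut_at u 0 t = head [::] (cut_at u 0 t) :: behead (cut_at u 0 t).
  by case: t.
case: x phi_cons => phi_cons.
  by rewrite big1 // => t _; rewrite cut_at0 phi_cons.
by rewrite -IH mulr_sumr; apply: eq_bigr => t _; rewrite cut_at0 phi_cons -cutE.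
Qed.

End Words.

(** A set I of cut positions occurs for exactly one k, namely [#|I| + 1], and this k is within the
    bound because I has at most as many elements as the word has letters. *)
Lemma phi_tE : phi_t =1 lin_ext (phi_w ab_b ab_c).
Proof.
move=> p; rewrite /phi_t /lin_ext; apply: eq_bigr => m _; congr (_ *: _).
rewrite -phi_wE -sum_vals; set u := fmonom_val m.
under eq_bigr do rewrite /phi_tk lin_ext_word /coprod_sum.
rewrite big_add1 big_mkord /= (exchange_big_dep predT) //=.
apply: eq_bigr => I _; rewrite big_mkcond /=.
have I_lt : (#|I| < (size u).+1)%N by rewrite ltnS -[X in (_ <= X)%N]card_ord max_card.
rewrite (bigD1 (Ordinal I_lt)) //= eqxx big1 ?addr0 // => k.
by rewrite eq_sym -val_eqE /= => /negPf ->.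
Qed.

Lemma lin_ext_letter (x : bool) (f g h : seq bool -> abpoly) (q r p : abpoly) :
  (forall u, f (x :: u) = q * g u + r * h u) ->
  lin_ext f ((if x then ab_b else ab_a) * p) = q * lin_ext g p + r * lin_ext h p.
Proof.
move=> fE; apply: etrans (lin_ext_cons x f p) _.
rewrite (funext fE); apply: etrans (lin_ext_add _ _ _) _.
exact: congr2 (lin_ext_mul _ _ _) (lin_ext_mul _ _ _).
Qed.

Lemma lin_ext_c f p :
  lin_ext f (ab_c * p) = lin_ext f (ab_a * p) - lin_ext f (ab_b * p).
Proof. by rewrite /ab_c mulrBl linearB. Qed.

Local Notation tail s := (lin_ext (tail_w ab_b ab_c s)).
Local Notation phi := (lin_ext (phi_w ab_b ab_c)).

Lemma phi_b p : phi (ab_b * p) = ab_b * tail 0 p.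
Proof.
have E u : phi_w ab_b ab_c (true :: u) =
    ab_b * tail_w ab_b ab_c 0 u + 0 * phi_w ab_b ab_c u.
  exact: (congr1 (+%R _) (esym (mul0r _))).
apply: etrans (lin_ext_letter p E) _.
by rewrite mul0r addr0.
Qed.

Lemma phi_a p : phi (ab_a * p) = ab_b * tail 0 p + ab_c * phi p.
Proof. exact: (@lin_ext_letter false). Qed.

(** Cutting at the first letter contributes the same for a and for b, hence cancels in c; only the
    terms that keep this letter survive. The rules for c below arise in the same way. *)
Lemma phi_c p : phi (ab_c * p) = ab_c * phi p.
Proof.
apply: etrans (lin_ext_c _ _) (etrans (congr2 (fun q r => q - r) (phi_a p) (phi_b p)) _).
by move: (ab_b * _) (ab_c * _) => q r; rewrite addrAC subrr add0r.
Qed.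

Lemma tail0_b p : tail 0 (ab_b * p) = 2%:R * ab_b * tail 0 p + ab_c * tail 0 p.
Proof. exact: (@lin_ext_letter true). Qed.

Lemma tailS_b s p : tail s.+1 (ab_b * p) = 2%:R * ab_b * tail 0 p.
Proof.
have E u : tail_w ab_b ab_c s.+1 (true :: u) =
    2%:R * ab_b * tail_w ab_b ab_c 0 u + 0 * phi_w ab_b ab_c u.
  exact: (congr1 (+%R _) (esym (mul0r _))).
apply: etrans (lin_ext_letter p E) _.
by rewrite mul0r addr0.
Qed.

Lemma tail0_a p : tail 0 (ab_a * p) = 2%:R * ab_b * tail 0 p + ab_c * tail 1 p.
Proof. exact: (@lin_ext_letter false). Qed.

Lemma tailS_a s p :
  tail s.+1 (ab_a * p) = 2%:R * ab_b * tail 0 p + ab_c * tail 2 p.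
Proof. exact: (@lin_ext_letter false). Qed.

Lemma tail0_c p : tail 0 (ab_c * p) = ab_c * tail 1 p - ab_c * tail 0 p.
Proof.
apply: etrans (lin_ext_c _ _)
  (etrans (congr2 (fun q r => q - r) (tail0_a p) (tail0_b p)) _).
have cancel (V : zmodType) (x y z : V) : x + y - (x + z) = y - z.
  by rewrite opprD addrACA subrr add0r.
exact: cancel.
Qed.

Lemma tailS_c s p : tail s.+1 (ab_c * p) = ab_c * tail 2 p.
Proof.
apply: etrans (lin_ext_c _ _)
  (etrans (congr2 (fun q r => q - r) (tailS_a s p) (tailS_b s p)) _).
by move: (2%:R * _ * _) (ab_c * _) => q r; rewrite addrAC subrr add0r.
Qed.

Lemma tail_nil s : tail s 1 = if s is s'.+2 then 0 else 1.
Proof. by rewrite -{1}abword_nil lin_ext_word. Qed.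

Lemma phi_nil : phi 1 = 1.
Proof. by rewrite -{1}abword_nil lin_ext_word. Qed.

(** * From chains of flats to chains of cells *)


Lemma mulrz_suml (V : zmodType) I (r : seq I) (P : pred I) (F : I -> V) z :
  (\sum_(i <- r | P i) F i) *~ z = \sum_(i <- r | P i) F i *~ z.
Proof. exact: (big_morph _ (mulrzDl z) (mul0rz _ z)). Qed.

Lemma mulrz_sumr (V : zmodType) I (r : seq I) (P : pred I) (x : V) F :
  x *~ (\sum_(i <- r | P i) F i) = \sum_(i <- r | P i) x *~ F i.
Proof. exact: (big_morph _ (mulrzDr x) (mulr0z x)). Qed.

Lemma sum_pred1_uniq (V : nmodType) (I : eqType) (F : I -> V) (r : seq I) i :
  uniq r -> i \in r -> \sum_(j <- r | j == i) F j = F i.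
Proof.
move=> r_uniq ir; rewrite big_mkcond (bigD1_seq i) //= eqxx big1 ?addr0 //.
by move=> j /negPf ->.
Qed.

Section TailAlgebra.
Variables (A : pzRingType) (b c : A).
Variables (tl : nat -> {additive A -> A}) (ph : {additive A -> A}).
Hypothesis tl0_b : forall p, tl 0 (b * p) = 2%:R * b * tl 0 p + c * tl 0 p.
Hypothesis tlS_b : forall s p, tl s.+1 (b * p) = 2%:R * b * tl 0 p.
Hypothesis tl0_c : forall p, tl 0 (c * p) = c * tl 1 p - c * tl 0 p.
Hypothesis tlS_c : forall s p, tl s.+1 (c * p) = c * tl 2 p.
Hypothesis tl_1 : forall s, tl s 1 = if s is s'.+2 then 0 else 1.
Hypothesis ph_b : forall p, ph (b * p) = b * tl 0 p.
Hypothesis ph_c : forall p, ph (c * p) = c * ph p.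
Hypothesis ph_1 : ph 1 = 1.

Lemma ph_cX j : ph (c ^+ j) = c ^+ j.
Proof. by elim: j => [|j IH]; rewrite ?ph_1 // exprS ph_c IH. Qed.

Lemma ph_cXb j p : ph (c ^+ j * b * p) = c ^+ j * b * tl 0 p.
Proof.
elim: j => [|j IH]; first by rewrite mul1r ph_b.
by rewrite exprS -!mulrA ph_c !mulrA IH !mulrA.
Qed.

Lemma tl2_cX j : tl 2 (c ^+ j) = 0.
Proof. by elim: j => [|j IH]; rewrite ?tl_1 // exprS tlS_c IH mulr0. Qed.

(** The states 0 and 1 both accept the empty word, so that the two terms of [tl0_c] cancel for j =
    1; for larger j each of them vanishes. *)
Lemma tl0_cX j : tl 0 (c ^+ j) = (j == 0%N)%:R.
Proof.
elim: j => [|j IH]; first exact: tl_1.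
rewrite exprS tl0_c IH; case: j {IH} => [|j]; first by rewrite tl_1 subrr.
by rewrite exprS tlS_c tl2_cX !mulr0 subrr.
Qed.

Lemma tlS_cXb s j p : tl s.+1 (c ^+ j * b * p) = 2%:R * (c ^+ j * b * tl 0 p).
Proof.
elim: j s => [|j IH] s; first by rewrite expr0 !mul1r tlS_b mulrA.
by rewrite exprS -!mulrA tlS_c mulrA IH !mulr_natl mulrnAr !mulrA.
Qed.

(** By the minus sign in [tl0_c], one more c replaces the coefficient e of the first term by 2 - e
    and negates the second term. *)
Lemma tl0_cXb j p :
  tl 0 (c ^+ j * b * p) =
  (c ^+ j * b * tl 0 p) *~ (1 + (-1) ^+ j) + (c ^+ j.+1 * tl 0 p) *~ (-1) ^+ j.
Proof.
elim: j => [|j IH].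
  by rewrite !expr0 !mul1r expr1 tl0_b mulrzDr !mulr1z -mulrA mulr_natl mulr2n.
rewrite exprS -!mulrA tl0_c [c ^+ j * (b * p)]mulrA IH tlS_cXb.
rewrite mulrDr !mulrzAr !mulr_natl mulrnAr !mulrA -!exprS.
rewrite opprD addrA -!mulrNz; rewrite [(-1) ^+ j.+1]exprS mulN1r; congr (_ + _).
by rewrite pmulrn -mulrzDr; congr (_ *~ _); rewrite opprD addrA.
Qed.

(** * Flats against cells, from two Euler relations *)

Section Duality.
Variables (X Y : eqType) (L : seq X) (Cs : seq Y) (N : nat).
Variables (ltX : rel X) (gtY : rel Y) (supp : Y -> X).
Variables (rX : X -> nat) (rY : Y -> nat).
Hypothesis L_uniq : uniq L.
Hypothesis Cs_uniq : uniq Cs.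
Hypothesis rX_le : forall x, x \in L -> (rX x <= N)%N.
Hypothesis ltX_rank : forall x y, x \in L -> y \in L -> ltX x y -> (rX x < rX y)%N.
Hypothesis ltX_trans : transitive ltX.
Hypothesis supp_L : forall C, C \in Cs -> supp C \in L.
Hypothesis rY_supp : forall C, C \in Cs -> rY C = rX (supp C).
Hypothesis gtY_supp : forall C D, C \in Cs -> D \in Cs -> gtY C D ->
  ltX (supp C) (supp D).
Hypothesis euler_local : forall x E, x \in L -> E \in Cs -> ltX x (supp E) ->
  \sum_(C <- Cs | ((C == E) || gtY C E) && ((x == supp C) || ltX x (supp C)))
     (-1) ^+ rY C = (-1) ^+ rX x :> int.
Hypothesis euler_global : forall x, x \in L ->
  \sum_(C <- Cs | (x == supp C) || ltX x (supp C)) (-1) ^+ rY C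
  = (if rX x == N then (-1) ^+ N else 0) :> int.
Variables (Q : X -> A) (U : Y -> A).
Hypothesis QE : forall x, x \in L ->
  Q x = c ^+ (N - rX x)
        + \sum_(y <- L | ltX x y) c ^+ (rX y - rX x).-1 * b * Q y.
Hypothesis UE : forall C, C \in Cs ->
  U C = c ^+ (N - rY C)
        + \sum_(D <- Cs | gtY C D) c ^+ (rY D - rY C).-1 * b * U D.

(** Induction on [N - rX x]. Expanding Q x at the first flat y, and then by induction at the cells
    spanning y, produces signed terms over the cells strictly above x; the Euler relations resum
    them to the cells spanning x. *)
Lemma tl_flats x : x \in L -> tl 0 (Q x) = \sum_(C <- Cs | supp C == x) U C.
Proof.
have [m] := ubnP (N - rX x); elim: m x => // m IH x lexm xL.
set r := rX x; pose j C := (rY C - r).-1.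
(* In a chain sum that starts at rank r, [W E] collects the chains whose next element is E, and
   [V C] is U C with its powers of c shifted to that start. [eps C] is the sign of the rank
   difference between C and x. *)
pose W E := c ^+ j E * b * U E.
pose V C := c ^+ (N - r) + \sum_(E <- Cs | gtY C E) W E.
pose eps C : int := (-1) ^+ (rY C + r).
have rank_gt C : C \in Cs -> ltX x (supp C) -> (r < rY C)%N.
  by move=> CC xC; rewrite rY_supp // ltX_rank // supp_L.
have rank_gtY C D : C \in Cs -> D \in Cs -> gtY C D -> (rY C < rY D)%N.
  by move=> CC DC CD; rewrite !rY_supp // ltX_rank ?supp_L // gtY_supp.
have gtY_irr E : E \in Cs -> gtY E E = false.
  by move=> EC; apply/negP => /(rank_gtY _ _ EC EC); rewrite ltnn.
have ltx_gtY C E : C \in Cs -> E \in Cs -> gtY C E ->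
    (x == supp C) || ltX x (supp C) -> ltX x (supp E).
  move=> CC EC CE /orP[/eqP ->|xC]; first exact: gtY_supp.
  exact: ltX_trans xC (gtY_supp CC EC CE).
have VE C : C \in Cs -> (x == supp C) || ltX x (supp C) ->
    c ^+ (rY C - r) * U C = V C.
  move=> CC xC; have rC : (r <= rY C)%N.
    by case/orP: xC => [/eqP xC|/(rank_gt _ CC)/ltnW//]; rewrite rY_supp -?xC.
  have CN : (rY C <= N)%N by rewrite rY_supp // rX_le // supp_L.
  rewrite UE // mulrDr -exprD.
  have -> : (rY C - r + (N - rY C) = N - r)%N by lia.
  congr (_ + _).
  rewrite mulr_sumr big_seq_cond [RHS]big_seq_cond; apply: eq_bigr => E.
  move=> /andP[EC CE]; rewrite !mulrA -exprD; congr (c ^+ _ * _ * _).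
  by have := rank_gtY _ _ CC EC CE; rewrite /j; lia.
have epsE C : C \in Cs -> ltX x (supp C) -> (-1) ^+ j C = - eps C.
  move=> CC /(rank_gt _ CC) rC; rewrite /eps /j -signr_odd -[in RHS]signr_odd.
  have -> : odd (rY C + r) = ~~ odd (rY C - r).-1 by lia.
  by case: (odd _); rewrite ?opprK.
have step : tl 0 (Q x) = (N - r == 0)%N%:R +
    \sum_(C <- Cs | ltX x (supp C)) (W C *~ (1 - eps C) - V C *~ eps C).
  rewrite QE // raddfD raddf_sum tl0_cX; congr (_ + _).
  transitivity (\sum_(y <- L | ltX x y) \sum_(C <- Cs | supp C == y)
      (W C *~ (1 - eps C) - V C *~ eps C)).
    rewrite big_seq_cond [RHS]big_seq_cond; apply: eq_bigr => y /andP[yL xy].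
    rewrite /= tl0_cXb IH //; last first.
      by have := ltX_rank xL yL xy; have := rX_le yL; lia.
    rewrite !mulr_sumr !mulrz_suml -big_split big_seq_cond [RHS]big_seq_cond.
    apply: eq_bigr => C /andP[CC /eqP Cy]; rewrite -Cy in xy *.
    rewrite -rY_supp // -/(j C) -/(W C) prednK; last first.
      by rewrite subn_gt0 rank_gt.
    by rewrite VE ?xy ?orbT // epsE // mulrNz.
  rewrite (exchange_big_dep (fun C => ltX x (supp C))) /=; last first.
    by move=> y C xy /eqP ->.
  rewrite big_seq_cond [RHS]big_seq_cond; apply: eq_bigr => C /andP[CC xC].
  rewrite (eq_bigl (pred1 (supp C))); last first.
    by move=> y /=; rewrite eq_sym; case: eqP => [->|]; rewrite ?xC ?andbF.
  by rewrite (sum_pred1_uniq _ L_uniq) // supp_L.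
have xx : ltX x x = false.
  by apply/negP => /(ltX_rank xL xL); rewrite ltnn.
(* The cells spanning x have sign 1 and satisfy [V C = U C]; splitting the left side of [main] into
   these and the other cells gives the claim. *)
suff main : \sum_(C <- Cs | (x == supp C) || ltX x (supp C)) V C *~ eps C =
    (N - r == 0)%N%:R + \sum_(C <- Cs | ltX x (supp C)) W C *~ (1 - eps C).
  rewrite step big_split /= addrA -main sumrN (bigID (fun C => ltX x (supp C))) /=.
  rewrite addrAC [X in X - _ + _](eq_bigl (fun C => ltX x (supp C))); last first.
    by move=> C; rewrite andb_orl; case: (ltX _ _); rewrite ?andbF ?andbT ?orbT.
  rewrite subrr add0r big_seq_cond [RHS]big_seq_cond; apply: eq_big => [C|C].
    rewrite eq_sym; case: eqP => [->|_]; rewrite ?xx ?andbT ?andbF //.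
    by case: (ltX _ _); rewrite ?andbF.
  move=> /and3P[CC xC nxC]; rewrite (negPf nxC) orbF in xC.
  rewrite -VE ?xC // /eps rY_supp // -(eqP xC) -/r subnn mul1r.
  by rewrite -signr_odd addnn odd_double.
rewrite /V; under eq_bigr do rewrite mulrzDl.
(* All the V C have the same constant term c^(N - r), whose multiplicity is given by the global
   relation. *)
rewrite big_split /= -mulrz_sumr; congr (_ + _).
  have -> : \sum_(C <- Cs | (x == supp C) || ltX x (supp C)) eps C = (r == N)%:R.
    under eq_bigr do rewrite /eps exprD.
    rewrite -mulr_suml euler_global // -/r; case: eqP => [->|]; rewrite ?mul0r //.
    by rewrite -exprD -signr_odd addnn odd_double.
  have -> : (N - r == 0)%N = (r == N) by have := rX_le xL; rewrite -/r; lia.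
  by case: eqP => [->|_]; rewrite ?subnn ?mulr1z.
under eq_bigr do rewrite mulrz_suml.
rewrite big_seq_cond; under eq_bigr do rewrite big_seq_cond.
(* For a fixed E the sum runs over the C with [gtY C E]. The local relation counts C = E as well,
   whence the coefficient [1 - eps E]. *)
rewrite (exchange_big_dep (fun E => (E \in Cs) && ltX x (supp E))) /=; last first.
  move=> C E /andP[CC xC] /andP[EC CE]; rewrite EC.
  exact: ltx_gtY CC EC CE xC.
rewrite [RHS]big_seq_cond; apply: eq_bigr => E /andP[EC xE].
rewrite -mulrz_sumr; congr (_ *~ _).
have sgn2 : (-1) ^+ rX x * (-1) ^+ r = 1 :> int.
  by rewrite -exprD -signr_odd addnn odd_double.
have : \sum_(C <- Cs | ((C == E) || gtY C E)
                       && ((x == supp C) || ltX x (supp C))) eps C = 1.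
  under eq_bigr do rewrite /eps exprD.
  by rewrite -mulr_suml euler_local.
rewrite big_mkcond (bigD1_seq E) //= eqxx xE orbT /= => <-.
rewrite addrAC subrr add0r big_mkcond [RHS]big_mkcond /= big_seq [RHS]big_seq.
apply: eq_bigr => C CC; rewrite CC EC /=; case: (C =P E) => [->|_] /=.
  by rewrite gtY_irr // andbF.
by rewrite andbC.
Qed.

Lemma ph_flats :
  ph (c ^+ N + \sum_(x <- L) c ^+ (rX x).-1 * b * Q x)
  = c ^+ N + \sum_(C <- Cs) c ^+ (rY C).-1 * b * U C.
Proof.
rewrite raddfD raddf_sum ph_cX; congr (_ + _).
under eq_big_seq => x xL do rewrite /= ph_cXb tl_flats // mulr_sumr.
rewrite (exchange_big_dep predT) //=; apply: eq_big_seq => C CC.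
under eq_bigl do rewrite eq_sym.
by rewrite (sum_pred1_uniq _ L_uniq) ?supp_L // rY_supp.
Qed.

End Duality.
End TailAlgebra.

(** * Chain sums in the letters b and c *)

Section Chains.
Variables (A : pzRingType) (b c : A).
Variables (T : eqType) (lt : rel T) (e : seq T) (rho : T -> nat).

Fixpoint chain_list (x : T) (s : seq nat) : seq (seq T) :=
  if s is k :: s' then
    flatten [seq [seq y :: t | t <- chain_list y s'] |
              y <- [seq y <- e | lt x y && (rho y == k)]]
  else [:: [::]].

Lemma mem_chain_list x s t :
  (t \in chain_list x s) = [&& path lt x t, all (mem e) t & map rho t == s].
Proof.
elim: s x t => [|k s IH] x t /=.
  by rewrite inE; case: t => //= y t; rewrite !andbF.
apply/flatten_mapP/and3P => [[y] | [xt te /eqP]].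
  rewrite mem_filter => /andP[/andP[xy /eqP <-] ye] /mapP[u].
  by rewrite IH => /and3P[yu ue /eqP <-] -> /=; rewrite xy yu ue ye.
case: t xt te => //= y t /andP[xy yt] /andP[ye te] [rhoy rhot].
exists y; first by rewrite mem_filter xy rhoy eqxx.
by apply: map_f; rewrite IH yt te rhot eqxx.
Qed.

Lemma chain_list_uniq x s : uniq e -> uniq (chain_list x s).
Proof.
move=> e_uniq; elim: s x => //= k s IH x.
apply: allpairs_uniq_dep => /=; first exact: filter_uniq.
  by move=> y _; exact: IH.
by move=> [y t] [z u] _ _ /= [-> ->].
Qed.

Definition chain_weight (l : nat) (s : seq nat) : A :=
  \prod_(k <- iota 0 l) (if k \in s then b else c).

Lemma chain_weight0 l s : chain_weight l.+1 (0%N :: map S s) = b * chain_weight l s.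
Proof.
rewrite /chain_weight /= big_cons mem_head (iotaDl 1 0) big_map; congr (_ * _).
by apply: eq_bigr => k _; rewrite inE /= mem_map //; exact: succn_inj.
Qed.

Lemma chain_weightS l s : chain_weight l.+1 (map S s) = c * chain_weight l s.
Proof.
rewrite /chain_weight /= big_cons (iotaDl 1 0) big_map.
have /negPf -> : 0%N \notin map S s by apply/mapP => -[].
congr (_ * _); apply: eq_bigr => k _; rewrite mem_map //; exact: succn_inj.
Qed.

(** Position k of the word stands for rank r + k + 1. The rank r is kept apart from [rho x] because
    peeling off a letter c raises it while the starting point x of the chains stays. *)
Definition chain_sum (l : nat) (x : T) (r : nat) : A :=
  \sum_(s <- incs l) chain_weight l s *+ size (chain_list x (map (addn r.+1) s)).

Lemma chain_sum0 x r : chain_sum 0 x r = 1.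
Proof. by rewrite /chain_sum big_seq1 /chain_weight big_nil. Qed.

Lemma chain_sumS l x r :
  chain_sum l.+1 x r = c * chain_sum l x r.+1
    + \sum_(y <- e | lt x y && (rho y == r.+1)) b * chain_sum l y r.+1.
Proof.
have addS s : map (addn r.+1) (map S s) = map (addn r.+2) s.
  by rewrite -map_comp; apply: eq_map => k /=; rewrite addnS addSn.
rewrite /chain_sum /= big_cat /= !big_map addrC; congr (_ + _).
  rewrite mulr_sumr; apply: eq_bigr => s _.
  by rewrite chain_weightS addS mulrnAr.
under [RHS]eq_bigr do rewrite mulr_sumr.
rewrite exchange_big /=; apply: eq_bigr => s _.
rewrite chain_weight0 addS addn0 size_flatten /shape -map_comp sumnE big_map.
rewrite big_filter -sumrMnr.
by apply: eq_bigr => y _; rewrite /= size_map mulrnAr.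
Qed.

(** The chains are sorted by their first element y; the ranks skipped before y give the power of
    c. *)
Lemma chain_sumE N l x r : (r + l = N)%N -> {in e, forall y, (rho y <= N)%N} ->
  chain_sum l x r = c ^+ l
    + \sum_(y <- e | lt x y && (r < rho y)%N)
        c ^+ (rho y - r).-1 * b * chain_sum (N - rho y) y (rho y).
Proof.
move=> rlN rho_le; elim: l r x rlN => [|l IH] r x rlN.
  rewrite chain_sum0 big_seq_cond big_pred0 ?addr0 // => y.
  apply/negbTE/negP => /and3P[/rho_le ye _]; rewrite ltnNge.
  by rewrite -[r]addn0 rlN ye.
rewrite chain_sumS IH ?addSnnS // mulrDr -exprS -addrA; congr (_ + _).
rewrite [RHS](bigID (fun y => rho y == r.+1)) /= addrC; congr (_ + _).
  apply: eq_big => [y|y /andP[_ /eqP rhoy]].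
    by rewrite -andbA; congr (_ && _); case: eqP => [->|_]; rewrite ?ltnSn ?andbF.
  by rewrite rhoy subSnn mul1r -rlN addnS subSS addKn.
rewrite mulr_sumr; apply: eq_big => [y|y /andP[_ ry]].
  by case: (lt x y) => //=; lia.
by rewrite !mulrA -exprS prednK ?subn_gt0 // subnS.
Qed.

End Chains.

(** * The ab-index as a sum over chains *)


Section FlagWords.
Variables (A : pzRingType) (a b : A).

Lemma prodr_sign I (r : seq I) (P : pred I) (F : I -> A) :
  \prod_(i <- r) ((-1) ^+ P i * F i) = (-1) ^+ count P r * \prod_(i <- r) F i.
Proof.
elim: r => [|i r IH]; first by rewrite !big_nil mulr1.
rewrite !big_cons IH /= exprD !mulrA; congr (_ * _).
by rewrite -!mulrA; congr (_ * _); rewrite commr_sign.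
Qed.

Lemma prodr_seq_eq0 (I : eqType) (r : seq I) (F : I -> A) i :
  i \in r -> F i = 0 -> \prod_(j <- r) F j = 0.
Proof.
move=> + Fi; elim: r => // j r IH; rewrite inE big_cons.
by case: eqP => [<- _|_ /IH ->]; rewrite ?Fi ?mul0r ?mulr0.
Qed.

(** Expansion of a product: outside T the letter a - b contributes a at the positions outside S and
    -b at those in S, and the signs collect to the power of -1. *)
Lemma flag_word_sum N (T : {set 'I_N}) :
  \sum_(S : {set 'I_N} | T \subset S)
     (\prod_(i < N) (if i \in S then b else a)) *~ (-1) ^+ #|S :\: T|
  = chain_weight b (a - b) N (vals T).
Proof.
have -> : chain_weight b (a - b) N (vals T) =
    \prod_(0 <= k < N) (if k \in vals T then b else a - b).
  by rewrite /chain_weight /index_iota subn0.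
rewrite big_mkord.
under [RHS]eq_bigr => i _ do
  (rewrite (mem_vals_val T i);
   have -> : (if i \in T then b else a - b) =
     (if i \in T then b else - b) + (if i \in T then 0 else a)
     by case: ifP; rewrite ?addr0 // addrC).
rewrite bigA_distr big_mkcond /=; apply: eq_bigr => S _.
case: ifPn => [/fintype.subsetP TS|/fintype.subsetPn[i iT iS]]; last first.
  by rewrite (@prodr_seq_eq0 _ _ _ i) ?mem_index_enum // (negPf iS) iT.
rewrite -mulrzl rmorphXn rmorphN1.
have -> : #|S :\: T|%SET = count [in S :\: T]%SET (index_enum 'I_N).
  by rewrite cardE /enum_mem size_filter.
rewrite -prodr_sign; apply: eq_bigr => i _; rewrite inE.
case: (boolP (i \in T)) => [/TS ->|_]; first by rewrite mul1r.
by case: (i \in S); rewrite ?mulN1r ?mul1r.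
Qed.

Lemma prod_enum_ord N (F : 'I_N -> A) :
  \prod_(i <- enum 'I_N) F i = \prod_(i < N) F i.
Proof. by rewrite enumT [index_enum _]unlock. Qed.

End FlagWords.

Lemma abword_prod (r : seq bool) :
  abword r = \prod_(x <- r) (if x then ab_b else ab_a).
Proof.
elim: r => [|x r IH]; first by rewrite big_nil abword_nil.
by rewrite abword_cons IH big_cons.
Qed.

Lemma scale_mulz (V : lmodType int) (z : int) (m : nat) (v : V) :
  (z * m%:Z) *: v = v *~ z *+ m.
Proof. by rewrite -[_ * _]intz scaler_int mulrzA -pmulrn. Qed.

(** The letter c = a - b absorbs the inclusion-exclusion in [flag_h], which leaves one word per set
    of ranks, weighted by its number of chains. *)
Lemma ab_index_flag (P : ranked_poset) :
  ab_index P = \sum_(s <- incs (rp_N P))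
    chain_weight ab_b ab_c (rp_N P) s *+ #|` fset_set (@rp_chains P (map S s))|.
Proof.
have wordE (S : {set 'I_(rp_N P)}) : abword [seq i \in S | i <- enum 'I_(rp_N P)] =
    \prod_(i < rp_N P) (if i \in S then ab_b else ab_a).
  rewrite abword_prod big_map; exact: prod_enum_ord.
have step : ab_index P = \sum_(T : {set 'I_(rp_N P)})
   chain_weight ab_b ab_c (rp_N P) (vals T) *+ flag_f T.
  rewrite /ab_index /flag_h.
  under eq_bigr do rewrite scaler_suml.
  rewrite (exchange_big_dep predT) //=; apply: eq_bigr => T _.
  rewrite -(flag_word_sum ab_a ab_b) -sumrMnl; apply: eq_bigr => S _.
  apply: etrans (scale_mulz _ _ _) _.
  exact: (congr1 (fun w => w *~ (-1) ^+ #|S :\: T|%SET *+ flag_f T) (wordE S)).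
rewrite step -sum_vals; apply: eq_bigr => T _; congr (_ *+ _).
by rewrite /flag_f /vals -map_comp.
Qed.

Lemma card_fset_set_seq (T : choiceType) (l : seq T) (B : set T) :
  uniq l -> (forall x, B x <-> x \in l) -> #|` fset_set B| = size l.
Proof.
move=> l_uniq Bl; have Bfin : finite_set B.
  have -> : B = [set` l] by apply/seteqP; split=> x /Bl.
  exact: finite_seq.
apply: perm_size; apply: uniq_perm => // x.
by rewrite in_fset_set //; apply/idP/idP; rewrite inE => /Bl.
Qed.

Lemma lin_ext_mulr q f p : lin_ext (fun u => f u * q) p = lin_ext f p * q.
Proof.
by rewrite /lin_ext mulr_suml; apply: eq_bigr => m _; rewrite scalerAl.
Qed.

Lemma ab_rev_letter (x : bool) p :
  ab_rev ((if x then ab_b else ab_a) * p) = ab_rev p * (if x then ab_b else ab_a).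
Proof.
rewrite /ab_rev lin_ext_cons -lin_ext_mulr; congr lin_ext; apply/funext => u.
rewrite rev_cons -cats1 abword_cat; congr (_ * _).
by rewrite abword_cons abword_nil mulr1.
Qed.

Lemma ab_rev_bc (x : bool) p :
  ab_rev ((if x then ab_b else ab_c) * p) = ab_rev p * (if x then ab_b else ab_c).
Proof.
case: x; first exact: (ab_rev_letter true).
apply: etrans (lin_ext_c _ _) (etrans (congr2 (fun q r => q - r)
  (ab_rev_letter false p) (ab_rev_letter true p)) _).
exact: (esym (mulrBr _ _ _)).
Qed.

Lemma ab_rev_prod (I : Type) (r : seq I) (Q : pred I) :
  ab_rev (\prod_(i <- r) (if Q i then ab_b else ab_c))
  = \prod_(i <- rev r) (if Q i then ab_b else ab_c).
Proof.
elim: r => [|i r IH].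
  by rewrite !big_nil /ab_rev -{1}abword_nil lin_ext_word abword_nil.
rewrite big_cons rev_cons -cats1 big_cat big_seq1 -IH; exact: ab_rev_bc.
Qed.

(** The effect on positions of reversing a word of length N; the outer [rev] keeps the list
    increasing. *)
Definition rev_incs N (s : seq nat) : seq nat := rev [seq (N.-1 - k)%N | k <- s].

Lemma rev_incsK N : {in incs N, involutive (rev_incs N)}.
Proof.
move=> s; rewrite mem_incs => /andP[_ /allP s_lt]; rewrite /rev_incs map_rev revK.
rewrite -map_comp map_id_in // => k /s_lt /=; lia.
Qed.

Lemma mem_rev_incs N k s : s \in incs N -> (k < N)%N ->
  (k \in rev_incs N s) = ((N.-1 - k)%N \in s).
Proof.
rewrite mem_incs mem_rev => /andP[_ /allP s_lt] kN; apply/mapP/idP => [[j js ->]|ks].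
  by have := s_lt j js; have -> // : (N.-1 - (N.-1 - j) = j)%N by have := s_lt j js; lia.
by exists (N.-1 - k)%N => //; lia.
Qed.

Lemma rev_incs_mem N s : s \in incs N -> rev_incs N s \in incs N.
Proof.
rewrite !mem_incs => /andP[s_sorted s_lt]; apply/andP; split; last first.
  rewrite all_rev all_map; apply/allP => k /(allP s_lt) /=; lia.
rewrite /rev_incs rev_sorted sorted_map; move: s_sorted s_lt.
case: s => //= k s; elim: s k => //= j s IH k /andP[kj js] /and3P[kN jN sN].
by rewrite IH ?js ?jN ?sN // andbT; lia.
Qed.

Lemma sum_rev_incs (V : nmodType) N (F : seq nat -> V) :
  \sum_(s <- incs N) F (rev_incs N s) = \sum_(s <- incs N) F s.
Proof.
rewrite -(big_map (rev_incs N) predT F); apply: perm_big.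
apply: uniq_perm; [|exact: incs_uniq|].
  rewrite map_inj_in_uniq ?incs_uniq // => s t sN tN st.
  by rewrite -(rev_incsK sN) st rev_incsK.
move=> s; apply/mapP/idP => [[t tN ->]|sN]; first exact: rev_incs_mem.
by exists (rev_incs N s); rewrite ?rev_incsK // rev_incs_mem.
Qed.

Lemma chain_weight_rev N s : s \in incs N ->
  ab_rev (chain_weight ab_b ab_c N s) = chain_weight ab_b ab_c N (rev_incs N s).
Proof.
move=> sN; rewrite /chain_weight ab_rev_prod.
have -> : rev (iota 0 N) = [seq (N.-1 - k)%N | k <- iota 0 N].
  apply: (@eq_from_nth _ 0%N); rewrite ?size_rev ?size_map // size_iota => k kN.
  by rewrite (nth_map 0%N) ?size_iota // nth_rev ?size_iota // !nth_iota; lia.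
rewrite big_map big_seq [RHS]big_seq; apply: eq_bigr => k.
by rewrite mem_iota => /andP[_ kN]; rewrite mem_rev_incs.
Qed.

Section ChainIndex.
Variables (P : ranked_poset) (e : seq (rp_type P)).
Hypothesis e_uniq : uniq e.

(** The flags involve only ranks from 1 to [rp_N P]. Asking for the description of the chains at
    these ranks alone keeps the two ends of the posets below out of e. *)
Lemma ab_index_chains (lt : rel (rp_type P)) :
  (forall s c, all (fun k => 0 < k <= rp_N P)%N s -> rp_chains s c <->
    [/\ path lt (rp_bot P) c, {subset c <= e} & map (@rp_rank P) c = s]) ->
  ab_index P =
  chain_sum ab_b ab_c lt e (@rp_rank P) (rp_N P) (rp_bot P) 0.
Proof.
move=> chainsP; rewrite ab_index_flag /chain_sum big_seq [RHS]big_seq.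
apply: eq_bigr => s; rewrite mem_incs => /andP[_ s_lt]; congr (_ *+ _).
apply: card_fset_set_seq; first exact: chain_list_uniq.
move=> c; rewrite mem_chain_list chainsP; last first.
  by rewrite all_map; apply: sub_all s_lt => k.
split=> [[-> ce ->]|/and3P[-> /allP ce /eqP ->]]; last by split.
by rewrite eqxx andbT; apply/allP.
Qed.

(** Reversing the word amounts to reading each chain from the top, with the corank in place of the
    rank. *)
Lemma ab_rev_index_chains (gt : rel (rp_type P)) :
  (forall s c, all (fun k => 0 < k <= rp_N P)%N s -> rp_chains s c <->
    [/\ path gt (rp_top P) (rev c), {subset c <= e} & map (@rp_rank P) c = s]) ->
  ab_rev (ab_index P) =
  chain_sum ab_b ab_c gt e (fun x => (rp_N P).+1 - rp_rank x)%N
    (rp_N P) (rp_top P) 0.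
Proof.
move=> chainsP; set N := rp_N P.
rewrite ab_index_flag -/N /ab_rev linear_sum -/ab_rev.
transitivity (\sum_(s <- incs N) chain_weight ab_b ab_c N (rev_incs N s)
    *+ #|` fset_set (@rp_chains P (map S s))|).
  rewrite big_seq [RHS]big_seq; apply: eq_bigr => s sN.
  by rewrite raddfMn; congr (_ *+ _); exact: chain_weight_rev.
rewrite -sum_rev_incs /chain_sum big_seq [RHS]big_seq; apply: eq_bigr => s sN.
rewrite rev_incsK //; congr (_ *+ _).
rewrite -(size_map rev); apply: card_fset_set_seq.
  by rewrite map_inj_uniq ?chain_list_uniq //; exact: (can_inj revK).
have s_lt : all (fun k => k < N)%N s by move: sN; rewrite mem_incs => /andP[].
have rs_lt : all (fun k => k < N)%N (rev_incs N s).
  by have := rev_incs_mem sN; rewrite mem_incs => /andP[].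
have mapE c : (map (@rp_rank P) c = map S (rev_incs N s)) <->
    (map (fun x => N.+1 - rp_rank x)%N (rev c) = map (addn 1) s).
  rewrite /rev_incs (map_rev S) -map_comp (map_comp (subn N.+1) (@rp_rank P)).
  rewrite [map (@rp_rank P) (rev c)]map_rev; split=> [->|cs].
    rewrite revK -map_comp; apply/eq_in_map => k /(allP s_lt) /=; lia.
  rewrite -[LHS]revK; congr rev; move: cs; set l := rev _ => cs.
  (* Truncated subtraction loses nothing here: each [N.+1 - k] is positive, so that k is at most
     N. *)
  have -> : l = map (subn N.+1) (map (subn N.+1) l).
    rewrite -map_comp map_id_in // => k kc /=.
    have : (N.+1 - k)%N \in map (addn 1) s by rewrite -cs map_f.
    by case/mapP => j; lia.
  rewrite cs -map_comp; apply/eq_in_map => k /(allP s_lt) /=; lia.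
move=> c; split=> [|/mapP[t]].
  rewrite chainsP; last by rewrite all_map; apply: sub_all rs_lt => k.
  move=> [tc ce /mapE cs]; apply/mapP; exists (rev c); rewrite ?revK //.
  rewrite mem_chain_list tc cs eqxx andbT; apply/allP => x.
  by rewrite mem_rev; exact: ce.
rewrite mem_chain_list => /and3P[tt /allP te /eqP ts] ->.
apply/chainsP; first by rewrite all_map; apply: sub_all rs_lt => k.
split; first by rewrite revK.
  by move=> x; rewrite mem_rev; exact: te.
by apply/mapE; rewrite revK.
Qed.

End ChainIndex.

(** * Affine arrangements and Euler relations *)


Section Transv.
Variable T : choiceType.

(** A finite list of representatives, one for each class of E in K; it turns a sum over cells into a
    sum over points. *)
Definition transv (E : T -> T -> Prop) (K : set T) (s : seq T) :=
  [/\ {in s, forall x, K x}, forall x, K x -> exists2 y, y \in s & E x y,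
      {in s &, forall x y, E x y -> x = y} & uniq s].

Lemma transv_eq (E E' : T -> T -> Prop) (K : set T) s :
  (forall x y, K x -> K y -> E x y <-> E' x y) ->
  transv E K s -> transv E' K s.
Proof.
move=> EE' [sK cov inj s_uniq]; split=> //.
  by move=> x Kx; have [y ys xy] := cov x Kx; exists y => //; apply/EE'; auto.
by move=> x y xs ys /EE' xy; apply: inj; auto.
Qed.

(** Compares lists of representatives found independently, such as those of a common refinement
    reached from two arrangements. *)
Lemma transv_sum (V : nmodType) (E : T -> T -> Prop) (K : set T) s s'
    (F : T -> V) :
  (forall x y, K x -> K y -> E x y -> E y x) ->
  (forall x y z, K x -> K y -> K z -> E x y -> E y z -> E x z) ->
  (forall x y, K x -> K y -> E x y -> F x = F y) ->
  transv E K s -> transv E K s' ->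
  \sum_(x <- s) F x = \sum_(x <- s') F x.
Proof.
move=> Esym Etrans EF [sK cov inj s_uniq] [sK' cov' inj' s_uniq'].
have /choice[h hP] : forall x, exists y, K x -> y \in s' /\ E x y.
  move=> x; have [Kx|nKx] := pselect (K x); last by exists x.
  by have [y ys' xy] := cov' x Kx; exists y.
transitivity (\sum_(x <- map h s) F x).
  rewrite big_map big_seq [RHS]big_seq; apply: eq_bigr => x /sK Kx.
  by have [hs' xh] := hP x Kx; apply: EF => //; exact: sK'.
apply: perm_big; apply: uniq_perm => //.
  rewrite map_inj_in_uniq // => x y xs ys hxy.
  have [hxs' xh] := hP x (sK x xs); have [hys' yh] := hP y (sK y ys).
  apply: inj => //; apply: (Etrans _ (h x)); auto.
  by apply: Esym; auto; rewrite hxy.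
move=> y; apply/mapP/idP => [[x xs ->]|ys'].
  by have [] := hP x (sK x xs).
have [x xs yx] := cov y (sK' y ys'); exists x => //.
have [hxs' xh] := hP x (sK x xs).
by apply: inj' => //; apply: (Etrans _ x); auto.
Qed.

Lemma transv_partition (L : eqType) (ls : seq L) (lab : T -> L)
    (E : T -> T -> Prop) (K : set T) (S : L -> seq T) :
  uniq ls -> (forall x, K x -> lab x \in ls) ->
  (forall l, l \in ls -> transv E [set x | K x /\ lab x = l] (S l)) ->
  transv (fun x y => lab x = lab y /\ E x y) K [seq x | l <- ls, x <- S l].
Proof.
move=> ls_uniq labK trS.
have memS x : x \in [seq x | l <- ls, x <- S l] ->
    [/\ lab x \in ls, K x & x \in S (lab x)].
  move=> /allpairsPdep[l [y [lls yS ->]]]; have [SK _ _ _] := trS l lls.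
  by have [Ky ly] := SK y yS; rewrite ly.
split.
- by move=> x /memS[].
- move=> x Kx; have lx := labK x Kx; have [SK cov _ _] := trS _ lx.
  have [y yS xy] := cov x (conj Kx erefl); exists y.
    by apply/allpairsPdep; exists (lab x), y.
  by split=> //; have [_ ->] := SK y yS.
- move=> x y /memS[lx Kx xS] /memS[ly Ky yS] [lxy xy].
  by have [_ _ inj _] := trS _ lx; apply: inj; rewrite // lxy.
- apply: (allpairs_uniq_dep (f := fun _ x => x)) => //.
    by move=> l /trS[].
  move=> _ _ /allpairsPdep[l [x [lls xS ->]]] /allpairsPdep[k [y [kls yS ->]]] /= xy.
  have [SK _ _ _] := trS l lls; have [SK' _ _ _] := trS k kls.
  have [_ lx] := SK x xS; have [_ ky] := SK' y yS; subst y.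
  by have -> : l = k by rewrite -lx.
Qed.

End Transv.

(** * Relatively open convex sets cut by hyperplanes *)

Section Dot.
Variables (R : realType) (n : nat).
Implicit Types (a x y u v : 'rV[R]_n) (V W : {vspace 'rV[R]_n}).

Definition dot a x : R^o := \sum_(i < n) a 0 i * x 0 i.

Lemma dot_is_linear a : linear (dot a).
Proof.
move=> k x y; rewrite /dot scaler_sumr -big_split; apply: eq_bigr => i _ /=.
by rewrite !mxE mulrDr mulrCA.
Qed.

HB.instance Definition _ a :=
  GRing.isLinear.Build R 'rV[R]_n R^o _ (dot a) (dot_is_linear a).

Definition kerv a : {vspace 'rV[R]_n} := lker (linfun (dot a)).

Lemma mem_kerv a u : (u \in kerv a) = (dot a u == 0).
Proof. by rewrite memv_ker lfunE. Qed.

Lemma dim_cap_kerv V a u : u \in V -> dot a u != 0 ->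
  \dim V = (\dim (V :&: kerv a)).+1.
Proof.
move=> uV au; rewrite -(limg_ker_dim (linfun (dot a)) V) -/(kerv a) -[RHS]addn1.
congr (_ + _)%N; apply/eqP; rewrite eqn_leq; apply/andP; split.
  by apply: leq_trans (dimvS (subvf _)) _; rewrite dimvf.
rewrite lt0n dimv_eq0; apply: contraNneq au => V0.
have := memv_img (linfun (dot a)) uV; rewrite V0 memv0 lfunE; exact.
Qed.

(** Convex, contained in a translate of V and open in it; the empty set satisfies this for every
    V. *)
Definition relopen (K : set 'rV[R]_n) V :=
  [/\ forall x y, K x -> K y -> y - x \in V,
      forall x u, K x -> u \in V ->
        exists2 e, 0 < e & forall t, `|t| < e -> K (x + t *: u)
    & forall x y t, K x -> K y -> 0 <= t <= 1 -> K (x + t *: (y - x))].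

(* A pair (a, g) stands for the affine function x |-> a . x - g. *)
Definition eqv_sign (fs : seq ('rV[R]_n * R)) x y :=
  all (fun f => Num.sg (dot f.1 x - f.2) == Num.sg (dot f.1 y - f.2)) fs.

(** The direction space of the piece of x when a set with direction space V is cut by the functions
    in fs. *)
Fixpoint zdir V (fs : seq ('rV[R]_n * R)) x : {vspace 'rV[R]_n} :=
  if fs is f :: fs' then
    zdir (if dot f.1 x == f.2 then (V :&: kerv f.1)%VS else V) fs' x
  else V.

Lemma mem_zdir V fs x u : reflect
  (u \in V /\ forall f, f \in fs -> dot f.1 x = f.2 -> dot f.1 u = 0)
  (u \in zdir V fs x).
Proof.
elim: fs V => [|f fs IH] V /=; first by apply: (iffP idP) => // -[].
apply: (iffP (IH _)) => [[uV ufs]|[uV ufs]].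
  case: eqP uV => [fx|fx]; rewrite ?memv_cap ?mem_kerv.
    move=> /andP[-> /eqP fu]; split=> // g; rewrite inE => /predU1P[->|] //.
    exact: ufs.
  move=> ->; split=> // g; rewrite inE => /predU1P[->|] //; exact: ufs.
split; last by move=> g gfs; apply: ufs; rewrite inE gfs orbT.
case: eqP => // fx; rewrite memv_cap uV mem_kerv ufs ?eqxx // mem_head //.
Qed.

Lemma sgr_stable (r d : R) : `|d| < `|r| -> Num.sg (r + d) = Num.sg r.
Proof.
move=> dr; case: (ltrgt0P r) dr => [r0|r0|->]; last by rewrite normr_lt0.
  by rewrite ltr_norml => /andP[? ?]; rewrite !gtr0_sg //; lra.
by rewrite ltr_norml => /andP[? ?]; rewrite !ltr0_sg //; lra.
Qed.

Lemma relopen_sign K V (f : 'rV[R]_n * R) (sg : R) : sg != 0 -> relopen K V ->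
  relopen [set x | K x /\ Num.sg (dot f.1 x - f.2) = sg] V.
Proof.
move=> sg0 [KV Kopen Kconv]; split=> [x y [Kx _] [Ky _]|x u [Kx fx] uV|x y t].
- exact: KV.
- have [e e0 Ke] := Kopen x u Kx uV.
  have r0 : dot f.1 x - f.2 != 0 by apply: contraNneq sg0 => r0; rewrite -fx r0 sgr0.
  (* Below this bound a move by [t *: u] changes the value of the function by less than its absolute
     value at x; the + 1 guards the division. *)
  exists (Num.min e (`|dot f.1 x - f.2| / (`|dot f.1 u| + 1))).
    by rewrite lt_min e0 divr_gt0 ?normr_gt0 // ltr_wpDl.
  move=> t; rewrite lt_min => /andP[te]; rewrite ltr_pdivlMr ?ltr_wpDl // => tr.
  split; first exact: Ke.
  rewrite -fx linearD linearZ /= addrAC sgr_stable // normrM.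
  apply: le_lt_trans tr; rewrite ler_wpM2l // lerDl //.
- move=> [Kx fx] [Ky fy] t01; split; first exact: Kconv.
  rewrite linearD linearZ linearB /=; move: t01 fx fy sg0.
  set p := dot f.1 x; set q := dot f.1 y; move=> /andP[t0 t1].
  have -> : p + t *: (q - p) - f.2 = (1 - t) * (p - f.2) + t * (q - f.2).
    by rewrite /GRing.scale /=; lra.
  move: (p - f.2) (q - f.2) => {}p {}q <-.
  case: (ltrgt0P p) => [p0|p0|->]; rewrite ?sgr0 ?eqxx // ?(gtr0_sg p0) ?(ltr0_sg p0).
    move=> q1 _; have q0 : 0 < q by rewrite -sgr_gt0 q1.
    by apply: gtr0_sg; case: (ltrP 0 t) => t0'; nra.
  move=> q1 _; have q0 : q < 0 by rewrite -sgr_lt0 q1 ltrN10.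
  by apply: ltr0_sg; case: (ltrP 0 t) => t0'; nra.
Qed.

Lemma relopen_zero K V (f : 'rV[R]_n * R) : relopen K V ->
  relopen [set x | K x /\ Num.sg (dot f.1 x - f.2) = 0] (V :&: kerv f.1)%VS.
Proof.
move=> [KV Kopen Kconv].
have sg0P z : Num.sg (dot f.1 z - f.2) = 0 <-> dot f.1 z = f.2.
  split=> [/eqP|->]; last by rewrite subrr sgr0.
  by rewrite sgr_eq0 subr_eq0 => /eqP.
split=> [x y [Kx /sg0P fx] [Ky /sg0P fy]|x u [Kx /sg0P fx]|x y t].
- by rewrite memv_cap KV // mem_kerv linearB /= fx fy subrr.
- rewrite memv_cap mem_kerv => /andP[uV /eqP fu].
  have [e e0 Ke] := Kopen x u Kx uV; exists e => // t te; split; first exact: Ke.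
  by apply/sg0P; rewrite linearD linearZ /= fu scaler0 addr0.
- move=> [Kx /sg0P fx] [Ky /sg0P fy] t01; split; first exact: Kconv.
  by apply/sg0P; rewrite linearD linearZ linearB /= fx fy subrr scaler0 addr0.
Qed.

(* Cutting K by a hyperplane that properly crosses it replaces (-1)^d by
   (-1)^d - (-1)^d + (-1)^d. *)
Lemma euler_relopen fs (K : set 'rV[R]_n) V : relopen K V -> K !=set0 ->
  exists2 s, transv (eqv_sign fs) K s
           & \sum_(x <- s) (-1) ^+ \dim (zdir V fs x) = (-1) ^+ \dim V :> int.
Proof.
elim: fs K V => [|f fs IH] K V KV Kne.
  have [x Kx] := Kne; exists [:: x]; last by rewrite big_seq1.
  split=> //; [by move=> y; rewrite inE => /eqP ->|by exists x; rewrite ?mem_head|].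
  by move=> y z; rewrite !inE => /eqP -> /eqP ->.
pose Ks (sg : R) := [set x | K x /\ Num.sg (dot f.1 x - f.2) = sg].
have ex sg W : relopen (Ks sg) W -> exists2 s, transv (eqv_sign fs) (Ks sg) s
    & \sum_(x <- s) (-1) ^+ \dim (zdir W fs x) =
      if `[< Ks sg !=set0 >] then (-1) ^+ \dim W else 0 :> int.
  move=> rW; have [ne|nne] := pselect (Ks sg !=set0).
    by rewrite asboolT //; exact: IH.
  rewrite asboolF //; exists [::]; last by rewrite big_nil.
  by split=> // x Kx; case: nne; exists x.
have n10 : (-1 : R) != 0 by rewrite oppr_eq0 oner_eq0.
(* Only the slice inside the hyperplane can lose directions. A nonempty slice is handled by
   induction, an empty one by the empty list. *)
pose W (sg : R) := if sg == 0 then (V :&: kerv f.1)%VS else V.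
have /choice[S SP] : forall sg, exists s, transv (eqv_sign fs) (Ks sg) s /\
    \sum_(x <- s) (-1) ^+ \dim (zdir (W sg) fs x) =
      if `[< Ks sg !=set0 >] then (-1) ^+ \dim (W sg) else 0 :> int.
  move=> sg; rewrite /W; have [sg0|sg0] := eqVneq sg 0.
    by have [|s] := ex sg (V :&: kerv f.1)%VS; [rewrite sg0; exact: relopen_zero|exists s].
  by have [|s] := ex sg V; [exact: relopen_sign|exists s].
pose lab x := Num.sg (dot f.1 x - f.2).
have labP x : lab x \in [:: 1; 0; -1].
  rewrite /lab !inE; case: (ltrgt0P (dot f.1 x - f.2)) => [h|h|->].
  - by rewrite (gtr0_sg h) eqxx.
  - by rewrite (ltr0_sg h) eqxx !orbT.
  - by rewrite sgr0 eqxx orbT.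
have u3 : uniq [:: 1; 0; -1 : R].
  rewrite /= !inE oner_eq0 eq_sym eqNr oner_eq0 eq_sym (negPf n10) //.
have tr := transv_partition u3 (fun x _ => labP x) (fun sg _ => (SP sg).1).
exists [seq x | sg <- [:: 1; 0; -1], x <- S sg].
  apply: transv_eq tr => x y _ _; rewrite /= /lab.
  by split=> [[-> ->]|/andP[/eqP -> ->]] //; rewrite eqxx.
have sumE sg : \sum_(x <- S sg) (-1) ^+ \dim (zdir V (f :: fs) x) =
    if `[< Ks sg !=set0 >] then (-1) ^+ \dim (W sg) else 0 :> int.
  rewrite -(SP sg).2 big_seq [RHS]big_seq; apply: eq_bigr => x xS.
  have [[SK _ _ _] _] := SP sg; have [_ labx] := SK x xS.
  by rewrite /= /W -labx sgr_eq0 subr_eq0.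
rewrite /= !big_cat /= big_nil addr0 !map_id !sumE {sumE SP tr ex}.
rewrite /W eqxx oner_eq0 (negPf n10).
have [KdV Kopen Kconv] := KV.
have KsP x : K x -> Ks (lab x) x by [].
have [[x0 [Kx0 /eqP]]|nz] := pselect (Ks 0 !=set0).
  rewrite sgr_eq0 subr_eq0 => /eqP fx0.
  have Kz : `[< Ks 0 !=set0 >].
    by apply/asboolP; exists x0; split=> //; rewrite fx0 subrr sgr0.
  rewrite Kz.
  (* Either K lies in the hyperplane and the other two slices are empty, or a direction u leaves the
     hyperplane and all three slices are nonempty. *)
  have [/subvP Vker|/subvPn[u uV]] := boolP (V <= kerv f.1)%VS.
    have K0 x : K x -> lab x = 0.
      move=> Kx; have := Vker _ (KdV _ _ Kx0 Kx); rewrite mem_kerv linearB /=.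
      by rewrite subr_eq0 => /eqP fx; rewrite /lab fx fx0 subrr sgr0.
    rewrite !asboolF; first by rewrite add0r addr0 (capv_idPl _) //; apply/subvP.
      by move=> [x [/K0 + sgx]]; rewrite /lab sgx => /eqP; rewrite (negPf n10).
    by move=> [x [/K0 + sgx]]; rewrite /lab sgx => /eqP; rewrite oner_eq0.
  rewrite mem_kerv => fu; have [e e0 Ke] := Kopen x0 u Kx0 uV.
  have lab_near t : lab (x0 + t *: u) = Num.sg (t * dot f.1 u).
    by rewrite /lab linearD linearZ /= fx0 addrAC subrr add0r.
  have ne (t : R) : `|t| < e -> `[< Ks (Num.sg (t * dot f.1 u)) !=set0 >].
    by move=> te; apply/asboolP; exists (x0 + t *: u); rewrite -lab_near; apply/KsP/Ke.
  have [d d0 de] : exists2 d, 0 < d & d < e by exists (e / 2); lra.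
  have np := ne d; have nn := ne (- d).
  have [Kp Kn] : `[< Ks 1 !=set0 >] /\ `[< Ks (-1) !=set0 >].
    move: np nn; rewrite !sgrM sgrN (gtr0_sg d0) mul1r mulN1r normrN gtr0_norm //.
    case: (ltrgt0P (dot f.1 u)) fu => [h|h|//] _; last rewrite (ltr0_sg h) opprK.
      by rewrite (gtr0_sg h) => np nn; split; [exact: np|exact: nn].
    by move=> np nn; split; [exact: nn|exact: np].
  by rewrite Kp Kn (dim_cap_kerv uV fu) exprS mulN1r addKr.
(* By convexity K cannot have points on both sides without meeting the hyperplane; t is the zero of
   the affine function on the segment. *)
have cross x y : Ks 1 x -> Ks (-1) y -> False.
  move=> [Kx fx] [Ky fy]; apply: nz.
  have x0 : 0 < dot f.1 x - f.2 by rewrite -sgr_gt0 fx.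
  have y0 : dot f.1 y - f.2 < 0 by rewrite -sgr_lt0 fy ltrN10.
  have d0 : 0 < dot f.1 x - dot f.1 y by lra.
  pose t := (dot f.1 x - f.2) / (dot f.1 x - dot f.1 y).
  exists (x + t *: (y - x)); split.
    apply: Kconv => //; rewrite /t divr_ge0 ?(ltW d0) ?(ltW x0) //=.
    by rewrite ler_pdivrMr //; lra.
  rewrite linearD linearZ linearB /=.
  have -> : t *: (dot f.1 y - dot f.1 x) = f.2 - dot f.1 x.
    rewrite -opprB scalerN /GRing.scale /= divfK ?gt_eqF //; lra.
  by rewrite [dot f.1 x + _]addrC subrK subrr sgr0.
rewrite (asboolF nz) add0r; have [x Kx] := Kne.
have := labP x; rewrite !inE => /or3P[] /eqP lx.
- have K1 : Ks 1 x by split.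
  have -> : `[< Ks 1 !=set0 >] by apply/asboolP; exists x.
  have -> : `[< Ks (-1) !=set0 >] = false.
    by apply/negbTE/asboolPn => -[y]; exact: (cross x y K1).
  by rewrite addr0.
- by case: nz; exists x.
- have K1 : Ks (-1) x by split.
  have -> : `[< Ks (-1) !=set0 >] by apply/asboolP; exists x.
  have -> : `[< Ks 1 !=set0 >] = false.
    by apply/negbTE/asboolPn => -[y Ky]; exact: (cross y x Ky K1).
  by rewrite add0r.
Qed.

End Dot.

Lemma seq_lower_bound (R : realType) (T : eqType) (s : seq T) (F : T -> R) :
  (forall x, 0 < F x) -> exists2 e, 0 < e & forall x, x \in s -> e <= F x.
Proof.
move=> F0; elim: s => [|x s [e e0 es]]; first by exists 1.
exists (Num.min (F x) e); first by rewrite lt_min F0.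
by move=> y; rewrite inE ge_min => /predU1P[->|/es ->]; rewrite ?lexx ?orbT.
Qed.

(** * Faces of a locally finite arrangement *)

Section Arrangement.
Variables (R : realType) (n : nat) (I : finType) (a : I -> 'rV[R]_n).
Implicit Types (G : I -> set R) (x y z u v p q : 'rV[R]_n).

Definition locally_finite G := forall i (M : R), finite_set [set g | G i g /\ `|g| <= M].

Definition sim G x y := forall i g, G i g ->
  Num.sg (dot (a i) x - g) = Num.sg (dot (a i) y - g).

Definition cell G x : set 'rV[R]_n := [set y | sim G x y].

(** The face order read off from signs: x lies in the closed cell of y. *)
Definition leface G x y := forall i g, G i g ->
  dot (a i) x = g \/ Num.sg (dot (a i) x - g) = Num.sg (dot (a i) y - g).

Definition dirs G x : {vspace 'rV[R]_n} :=
  (\bigcap_(i | `[< G i (dot (a i) x) >]) kerv (a i))%VS.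

Lemma mem_dirs G x u : reflect
  (forall i, G i (dot (a i) x) -> dot (a i) u = 0) (u \in dirs G x).
Proof.
rewrite memvE; apply: (iffP subv_bigcapP) => H i Gi.
  have := H i; rewrite asboolT // => /(_ isT).
  by rewrite -memvE mem_kerv => /eqP.
by rewrite -memvE mem_kerv H //; apply/asboolP.
Qed.

Lemma sim_refl G x : sim G x x. Proof. by []. Qed.

Lemma sim_sym G x y : sim G x y -> sim G y x.
Proof. by move=> xy i g Gg; rewrite xy. Qed.

Lemma sim_trans G x y z : sim G x y -> sim G y z -> sim G x z.
Proof. by move=> xy yz i g Gg; rewrite xy ?yz. Qed.

Lemma sgr_sub_eq0 (r g : R) : Num.sg (r - g) = 0 <-> r = g.
Proof.
split=> [/eqP|->]; last by rewrite subrr sgr0.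
by rewrite sgr_eq0 subr_eq0 => /eqP.
Qed.

Lemma sim_on G x y i : sim G x y -> G i (dot (a i) x) -> dot (a i) y = dot (a i) x.
Proof. by move=> xy Gx; apply/sgr_sub_eq0; rewrite -xy // subrr sgr0. Qed.

Lemma sim_dirs G x y : sim G x y -> dirs G x = dirs G y.
Proof.
have H x' y' : sim G x' y' -> (dirs G x' <= dirs G y')%VS.
  move=> xy; apply/subvP => u /mem_dirs ux; apply/mem_dirs => i Gi.
  by apply: ux; rewrite (sim_on (sim_sym xy)).
by move=> xy; apply/eqP; rewrite eqEsubv !H //; exact: sim_sym.
Qed.

Lemma leface_on G x y i : leface G x y -> G i (dot (a i) y) ->
  dot (a i) x = dot (a i) y.
Proof.
move=> xy Gy; have [//|] := xy i _ Gy.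
by rewrite subrr sgr0 => /sgr_sub_eq0.
Qed.

Lemma sim_leface G x y : sim G x y -> leface G x y.
Proof. by move=> xy i g Gg; right; exact: xy. Qed.

Lemma leface_dirs G x y : leface G x y -> (dirs G x <= dirs G y)%VS.
Proof.
move=> xy; apply/subvP => u /mem_dirs ux; apply/mem_dirs => i Gi.
by apply: ux; rewrite (leface_on xy).
Qed.

(** Equal dimensions force equal direction spaces; these contain y - x, so that every level through
    x also passes through y. *)
Lemma leface_dim G x y : leface G x y -> \dim (dirs G x) = \dim (dirs G y) ->
  sim G x y.
Proof.
move=> xy dxy i g Gg; have [xg|//] := xy i g Gg.
have dE : dirs G x = dirs G y by apply/eqP; rewrite eqEdim dxy leqnn leface_dirs.
have xyd : y - x \in dirs G x.
  rewrite dE; apply/mem_dirs => j Gj.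
  by rewrite linearB /= (leface_on xy Gj) subrr.
have := mem_dirs _ _ _ xyd i; rewrite linearB /= xg => /(_ Gg)/eqP.
by rewrite subr_eq0 => /eqP ->.
Qed.

Lemma sgr_convex (r s g t : R) : 0 < t -> t <= 1 ->
  (r = g \/ Num.sg (r - g) = Num.sg (s - g)) ->
  Num.sg (r + t * (s - r) - g) = Num.sg (s - g).
Proof.
move=> t0 t1 rs.
have -> : r + t * (s - r) - g = (1 - t) * (r - g) + t * (s - g) by lra.
case: rs => [->|]; first by rewrite subrr mulr0 add0r sgrM (gtr0_sg t0) mul1r.
move: (r - g) (s - g) => {}r {}s.
case: (ltrgt0P s) => [s0|s0|->]; last first.
- by rewrite sgr0 mulr0 addr0 => /eqP; rewrite sgr_eq0 => /eqP ->; rewrite mulr0 sgr0.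
- rewrite (ltr0_sg s0) => r1; have r0 : r < 0 by rewrite -sgr_lt0 r1 ltrN10.
  by apply: ltr0_sg; nra.
- rewrite (gtr0_sg s0) => r1; have r0 : 0 < r by rewrite -sgr_gt0 r1.
  by apply: gtr0_sg; nra.
Qed.

Lemma leface_segment G x y t : leface G x y -> 0 < t -> t <= 1 ->
  sim G y (x + t *: (y - x)).
Proof.
move=> xy t0 t1 i g Gg; rewrite linearD linearZ linearB /=.
by rewrite sgr_convex //; exact: xy.
Qed.

Lemma sgr_between (r s h t : R) : 0 <= t <= 1 ->
  (r = 0 \/ Num.sg r = Num.sg h) -> (s = 0 \/ Num.sg s = Num.sg h) ->
  (1 - t) * r + t * s = 0 \/ Num.sg ((1 - t) * r + t * s) = Num.sg h.
Proof.
move=> /andP[t0 t1] rh sh; case: (ltrgt0P h) rh sh => [h0|h0|->].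
- rewrite (gtr0_sg h0) => rh sh.
  have r0 : 0 <= r by case: rh => [->//|r1]; rewrite ltW // -sgr_gt0 r1.
  have s0 : 0 <= s by case: sh => [->//|s1]; rewrite ltW // -sgr_gt0 s1.
  have : 0 <= (1 - t) * r + t * s by rewrite addr_ge0 // mulr_ge0 // subr_ge0.
  by rewrite le_eqVlt => /predU1P[<-|/gtr0_sg]; [left|right].
- rewrite (ltr0_sg h0) => rh sh.
  have r0 : r <= 0 by case: rh => [->//|r1]; rewrite ltW // -sgr_lt0 r1 ltrN10.
  have s0 : s <= 0 by case: sh => [->//|s1]; rewrite ltW // -sgr_lt0 s1 ltrN10.
  have : (1 - t) * r + t * s <= 0.
    by rewrite -oppr_ge0 opprD -!mulrN addr_ge0 // mulr_ge0 ?oppr_ge0 // subr_ge0.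
  by rewrite le_eqVlt => /predU1P[->|/ltr0_sg]; [left|right].
- rewrite sgr0 => rh sh.
  have -> : r = 0 by case: rh => // /eqP; rewrite sgr_eq0 => /eqP.
  have -> : s = 0 by case: sh => // /eqP; rewrite sgr_eq0 => /eqP.
  by rewrite !mulr0 addr0; left.
Qed.

Lemma leface_convex G x y z t : leface G x z -> leface G y z -> 0 <= t <= 1 ->
  leface G (x + t *: (y - x)) z.
Proof.
move=> xz yz t01 i g Gg; rewrite linearD linearZ linearB /=.
have tE : dot (a i) x + t *: (dot (a i) y - dot (a i) x) - g =
    (1 - t) * (dot (a i) x - g) + t * (dot (a i) y - g).
  by rewrite /GRing.scale /=; lra.
have zero r : r = g -> r - g = 0 :> R by move=> ->; rewrite subrr.
have := @sgr_between (dot (a i) x - g) (dot (a i) y - g) (dot (a i) z - g) t t01.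
rewrite -tE => /(_ _ _)[||/eqP|].
- by case: (xz i g Gg); [left; exact: zero|right].
- by case: (yz i g Gg); [left; exact: zero|right].
- by rewrite subr_eq0 => /eqP; left.
- by right.
Qed.

Section LocallyFinite.
Variable G : I -> set R.
Hypothesis Glf : locally_finite G.

(** Only finitely many levels come within distance 1 of [r i], which leaves a gap; as I is finite,
    one gap serves all i. *)
Lemma separation (r : I -> R) :
  exists2 e, 0 < e & forall i g, G i g -> g != r i -> e <= `|r i - g|.
Proof.
have sep1 i : exists2 e, 0 < e & forall g, G i g -> g != r i -> e <= `|r i - g|.
  pose S := fset_set [set g | G i g /\ `|g| <= `|r i| + 1].
  have Sfin := Glf i (`|r i| + 1).
  (* The value 1 at [r i] is a filler, since [seq_lower_bound] wants a function that is positive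
     everywhere. *)
  pose F g := if g == r i then 1 else `|r i - g|.
  have [|e e0 eF] := @seq_lower_bound R _ S F.
    by move=> g; rewrite /F; case: eqVneq => // gr; rewrite normr_gt0 subr_eq0 eq_sym.
  exists (Num.min e 1) => [|g Gg gr]; first by rewrite lt_min e0 ltr01.
  rewrite ge_min; apply/orP; have [gM|gM] := lerP `|g| (`|r i| + 1).
    left; have gS : g \in S by rewrite in_fset_set // inE.
    by have := eF g gS; rewrite /F (negPf gr).
  right; have := ler_distD 0 g (r i).
  have := lerB_dist g (r i); rewrite distrC => h _; lra.
have /choice[e eP] : forall i, exists e, 0 < e /\
    forall g, G i g -> g != r i -> e <= `|r i - g|.
  by move=> i; have [e e0 eP] := sep1 i; exists e.
have [i|d d0 de] := @seq_lower_bound R _ (enum I) e; first by have [] := eP i.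
exists d => // i g Gg gr; have [_ ep] := eP i; apply: le_trans (ep g Gg gr).
by apply: de; rewrite mem_enum.
Qed.

Lemma leface_near x : exists2 e, 0 < e & forall y,
  (forall i, `|dot (a i) y - dot (a i) x| < e) -> leface G x y.
Proof.
have [e e0 sep] := separation (fun i => dot (a i) x).
exists e => // y xy i g Gg; have [->|gx] := eqVneq g (dot (a i) x); first by left.
right.
have -> : dot (a i) y - g = dot (a i) x - g + (dot (a i) y - dot (a i) x).
  by rewrite [RHS]addrC subrKA.
rewrite [RHS]sgr_stable //; apply: lt_le_trans (xy i) _; exact: sep.
Qed.

Lemma dot_bound u : exists2 B, 0 < B & forall i, `|dot (a i) u| < B.
Proof.
exists (\sum_i `|dot (a i) u| + 1); first by rewrite ltr_wpDl // sumr_ge0.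
by move=> i; rewrite (bigD1 i) //= -addrA ltrDl ltr_wpDl // sumr_ge0.
Qed.

Lemma relopen_cell x : relopen (cell G x) (dirs G x).
Proof.
split=> [y z xy xz|y u xy ux|y z t xy xz /andP[t0 t1]].
- apply/mem_dirs => i Gi; rewrite linearB /=.
  by rewrite (sim_on xy Gi) (sim_on xz Gi) subrr.
- have [e e0 near] := leface_near y; have [B B0 uB] := dot_bound u.
  exists (e / B) => [|t tB]; first exact: divr_gt0.
  apply: sim_trans (xy) _ => i g Gg.
  have [|yg|//] := near (y + t *: u) _ i g Gg.
    move=> j; rewrite linearD linearZ /= addrAC subrr add0r normrM.
    apply: le_lt_trans (_ : `|t| * B < e); last by rewrite -ltr_pdivlMr.
    by rewrite ler_wpM2l // ltW.
  have /mem_dirs uy : u \in dirs G y by rewrite -(sim_dirs xy).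
  by rewrite linearD linearZ /= uy ?yg // scaler0 addr0.
- have [->|t0'] := eqVneq t 0; first by rewrite scale0r addr0.
  apply: sim_trans (xz) _; apply: leface_segment => //; last by rewrite lt0r t0'.
  by apply: sim_leface; apply: sim_trans (sim_sym xy) xz.
Qed.

(** A level beyond the bound for [a i] has all of K on one side, and only finitely many levels lie
    within the bounds, so that the finite case applies. *)
Lemma euler_cells (K : set 'rV[R]_n) V : relopen K V -> K !=set0 ->
  (forall i, exists M, forall x, K x -> `|dot (a i) x| <= M) ->
  exists2 s, transv (sim G) K s
    & \sum_(x <- s) (-1) ^+ \dim (V :&: dirs G x) = (-1) ^+ \dim V :> int.
Proof.
move=> KV Kne /choice[M MP].
pose S i : {fset R} := fset_set [set g | G i g /\ `|g| <= M i].
have SP i g : g \in S i <-> G i g /\ `|g| <= M i.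
  by rewrite in_fset_set ?inE //; exact: Glf.
pose fs := [seq (a i, g) | i <- enum I, g <- enum_fset (S i)].
have fsP f : f \in fs <-> exists i, [/\ f.1 = a i, G i f.2 & `|f.2| <= M i].
  split=> [/allpairsPdep[i [g [_ /SP[Gg gM] ->]]]|[i [fi Gf fM]]].
    by exists i.
  apply/allpairsPdep; exists i, f.2; rewrite mem_enum -fi -surjective_pairing.
  by split=> //; apply/SP.
have [s strans ssum] := euler_relopen fs KV Kne.
exists s.
  apply: transv_eq strans => x y Kx Ky; split=> [/allP xy i g Gg|xy].
    have [gM|gM] := lerP `|g| (M i).
      by apply/eqP/(xy (a i, g))/fsP; exists i.
    have := MP i x Kx; have := MP i y Ky; rewrite !ler_norml => /andP[? ?] /andP[? ?].
    have [g0|g0] := lerP 0 g.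
      by move: gM; rewrite ger0_norm // => gM; rewrite !ltr0_sg //; lra.
    by move: gM; rewrite ltr0_norm // => gM; rewrite !gtr0_sg //; lra.
  by apply/allP => f /fsP[i [fi Gf _]]; rewrite fi xy.
rewrite -ssum big_seq [RHS]big_seq; apply: eq_bigr => x xs; congr (_ ^+ \dim _).
have [sK _ _ _] := strans; apply/vspaceP => u; apply/idP/idP.
  rewrite memv_cap => /andP[uV /mem_dirs ux]; apply/mem_zdir; split=> // f.
  by move=> /fsP[i [fi Gf _]] fx; rewrite fi ux // -fi fx.
move=> /mem_zdir[uV ux]; rewrite memv_cap uV; apply/mem_dirs => i Gx.
by apply: (ux (a i, dot (a i) x)) => //; apply/fsP; exists i; split=> //; exact/MP/sK.
Qed.

End LocallyFinite.
End Arrangement.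

(** * Periodic arrangements *)


Section Periodic.
Variables (R : realType) (n : nat) (I : finType) (a : I -> 'rV[R]_n).
Implicit Types (G B : I -> set R) (x y z u v : 'rV[R]_n) (k m : 'rV[int]_n).

Definition Zv k : 'rV[R]_n := map_mx intr k.

Lemma Zv0 : Zv 0 = 0. Proof. exact: map_mx0. Qed.
Lemma ZvD k m : Zv (k + m) = Zv k + Zv m. Proof. exact: map_mxD. Qed.
Lemma ZvN k : Zv (- k) = - Zv k. Proof. exact: map_mxN. Qed.

Definition periodic G := forall i g k, G i g -> G i (g + dot (a i) (Zv k)).

Definition unbounded G := forall i M, (exists2 g, G i g & M < g) /\
                                      (exists2 g, G i g & g < M).

Definition free_translations G := forall x k, sim a G x (x + Zv k) -> k = 0.

Definition orb G x y := exists k, sim a G x (y + Zv k).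

Lemma sim_shift G x y k : periodic G -> sim a G x y -> sim a G (x + Zv k) (y + Zv k).
Proof.
move=> Gp xy i g Gg; rewrite !linearD /=.
have := xy i (g + dot (a i) (Zv (- k))) (Gp _ _ _ Gg).
by rewrite ZvN linearN /= opprD opprK !addrA ![_ - g + _]addrAC.
Qed.

Lemma leface_shift G x y k : periodic G -> leface a G x y ->
  leface a G (x + Zv k) (y + Zv k).
Proof.
move=> Gp xy i g Gg; rewrite !linearD /=.
have := xy i (g + dot (a i) (Zv (- k))) (Gp _ _ _ Gg).
rewrite ZvN linearN /= opprD opprK !addrA ![_ - g + _]addrAC.
by case=> [->|]; [left; rewrite subrK|right].
Qed.

Lemma sim_shiftN G x y k : periodic G -> sim a G x (y + Zv k) ->
  sim a G (x - Zv k) y.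
Proof.
by move=> Gp /(sim_shift (- k) Gp); rewrite ZvN addrK.
Qed.

Lemma dirs_shift G x k : periodic G -> dirs a G (x + Zv k) = dirs a G x.
Proof.
move=> Gp; apply/vspaceP => u; apply/mem_dirs/mem_dirs => H i Gi; apply: H.
  by rewrite linearD /=; exact: Gp.
have := Gp i _ (- k) Gi; rewrite linearD /= ZvN linearN /= addrK; exact.
Qed.

Lemma orb_sym G x y : periodic G -> orb G x y -> orb G y x.
Proof.
move=> Gp [k /(sim_shiftN Gp) xy]; exists (- k); rewrite ZvN; exact: sim_sym.
Qed.

Lemma orb_trans G x y z : periodic G -> orb G x y -> orb G y z -> orb G x z.
Proof.
move=> Gp [k xy] [m yz]; exists (m + k); rewrite ZvD addrA.
exact: sim_trans xy (sim_shift k Gp yz).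
Qed.

Lemma orb_dirs G x y : periodic G -> orb G x y -> dirs a G x = dirs a G y.
Proof. by move=> Gp [k /sim_dirs ->]; exact: dirs_shift. Qed.

(** The cell lies between two levels of each [a i]. Nothing is said about common kernel directions:
    [euler_cells] asks only for bounds on the [a i]. *)
Lemma cell_bounded G x : unbounded G ->
  forall i, exists M, forall y, cell a G x y -> `|dot (a i) y| <= M.
Proof.
move=> Gu i; have [[g Gg gx] [h Gh hx]] := Gu i (dot (a i) x).
exists (`|g| + `|h|) => y xy.
have : dot (a i) y - g < 0 by rewrite -sgr_lt0 -xy // sgr_lt0 subr_lt0.
have : 0 < dot (a i) y - h by rewrite -sgr_gt0 -xy // sgr_gt0 subr_gt0.
have := ler_norm g; have := ler_norm (- h); rewrite normrN.
have := normr_ge0 g; have := normr_ge0 h; rewrite ler_norml.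
by move: (dot (a i) y : R) => d; lra.
Qed.

(** * Signed cell counts of a flat modulo the lattice *)

Section Flat.
Variables (S : {set I}) (x0 : 'rV[R]_n).

Definition aflat : set 'rV[R]_n := [set y | forall i, i \in S -> dot (a i) y = dot (a i) x0].

Definition aflat_dir : {vspace 'rV[R]_n} := (\bigcap_(i in S) kerv (a i))%VS.

Lemma mem_aflat_dir u : reflect (forall i, i \in S -> dot (a i) u = 0)
  (u \in aflat_dir).
Proof.
rewrite memvE; apply: (iffP subv_bigcapP) => H i iS.
  by have := H i iS; rewrite -memvE mem_kerv => /eqP.
by rewrite -memvE mem_kerv H.
Qed.

Lemma aflat_sub x y : aflat x -> aflat y -> y - x \in aflat_dir.
Proof.
by move=> xA yA; apply/mem_aflat_dir => i iS; rewrite linearB /= xA ?yA // subrr.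
Qed.

Lemma aflat_add x u : aflat x -> u \in aflat_dir -> aflat (x + u).
Proof.
by move=> xA /mem_aflat_dir uA i iS; rewrite linearD /= xA // uA // addr0.
Qed.

Lemma aflat_base : aflat x0. Proof. by []. Qed.

Definition flat_of G := forall i, i \in S -> G i (dot (a i) x0).

Lemma aflat_cell G x y : flat_of G -> aflat x -> sim a G x y -> aflat y.
Proof. by move=> GS xA xy i iS; rewrite (sim_on xy) xA //; exact: GS. Qed.

Lemma dirs_aflat G x : flat_of G -> aflat x -> (dirs a G x <= aflat_dir)%VS.
Proof.
move=> GS xA; apply/subvP => u /mem_dirs ux; apply/mem_aflat_dir => i iS.
by apply: ux; rewrite xA //; exact: GS.
Qed.

(** The B-cells inside one G-cell have its signed count. No two of them are lattice translates of
    each other, as the translation would preserve the G-cell; hence the lists for the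
    representatives of G concatenate to a list of representatives for B. *)
Lemma euler_refine G B s : locally_finite G -> locally_finite B ->
  (forall i, G i `<=` B i) -> periodic G -> periodic B -> unbounded G ->
  free_translations G -> flat_of G -> transv (orb G) aflat s ->
  exists2 t, transv (orb B) aflat t
    & \sum_(x <- t) (-1) ^+ \dim (dirs a B x)
      = \sum_(x <- s) (-1) ^+ \dim (dirs a G x) :> int.
Proof.
move=> Glf Blf GB Gp Bp Gu Gfree GS [sA scov sinj s_uniq].
have simGB x y : sim a B x y -> sim a G x y.
  by move=> xy i g Gg; apply: xy; exact: GB.
have /choice[t tP] : forall x, exists t, transv (sim a B) (cell a G x) t /\
    \sum_(y <- t) (-1) ^+ \dim (dirs a B y) = (-1) ^+ \dim (dirs a G x) :> int.
  move=> x; have xne : cell a G x !=set0 by exists x; exact: sim_refl.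
  have [t tt tsum] :=
    euler_cells Blf (relopen_cell a Glf x) xne (cell_bounded x Gu).
  exists t; split=> //; rewrite -tsum big_seq [RHS]big_seq; apply: eq_bigr => y yt.
  have [tx _ _ _] := tt; have xy := tx y yt; congr (_ ^+ \dim _).
  apply/esym/capv_idPr; rewrite (sim_dirs xy).
  apply/subvP => u /mem_dirs uy; apply/mem_dirs => i Gi; apply: uy.
  exact: GB.
have tx x y : y \in t x -> sim a G x y by have [[H _ _ _] _] := tP x; exact: H.
have key x x' z z' k : x \in s -> x' \in s -> z \in t x -> z' \in t x' ->
    sim a G z (z' + Zv k) -> x = x' /\ k = 0.
  move=> xs xs' /tx xz /tx xz' zz'.
  have xx' : sim a G x (x' + Zv k).
    apply: sim_trans (xz) (sim_trans zz' _); apply: sim_shift => //.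
    exact: sim_sym.
  have xE : x = x' by apply: sinj => //; exists k.
  by split=> //; apply: (Gfree x); rewrite {2}xE.
exists [seq z | x <- s, z <- t x]; last first.
  rewrite big_allpairs_dep; apply: eq_bigr => x _; exact: (tP x).2.
split.
- move=> z /allpairsPdep[x [y [xs yt ->]]].
  exact: aflat_cell GS (sA x xs) (tx _ _ yt).
- move=> y yA; have [x xs [k yx]] := scov y yA.
  have [[_ cov _ _] _] := tP x.
  have [z zt yz] := cov _ (sim_sym (sim_shiftN Gp yx)).
  exists z; first by apply/allpairsPdep; exists x, z.
  by exists k; have := sim_shift k Bp yz; rewrite subrK.
- move=> _ _ /allpairsPdep[x [z [xs zt ->]]] /allpairsPdep[x' [z' [xs' zt' ->]]].
  move=> [k zz']; have [xx' k0] := key _ _ _ _ _ xs xs' zt zt' (simGB _ _ zz').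
  subst x' k; have [[_ _ inj _] _] := tP x; apply: inj => //.
  by move: zz'; rewrite Zv0 addr0.
- apply: (allpairs_uniq_dep (f := fun _ z => z)) => // [x _|].
    by have [[]] := tP x.
  move=> _ _ /allpairsPdep[x [z [xs zt ->]]] /allpairsPdep[x' [z' [xs' zt' ->]]] /= zz'.
  subst z'; have [|-> _ //] := key x x' z z 0 xs xs' zt zt'.
  by rewrite Zv0 addr0; exact: sim_refl.
Qed.

Lemma double_half (g c : R) : 2 * ((g + c) / 2) - c = g. Proof. lra. Qed.

(** The levels of the image of the arrangement under the homothety of ratio 1/2 centred at x0, whose
    inverse is [y *+ 2 - x0]. This centre keeps the levels through x0, hence the flat. *)
Definition halve G : I -> set R :=
  fun i => [set h | G i (2 * h - dot (a i) x0)].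

Lemma dot_double i x : dot (a i) (x *+ 2 - x0) = 2 * dot (a i) x - dot (a i) x0.
Proof. by rewrite linearB /= raddfMn mulr_natl. Qed.

Lemma sim_halve G x y :
  sim a (halve G) x y <-> sim a G (x *+ 2 - x0) (y *+ 2 - x0).
Proof.
have sg2 (r : R) : Num.sg (2 * r) = Num.sg r by rewrite sgrM gtr0_sg ?mul1r.
have E i z (h : R) : 2 * dot (a i) z - dot (a i) x0 - (2 * h - dot (a i) x0)
    = 2 * (dot (a i) z - h) :> R.
  by rewrite opprB addrA subrK mulrBr.
split=> xy i g Gg.
  rewrite !dot_double.
  rewrite -(double_half g (dot (a i) x0)) !E !sg2; apply: xy.
  by rewrite /halve /= double_half.
by have := xy i _ Gg; rewrite !dot_double !E !sg2.
Qed.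

Lemma dirs_halve G x : dirs a (halve G) x = dirs a G (x *+ 2 - x0).
Proof.
by apply/vspaceP => u; apply/mem_dirs/mem_dirs => H i Gi; apply: H;
  move: Gi; rewrite /halve /= dot_double.
Qed.

Lemma halve_periodic G : periodic G -> periodic (halve G).
Proof.
have E (h d c : R) : 2 * (h + d) - c = 2 * h - c + (d + d) by lra.
move=> Gp i h k /= Gh; have := Gp i _ (k + k) Gh.
by rewrite ZvD linearD /halve /= E.
Qed.

Lemma halve_locally_finite G : locally_finite G -> locally_finite (halve G).
Proof.
move=> Glf i M; set c := dot (a i) x0.
have := finite_image (fun g : R => (g + c) / 2) (Glf i (2 * M + `|c|)).
apply: sub_finite_set => h [/= Gh hM]; exists (2 * h - c).
  split=> //; apply: le_trans (ler_normB _ _) _; rewrite lerD2r normrM.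
  by rewrite ger0_norm // ler_wpM2l.
by move: c h Gh hM => c h _ _; lra.
Qed.

Lemma halve_unbounded G : unbounded G -> unbounded (halve G).
Proof.
move=> Gu i M; set c := dot (a i) x0.
have [[g Gg gM] [h Gh hM]] := Gu i (2 * M - c); split.
  exists ((g + c) / 2); first by rewrite /halve /= double_half.
  by move: (c : R) gM => d gM; lra.
exists ((h + c) / 2); first by rewrite /halve /= double_half.
by move: (c : R) hM => d hM; lra.
Qed.

Lemma double_shift y k : (y + Zv k) *+ 2 - x0 = y *+ 2 - x0 + Zv (k + k).
Proof. rewrite mulrnDl ZvD; exact: addrAC. Qed.

Lemma halve_free G : free_translations G -> free_translations (halve G).
Proof.
move=> Gfree x k /sim_halve; rewrite double_shift.
move=> /Gfree kk; apply/rowP => j.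
have := congr1 (fun M : 'rV[int]_n => M 0 j) kk; rewrite !mxE /=; move: (k 0 j) => c; lia.
Qed.

Lemma halve_flat_of G : flat_of G -> flat_of (halve G).
Proof.
by move=> GS i iS; rewrite /halve /= mulr_natl mulr2n addrK; exact: GS.
Qed.

(** The class modulo 2 Z^n. On the lattice Lambda of directions of a flat it separates exactly the
    cosets of 2 Lambda, since half of an even vector of Lambda is again in Lambda. *)
Definition parity k : {ffun 'I_n -> bool} := [ffun j => odd (absz (k 0 j))].

Lemma parity_eq k m : parity k = parity m -> exists d, k = m + (d + d).
Proof.
move=> /ffunP km; exists (\row_j divz (k 0 j - m 0 j) 2).
apply/rowP => j; have := km j; rewrite !ffunE !mxE.
move: (k 0 j) (m 0 j) => c d; lia.
Qed.

Lemma parity_double k m : parity (k + (m + m)) = parity k.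
Proof.
by apply/ffunP => j; rewrite !ffunE !mxE; move: (k 0 j) (m 0 j) => c d; lia.
Qed.

(** Descent: halving an even nonzero vector lowers the sum of the absolute values of its entries. *)
Lemma exists_odd (P : 'rV[int]_n -> Prop) : (forall k, P (k + k) -> P k) ->
  (exists2 k, k != 0 & P k) -> exists2 k, parity k != parity 0 & P k.
Proof.
move=> Phalf [k]; have [N] := ubnP (\sum_j absz (k 0%R j))%N.
elim: N k => // N IH k kN k0 Pk.
have [/parity_eq[d]|kodd] := eqVneq (parity k) (parity 0); last by exists k.
rewrite add0r => kd; apply: (IH d); last 2 first.
- by apply: contraNneq k0 => d0; rewrite kd d0 addr0.
- by apply: Phalf; rewrite -kd.
rewrite ltnS in kN; apply: leq_trans kN; rewrite kd; have [j dj] : exists j, d 0 j != 0.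
  apply/existsP; apply: contraNT k0; rewrite negb_exists => /forallP d0.
  rewrite kd; apply/eqP/rowP => j; rewrite !mxE; have := d0 j; move: (d 0 j) => c; lia.
rewrite (bigD1 j) //= [X in (_ <= X)%N](bigD1 j) //= -addSn; apply: leq_add.
  by rewrite !mxE; move: (d 0 j) dj => c; lia.
by apply: leq_sum => i _; rewrite !mxE; move: (d 0 i) => c; lia.
Qed.

(** A transfer argument for the Euler characteristic of a torus. Undoing the homothety, the cells of
    [halve G] modulo Lambda become the cells of G modulo 2 Lambda, and each class modulo Lambda
    splits into one class per coset of 2 Lambda. *)
Lemma euler_torus G s : locally_finite G -> periodic G -> unbounded G ->
  free_translations G -> flat_of G -> transv (orb G) aflat s ->
  (exists2 k, k != 0 & Zv k \in aflat_dir) ->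
  \sum_(x <- s) (-1) ^+ \dim (dirs a G x) = 0 :> int.
Proof.
move=> Glf Gp Gu Gfree GS str kex.
pose Gam k := Zv k \in aflat_dir.
have half_dir u : u *+ 2 \in aflat_dir -> u \in aflat_dir.
  move=> /mem_aflat_dir u2; apply/mem_aflat_dir => i iS.
  by have := u2 i iS; rewrite raddfMn => /eqP; rewrite mulrn_eq0 => /eqP.
have Gam2 k : Gam (k + k) -> Gam k by rewrite /Gam ZvD => /half_dir.
have [k1 k1odd Gk1] := exists_odd Gam2 kex.
(* The cosets of 2 Lambda in Lambda; [gam] picks a member of each. *)
pose PS := [set p | `[< exists2 k, Gam k & parity k = p >]]%SET.
have /choice[gam gamP] : forall p, exists k, p \in PS -> Gam k /\ parity k = p.
  move=> p; case: (boolP (p \in PS)) => [|_]; last by exists 0.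
  by rewrite inE => /asboolP[k Gk kp]; exists k.
pose sig x : 'rV[R]_n := 2^-1 *: (x + x0).
have sigK x : sig x *+ 2 - x0 = x.
  have h2 : 2^-1 *+ 2 = 1 :> R by lra.
  by rewrite /sig scalerMnl h2 scale1r addrK.
pose pt (x : 'rV[R]_n) p := sig (x + Zv (gam p)).
pose s' := [seq pt x p | x <- s, p <- enum PS].
have [sA scov sinj s_uniq] := str.
have key x x' p p' m : x \in s -> x' \in s -> p \in PS -> p' \in PS ->
    sim a (halve G) (pt x p) (pt x' p' + Zv m) -> x = x' /\ p = p'.
  move=> xs xs' pP pP' /sim_halve.
  rewrite double_shift !sigK -[_ + Zv (m + m)]addrA -ZvD.
  move=> /(sim_shift (- gam p) Gp); rewrite {1}ZvN addrK -addrA -ZvD => xx'.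
  have xE : x = x' by apply: sinj => //; eexists; exact: xx'.
  split=> //; move: xx'; rewrite -xE => /Gfree /eqP; rewrite subr_eq0 => /eqP kE.
  have [_ <-] := gamP p pP; have [_ <-] := gamP p' pP'.
  by rewrite -kE parity_double.
have str' : transv (orb (halve G)) aflat s'.
  split.
  - move=> _ /allpairsP[[x p] [/= xs pP ->]]; rewrite mem_enum in pP.
    move=> i iS; rewrite /pt /sig linearZ !linearD /= sA //.
    have [/mem_aflat_dir -> // _] := gamP p pP.
    by rewrite addr0 /GRing.scale /=; move: (dot (a i) x0 : R) => c; lra.
  - move=> y yA; have yA2 : aflat (y *+ 2 - x0).
      by move=> i iS; rewrite dot_double yA // mulr_natl mulr2n addrK.
    have [x xs [k yx]] := scov _ yA2.
    have Gk : Gam k.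
      have := aflat_sub (sA x xs) (aflat_cell GS yA2 yx).
      by rewrite addrC addKr.
    have kP : parity k \in PS by rewrite inE; apply/asboolP; exists k.
    have [Gg gE] := gamP _ kP; have [d kd] := parity_eq (esym gE).
    exists (pt x (parity k)).
      by apply/allpairsP; exists (x, parity k); rewrite mem_enum.
    exists d; apply/sim_halve; rewrite double_shift sigK.
    by rewrite -[X in sim _ _ _ X]addrA -ZvD -kd.
  - move=> _ _ /allpairsP[[x p] [/= xs pP ->]] /allpairsP[[x' p'] [/= xs' pP' ->]] [m].
    rewrite mem_enum in pP; rewrite mem_enum in pP'.
    by move=> /(key _ _ _ _ _ xs xs' pP pP')[-> ->].
  - apply: allpairs_uniq; rewrite ?enum_uniq //.
    move=> _ _ /allpairsP[[x p] [/= xs pP ->]] /allpairsP[[x' p'] [/= xs' pP' ->]] /= ptE.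
    rewrite mem_enum in pP; rewrite mem_enum in pP'.
    have [|-> -> //] := key x x' p p' 0 xs xs' pP pP'.
    by rewrite ptE Zv0 addr0; exact: sim_refl.
(* The common refinement, whose signed count agrees with that of G and with that of [halve G]. *)
pose B i := G i `|` halve G i.
have Blf : locally_finite B.
  move=> i M; have := halve_locally_finite Glf i M; have := Glf i M.
  move=> f1 f2; have : finite_set ([set g | G i g /\ `|g| <= M] `|`
    [set g | halve G i g /\ `|g| <= M]) by rewrite finite_setU.
  by apply: sub_finite_set => g [[Gg|Gg] gM]; [left|right].
have Bp : periodic B.
  by move=> i g k [Gg|Gg]; [left; exact: Gp|right; exact: halve_periodic].
have [t ttr tsum] := euler_refine Glf Blf (fun i => @subsetUl _ _ _) Gp Bp Gu Gfree GS str.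
have [t' ttr' tsum'] := euler_refine (halve_locally_finite Glf) Blf
  (fun i => @subsetUr _ _ _) (halve_periodic Gp) Bp (halve_unbounded Gu)
  (halve_free Gfree) (halve_flat_of GS) str'.
have : \sum_(x <- s) (-1) ^+ \dim (dirs a G x) =
       \sum_(x <- s') (-1) ^+ \dim (dirs a (halve G) x) :> int.
  rewrite -tsum -tsum'; apply: transv_sum ttr ttr'.
  - by move=> x y _ _; exact: orb_sym.
  - by move=> x y z _ _ _; exact: orb_trans.
  - by move=> x y _ _ /(orb_dirs Bp) ->.
rewrite /s' big_allpairs_dep /=.
have sumE x : \sum_(p <- enum PS) (-1) ^+ \dim (dirs a (halve G) (pt x p)) =
    #|PS|%:R * (-1) ^+ \dim (dirs a G x) :> int.
  rewrite -sum1_card big_enum natr_sum mulr_suml; apply: eq_bigr => p _.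
  by rewrite dirs_halve sigK dirs_shift // mul1r.
under [in X in _ = X]eq_bigr do rewrite sumE.
rewrite -mulr_sumr; set X := \sum_(x <- s) _.
(* The classes of k1 and 0 differ, and an integer equal to at least twice itself as a multiple must
   be 0. *)
have PS2 : (1 < #|PS|)%N.
  apply/card_gt1P; exists (parity k1), (parity 0); split=> //.
    by rewrite inE; apply/asboolP; exists k1.
  by rewrite inE; apply/asboolP; exists 0; rewrite // /Gam Zv0 mem0v.
by move: PS2; rewrite natz; move: #|PS| X => m X; nia.
Qed.

End Flat.
End Periodic.

(** * The topology of the torus *)


(** If membership in D is locally constant on E, then D is open and closed in E, and the component
    of x cannot leave it. *)
Lemma component_clopen (T : topologicalType) (E D : set T) (x : T) :
  connected D -> D `<=` E -> D x ->
  (forall p, E p -> nbhs p [set q | E q -> (D q <-> D p)]) ->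
  connected_component E x = D.
Proof.
move=> Dconn DE Dx loc; apply/seteqP; split; last exact: connected_component_max.
set C := connected_component E x.
have CE : C `<=` E by exact: connected_component_sub.
have Cx : C x by apply: connected_component_refl; exact: DE.
suff CD : C `&` D = C by rewrite -CD; exact: subIsetr.
apply: (component_connected (A := E) (x := x)); first by exists x.
  exists [set q | E q -> D q]^°; first exact: open_interior.
  apply/seteqP; split=> p [Cp]; last first.
    by move=> /nbhs_singleton /= Dp; split=> //; apply: Dp; exact: CE.
  move=> Dp; split=> //; apply: filterS (loc p (CE p Cp)) => q /= H Eq.
  by apply/(H Eq).
exists (~` [set q | E q -> ~ D q]^°).
  by apply: open_closedC; exact: open_interior.
apply/seteqP; split=> p [Cp].
  by move=> Dp; split=> // /nbhs_singleton /= /(_ (CE p Cp)).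
move=> Op; split=> //; apply: contrapT => nDp; apply: Op.
by apply: filterS (loc p (CE p Cp)) => q /= H Eq /(H Eq).
Qed.

Section TorusTopology.
Variables (R : realType) (n : nat).
Implicit Types (x y z : 'rV[R]_n) (k : 'rV[int]_n) (P Q : torus R n).
Local Notation pr := (@torus_proj R n).
Local Notation Zv := (@Zv R n).

Lemma torus_projP x y : pr x = pr y <-> exists k, x - y = Zv k.
Proof.
split=> [/eqmodP/asboolP //|xy].
by apply/eqmodP/asboolP.
Qed.

Lemma torus_projD x k : pr (x + Zv k) = pr x.
Proof. by apply/torus_projP; exists k; rewrite addrC addKr. Qed.

Lemma torus_proj_surj P : exists x, P = pr x.
Proof. by exists (repr P); rewrite /torus_proj reprK. Qed.

Lemma torus_proj_continuous : continuous pr.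
Proof. exact: pi_continuous. Qed.

(** The projection is open, because the preimage of the image of a ball is the union of the lattice
    translates of the ball. *)
Lemma nbhs_torusP x (W : set (torus R n)) :
  nbhs (pr x) W <-> exists2 e, 0 < e & forall y, `|y - x| < e -> W (pr y).
Proof.
split=> [/torus_proj_continuous /nbhs_ballP[e /= e0 xe]|[e e0 xe]].
  exists e => // y yx; apply: xe; rewrite /= -ball_normE /ball_ /=.
  by rewrite distrC.
rewrite nbhsE; exists (pr @` ball x e); last first.
  move=> _ [y + <-]; rewrite -ball_normE /= distrC; exact: xe.
split; last by exists x => //; exact: ballxx.
rewrite /open /= /quotient_open.
have -> : \pi_(torus R n)%qT @^-1` (pr @` ball x e) =
    \bigcup_(k in setT) ball (x + Zv k) e.
  apply/seteqP; split=> [y [z xz /torus_projP[k zy]]|y [k _]].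
    exists (- k) => //; move: xz; rewrite -!ball_normE /=.
    by rewrite ZvN -zy opprB addrAC subrKA.
  rewrite -ball_normE /= => xy; exists (y - Zv k); last first.
    by rewrite -ZvN; exact: torus_projD.
  by rewrite /= opprB addrA.
by apply: bigcup_open => k _; exact: ball_open.
Qed.

Lemma connected_segment_image x y :
  connected ((fun t : R => pr (x + t *: (y - x))) @` `[0, 1]%classic).
Proof.
apply: connected_continuous_connected; first exact: segment_connected.
apply: continuous_subspaceT => t.
apply: (@continuous_comp _ _ _ (fun t : R => x + t *: (y - x)) pr); last first.
  exact: torus_proj_continuous.
apply: cvgD; first exact: cvg_cst.
by apply: cvgZr_tmp; exact: cvg_id.
Qed.

Definition segment_convex (F : set 'rV[R]_n) :=
  forall x y t, F x -> F y -> 0 <= t <= 1 -> F (x + t *: (y - x)).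

Lemma convex_setP (F : set 'rV[R]_n) : convex_set F <-> segment_convex F.
Proof.
have E x y (t : R) : t *: y + (1 - t) *: x = x + t *: (y - x).
  by rewrite scalerBl scalerBr scale1r addrCA.
split=> [Fc x y t Fx Fy /andP[t0 t1]|Fc x y t].
  have := Fc y x (Itv01 t0 t1); rewrite !inE => /(_ Fy Fx).
  by rewrite /conv /= /unstable.onem E.
rewrite !inE => Fx Fy; rewrite /conv /= /unstable.onem E; apply: Fc => //.
by rewrite ge0 le1.
Qed.

Lemma connected_convex_image (F : set 'rV[R]_n) x : segment_convex F -> F x ->
  connected (pr @` F).
Proof.
move=> Fc Fx.
have -> : pr @` F =
    \bigcup_(y in F) ((fun t : R => pr (x + t *: (y - x))) @` `[0, 1]%classic).
  apply/seteqP; split=> [_ [y Fy <-]|_ [y Fy [t /= t01 <-]]].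
    exists y => //; exists 1; first by rewrite /= in_itv /= ler01 lexx.
    by rewrite scale1r addrC subrK.
  by exists (x + t *: (y - x)) => //; apply: Fc => //; rewrite in_itv in t01.
apply: bigcup_connected => [|y _]; last exact: connected_segment_image.
exists (pr x) => y _; exists 0; first by rewrite /= in_itv /= lexx ler01.
by rewrite scale0r addr0.
Qed.

Lemma uncountable_pigeonhole (T : countType) (f : R -> T) :
  exists t s, [/\ 0 <= t <= 1, 0 <= s <= 1, t != s & f t = f s].
Proof.
apply: contrapT => nf.
have : countable (`[0, 1]%classic : set R).
  apply/countable_injP; exists (choice.pickle \o f) => t s; rewrite !inE /= !in_itv /=.
  move=> t01 s01 /(pcan_inj choice.pickleK) fts; apply: contrapT => ts; apply: nf.
  by exists t, s; split=> //; exact/eqP.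
move=> /countable_lebesgue_measure0; rewrite lebesgue_measure_itv /= lte_fin ltr01.
by rewrite oppr0 adde0 => /eqP; rewrite eqe oner_eq0.
Qed.

(** Each point of the segment from p1 to y lies in a lattice translate of p2 + V2. The points are
    uncountably many and the translates countably many, so two points share one, and y - p1 is a
    multiple of their difference. *)
Lemma affine_hull_dim_le (F1 F2 : set 'rV[R]_n) d1 d2 : segment_convex F1 ->
  affine_hull_dim F1 d1 -> affine_hull_dim F2 d2 -> pr @` F1 `<=` pr @` F2 ->
  (d1 <= d2)%N.
Proof.
move=> F1c [p1 [V1 [Fp1 _ V1min <-]]] [p2 [V2 [Fp2 FV2 _ <-]]] F12.
apply: dimvS; apply: V1min => y Fy.
have /choice[k kP] : forall t, exists k, 0 <= t <= 1 ->
    p1 + t *: (y - p1) - p2 + Zv k \in V2.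
  move=> t; have [t01|nt01] := pselect (0 <= t <= 1); last by exists 0.
  have [z Fz /torus_projP[k zE]] : (pr @` F2) (pr (p1 + t *: (y - p1))).
    by apply: F12; exists (p1 + t *: (y - p1)) => //; exact: F1c.
  exists k => _; have := FV2 z Fz; rewrite -zE.
  by rewrite [X in _ -> X \in _]addrC subrKA.
have [t [s [t01 s01 ts kts]]] := uncountable_pigeonhole k.
have := rpredB (kP t t01) (kP s s01); rewrite kts.
have -> : p1 + t *: (y - p1) - p2 + Zv (k s) -
    (p1 + s *: (y - p1) - p2 + Zv (k s)) = (t - s) *: (y - p1).
  by rewrite opprD addrACA subrr addr0 opprB addrA subrK opprD addrACA subrr add0r scalerBl.
move=> /(rpredZ (t - s)^-1); rewrite scalerA mulVf ?scale1r // subr_eq0 //.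
Qed.

Lemma torus_dimE (F : set 'rV[R]_n) d : segment_convex F -> affine_hull_dim F d ->
  torus_dim (pr @` F) = d.
Proof.
move=> Fc Fd; apply: xget_unique; first by exists F; split=> //; exact/convex_setP.
move=> e [F' [/convex_setP Fc' FF' Fe]]; apply/eqP; rewrite eqn_leq.
by rewrite (affine_hull_dim_le Fc' Fe Fd) ?FF' // (affine_hull_dim_le Fc Fd Fe) ?FF'.
Qed.

End TorusTopology.

(** * Contraction of loops in ball cells *)


Lemma continuous_comp_within (T U V : topologicalType) (A : set U)
    (h : T -> U) (g : U -> V) :
  continuous h -> (forall t, A (h t)) -> {within A, continuous g} ->
  continuous (g \o h).
Proof.
move=> hc hA /subspace_continuousP gc t W Wg.
have H : nbhs t (h @^-1` [set u | A u -> W (g u)]) := hc t _ (gc (h t) (hA t) W Wg).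
change (nbhs t ((g \o h) @^-1` W)).
by apply: filterS H => s /=; apply; exact: hA.
Qed.

Section Contraction.
Variables (R : realType) (n : nat).
Implicit Types (x y z : 'rV[R]_n) (k m : 'rV[int]_n) (P Q : torus R n).
Local Notation pr := (@torus_proj R n).
Local Notation Zv := (@Zv R n).

Lemma normr_entry x j : `|x 0 j| <= `|x|.
Proof.
by rewrite [leRHS]/Num.norm /= mx_normrE; apply/bigmax_geP; right; exists (0, j).
Qed.

Lemma Zv_small m : `|Zv m| < 1 -> m = 0.
Proof.
move=> m1; apply/rowP => j; rewrite [RHS]mxE.
have := le_lt_trans (normr_entry (Zv m) j) m1.
rewrite mxE -intr_norm -[1]/(1%:~R) ltr_int; move: (m 0 j) => c; lia.
Qed.

(** This is min(max(r, 0), 1). Composition with it extends paths from [0, 1] to R, so that their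
    continuity need not be relative to the interval. *)
Definition clamp (r : R) : R := (`|r| - `|r - 1| + 1) / 2.

Lemma clamp_continuous : continuous clamp.
Proof.
move=> r; apply: cvgMl; apply: cvgD; last exact: cvg_cst.
apply: cvgB; first exact: norm_continuous.
apply: (@continuous_comp _ _ _ (fun s : R => s - 1) (fun s : R => `|s|)).
  by apply: cvgB; [exact: cvg_id|exact: cvg_cst].
exact: norm_continuous.
Qed.

Lemma clamp_id r : 0 <= r <= 1 -> clamp r = r.
Proof.
move=> /andP[r0 r1]; rewrite /clamp ger0_norm // ler0_norm ?subr_le0 //; lra.
Qed.

Lemma clamp01 r : 0 <= clamp r <= 1.
Proof.
rewrite /clamp; case: (ger0P r) => r0; case: (ger0P (r - 1)) => r1; lra.
Qed.

Definition torus_small (e : R) P Q :=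
  exists x y, [/\ P = pr x, Q = pr y & `|y - x| < e].

Lemma torus_small_lift e x Q : torus_small e (pr x) Q ->
  exists2 y, Q = pr y & `|y - x| < e.
Proof.
move=> [x' [y' [/torus_projP[k xx'] -> xy]]]; exists (y' + Zv k).
  by rewrite torus_projD.
by rewrite -xx' addrAC subrKA.
Qed.

Lemma torus_small_trans P Q S e d :
  torus_small e Q P -> torus_small d Q S -> torus_small (e + d) P S.
Proof.
move=> [x [y [-> -> xy]]] /torus_small_lift[z -> xz]; exists y, z; split=> //.
have := ler_normD (z - x) (x - y); rewrite subrKA => h; apply: le_lt_trans h _.
by rewrite addrC; apply: ltrD => //; rewrite distrC.
Qed.

(** Uniform continuity on the compact square. The constant 1/4 is such that four steps stay below 1,
    the norm under which 0 is the only lattice vector. *)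
Lemma torus_small_uniform (h : R * R -> torus R n) : continuous h ->
  exists2 d, 0 < d & forall s t s' t', 0 <= s <= 1 -> 0 <= t <= 1 ->
    `|s' - s| < d -> `|t' - t| < d -> torus_small 4^-1 (h (s, t)) (h (s', t')).
Proof.
move=> hc; pose K : set (R * R) := `[0, 1]%classic `*` `[0, 1]%classic.
have Kc : compact K by apply: compact_setX; exact: segment_compact.
pose PP (d : R) (p : R * R) := forall s' t',
  `|s' - p.1| < d -> `|t' - p.2| < d -> torus_small 4^-1 (h p) (h (s', t')).
have := (compact_near_coveringP K).1 Kc R (at_right 0) PP _.
move=> /(_ _)[p Kp|e /= e0 eP].
  (* Both points to be compared are within 1/8 of the value at p, hence within 1/4 of each other. *)
  have : nbhs (h p) (torus_small 8^-1 (h p)).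
    have [x ->] := torus_proj_surj (h p); apply/nbhs_torusP; exists 8^-1 => // y yx.
    by exists x, y.
  move=> /hc /nbhs_ballP[r /= r0 rP].
  have hr s t : `|s - p.1| < r -> `|t - p.2| < r -> torus_small 8^-1 (h p) (h (s, t)).
    by move=> sr tr; apply: rP; split; rewrite /= /ball /= distrC.
  exists (ball p (r / 2), [set d : R | 0 < d < r / 2]) => /=.
    split; first by apply: nbhsx_ballx; lra.
    exists (r / 2); first by rewrite /=; lra.
    by move=> d /=; rewrite sub0r normrN => dr d0; rewrite d0 -(gtr0_norm d0).
  move=> [[s t] d] /= [[]]; rewrite /ball /= => ps pt /andP[d0 dr] s' t' ss' tt'.
  have -> : 4^-1 = 8^-1 + 8^-1 :> R by lra.
  apply: torus_small_trans; apply: hr.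
  - by rewrite distrC; lra.
  - by rewrite distrC; lra.
  - rewrite /= in ss'; have := ler_distD s s' p.1; rewrite (distrC s p.1); lra.
  - rewrite /= in tt'; have := ler_distD t t' p.2; rewrite (distrC t p.2); lra.
exists (e / 2); first by lra.
move=> s t s' t' s01 t01 ss' tt'; apply: (eP (e / 2)) => //=.
- by rewrite sub0r normrN gtr0_norm; lra.
- by lra.
Qed.

(** * Lifting a homotopy row by row over a grid *)

Section Grid.
Variables (h : R * R -> torus R n) (N : nat) (x : 'rV[R]_n) (k : 'rV[int]_n).
Hypothesis h_small : forall i j i' j',
  (i <= N)%N -> (j <= N)%N -> (i' <= i.+1)%N -> (i <= i'.+1)%N ->
  (j' <= j.+1)%N -> (j <= j'.+1)%N ->
  torus_small 4^-1 (h (i%:R / N%:R, j%:R / N%:R)) (h (i'%:R / N%:R, j'%:R / N%:R)).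
Hypothesis h_loop : forall i, h (i%:R / N%:R, N%:R / N%:R) = h (i%:R / N%:R, 0).
Hypothesis h_const : forall j, h (0, j%:R / N%:R) = h (0, 0).
Hypothesis h_line : forall j, (j <= N)%N ->
  h (N%:R / N%:R, j%:R / N%:R) = pr (x + (j%:R / N%:R) *: Zv k).
Hypothesis N_gt0 : (0 < N)%N.
Hypothesis k_small : `|N%:R^-1 *: Zv k| < 4^-1.

Definition row_lift (i : nat) (L : nat -> 'rV[R]_n) :=
  [/\ forall j, (j <= N)%N -> h (i%:R / N%:R, j%:R / N%:R) = pr (L j),
      forall j, (j < N)%N -> `|L j.+1 - L j| < 4^-1 & L N - L 0 = Zv k].

Lemma row_lift_top : row_lift N (fun j => x + (j%:R / N%:R) *: Zv k).
Proof.
have N0 : N%:R != 0 :> R by rewrite pnatr_eq0 -lt0n.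
split=> [j jN|j jN|]; first exact: h_line.
  rewrite opprD addrACA subrr add0r -scalerBl -mulrBl -natr1 addrAC subrr add0r.
  by rewrite mul1r.
by rewrite mulfV // scale1r mul0r scale0r addr0 addrAC subrr add0r.
Qed.

Lemma norm4 (u v w t : 'rV[R]_n) : `|u + v + w + t| <= `|u| + `|v| + `|w| + `|t|.
Proof.
do 3! (apply: le_trans (ler_normD _ _) _; rewrite lerD2r).
exact: lexx.
Qed.

(** Each grid point is lifted close to the lift of its neighbour in row i + 1. The steps stay small
    and the displacement stays [Zv k] because in both cases the possible error is a lattice vector
    of norm less than 1. *)
Lemma row_lift_down i L : (i < N)%N -> row_lift i.+1 L -> exists L', row_lift i L'.
Proof.
move=> iN [Lpr Lstep Lend].
have /choice[L' L'P] : forall j, exists y, (j <= N)%N ->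
    h (i%:R / N%:R, j%:R / N%:R) = pr y /\ `|y - L j| < 4^-1.
  move=> j; have [jN|jN] := leqP j N; last by exists 0.
  have := @h_small i.+1 j i j iN jN (leqW (leqnSn i)) (leqnn _) (leqnSn j) (leqnSn j).
  by rewrite Lpr // => /torus_small_lift[y yE yL]; exists y.
exists L'; split=> [j jN|j jN|]; first by have [] := L'P j jN.
  have [E1 d1] := L'P j (ltnW jN); have [E2 d2] := L'P j.+1 jN.
  have := @h_small i j i j.+1 (ltnW iN) (ltnW jN) (leqnSn i) (leqnSn i)
    (leqnn _) (leqW (leqnSn j)).
  rewrite E1 E2 => /torus_small_lift[y /torus_projP[m mE] yd].
  suff m0 : m = 0.
    by move: mE; rewrite m0 Zv0 => /eqP; rewrite subr_eq0 => /eqP ->.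
  apply: Zv_small; rewrite -mE; have step := Lstep j jN.
  (* A turn around one square of the grid, in four moves shorter than 1/4. *)
  have -> : L' j.+1 - y = (L' j.+1 - L j.+1) + (L j.+1 - L j) + (L j - L' j) + (L' j - y).
    by rewrite !addrA !subrK.
  apply: le_lt_trans (norm4 _ _ _ _) _; rewrite (distrC (L j)) (distrC (L' j) y); lra.
have [E1 d1] := L'P 0%N (leq0n N); have [E2 d2] := L'P N (leqnn N).
have := h_loop i; rewrite E2 -(mul0r (N%:R^-1)) E1 => /torus_projP[m mE].
suff mk : m - k = 0 by rewrite mE; congr Zv; apply/eqP; rewrite -subr_eq0 mk.
apply: Zv_small; rewrite ZvD ZvN -mE -Lend.
have -> : L' N - L' 0%N - (L N - L 0%N) = (L' N - L N) - (L' 0%N - L 0%N).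
  by rewrite !opprD !opprK addrACA.
apply: le_lt_trans (ler_normB _ _) _; lra.
Qed.

Lemma row_lift_all i : (i <= N)%N -> exists L, row_lift (N - i) L.
Proof.
elim: i => [_|i IH iN]; first by rewrite subn0; eexists; exact: row_lift_top.
have [L LP] := IH (ltnW iN); apply: (@row_lift_down _ L); first by lia.
by have -> : (N - i.+1).+1 = (N - i)%N by lia.
Qed.

(** Row 0 is a constant path, so that its lift is constant, while the lift has displacement
    [Zv k]. *)
Lemma grid_trivial : k = 0.
Proof.
have [L] := row_lift_all (leqnn N); rewrite subnn => -[Lpr Lstep Lend].
have LE j : (j <= N)%N -> L j = L 0%N.
  elim: j => // j IH jN; rewrite -IH ?(ltnW jN) //.
  have := Lpr _ jN; rewrite mul0r h_const -(h_const j) -(mul0r N%:R^-1).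
  rewrite Lpr ?(ltnW jN) // => /esym /torus_projP[m mE].
  have m0 : m = 0.
    by apply: Zv_small; rewrite -mE; apply: lt_trans (Lstep j jN) _; lra.
  by move: mE; rewrite m0 Zv0 => /eqP; rewrite subr_eq0 => /eqP ->.
by apply: Zv_small; rewrite -Lend LE // subrr normr0 ltr01.
Qed.

End Grid.

(* A loop in the closed ball can be contracted to a point, so that its lift to
   R^n is closed. *)
Lemma contract_loop (C : set (torus R n)) d x k : ball_cell R d C ->
  (forall t, 0 <= t <= 1 -> closure C (pr (x + t *: Zv k))) -> k = 0.
Proof.
move=> [f [g [fc gc fK fC _]]] xC.
pose c1 t := pr (x + clamp t *: Zv k).
have c1C t : closure C (c1 t) by apply: xC; exact: clamp01.
have c1c : continuous c1.
  move=> t; apply: (@continuous_comp _ _ _ (fun t => x + clamp t *: Zv k) pr).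
    apply: cvgD; first exact: cvg_cst.
    by apply: cvgZr_tmp; exact: clamp_continuous.
  exact: torus_proj_continuous.
have c2c : continuous (g \o c1) := continuous_comp_within c1c c1C gc.
have c2D t : closed_disk (g (c1 t)) /\ f (g (c1 t)) = c1 t.
  have := c1C t; rewrite -fC => -[w wD wE]; rewrite -wE fK ?inE //.
(* Radial contraction of the loop to the centre of the ball. *)
pose c3 (p : R * R) := clamp p.1 *: g (c1 p.2).
have c3D p : closed_disk (c3 p).
  have [+ _] := c2D p.2; rewrite /closed_disk /=; apply: le_trans.
  apply: ler_sum => i _; rewrite mxE exprMn ler_piMl ?sqr_ge0 //.
  by have /andP[c0 c1'] := clamp01 p.1; rewrite exprn_ile1.
have c3c : continuous c3.
  move=> p; apply: (@cvgZ _ _ _ _ _ (fun p : R * R => clamp p.1) (fun p => g (c1 p.2))).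
    apply: (@continuous_comp _ _ _ fst clamp); [exact: cvg_fst|exact: clamp_continuous].
  apply: (@continuous_comp _ _ _ snd (g \o c1)); [exact: cvg_snd|exact: c2c].
pose h := f \o c3.
have hc : continuous h := continuous_comp_within c3c c3D fc.
have [e e0 eP] := torus_small_uniform hc.
(* N > M ensures both 1/N < e, the mesh for uniform continuity, and |Zv k| / N < 1/4, the step along
   the original loop. *)
pose M := e^-1 + 4 * `|Zv k| + 1.
have M0 : 0 <= M by rewrite /M !addr_ge0 ?invr_ge0 ?mulr_ge0 // ltW.
pose N := Num.bound M; have NM : M < N%:R := archi_boundP M0.
have N0 : 0 < N%:R :> R by exact: le_lt_trans NM.
have Ngt0 : (0 < N)%N by rewrite -(ltr0n R).
have Ne : N%:R^-1 < e.
  rewrite invf_plt ?posrE //; apply: le_lt_trans NM; rewrite /M -addrA lerDl.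
  by rewrite addr_ge0 // mulr_ge0.
have in01 j : (j <= N)%N -> 0 <= (j%:R / N%:R : R) <= 1.
  by move=> jN; rewrite divr_ge0 //= ler_pdivrMr // mul1r ler_nat.
have close i i' : (i' <= i.+1)%N -> (i <= i'.+1)%N ->
    `|i'%:R / N%:R - i%:R / N%:R| < e.
  move=> ii' i'i; rewrite -mulrBl normrM [X in _ * X]gtr0_norm ?invr_gt0 //.
  apply: le_lt_trans Ne; rewrite ler_piMl ?invr_ge0 ?(ltW N0) //.
  have : i'%:R <= i%:R + 1 :> R by rewrite natr1 ler_nat.
  have : i%:R <= i'%:R + 1 :> R by rewrite natr1 ler_nat.
  by rewrite ler_norml; lra.
have clamp_in t : 0 <= t <= 1 -> clamp t = t by exact: clamp_id.
have c1_loop : c1 1 = c1 0.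
  rewrite /c1 !clamp_in ?lexx ?ler01 // scale1r scale0r addr0; exact: torus_projD.
have NN : N%:R / N%:R = 1 :> R by rewrite mulfV // gt_eqF.
apply: (@grid_trivial h N x k) => //.
- move=> i j i' j' iN jN ii' i'i jj' j'j.
  by apply: eP; [exact: in01|exact: in01|exact: close|exact: close].
- by move=> i; rewrite NN /h /= /c3 /= c1_loop.
- by move=> j; rewrite /h /= /c3 /= clamp_in ?lexx ?ler01 // !scale0r.
- move=> j jN; rewrite NN /h /= /c3 /= clamp_in ?lexx ?ler01 // scale1r.
  by have [_ ->] := c2D (j%:R / N%:R); rewrite /c1 clamp_in // in01.
- rewrite normrZ gtr0_norm ?invr_gt0 // mulrC ltr_pdivrMr //.
  have : 4 * `|Zv k| < N%:R.
    apply: le_lt_trans NM; rewrite /M addrAC lerDr addr_ge0 ?invr_ge0 // ltW //.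
  lra.
Qed.

End Contraction.

(** * Toric arrangements *)


Lemma dot_norm (R : realType) n (b u : 'rV[R]_n) :
  `|dot b u| <= (\sum_j `|b 0 j|) * `|u|.
Proof.
rewrite mulr_suml; apply: le_trans (ler_norm_sum _ _ _) _.
by apply: ler_sum => j _; rewrite normrM ler_wpM2l // normr_entry.
Qed.

Lemma dot_near (R : realType) n (I : finType) (a : I -> 'rV[R]_n) (e : R) : 0 < e ->
  exists2 d, 0 < d & forall y z, `|z - y| < d ->
    forall i, `|dot (a i) z - dot (a i) y| < e.
Proof.
move=> e0; pose B := \sum_i \sum_j `|a i 0 j| + 1.
have B0 : 0 < B by rewrite ltr_wpDl // sumr_ge0 // => i _; rewrite sumr_ge0.
exists (e / B) => [|y z yz i]; first exact: divr_gt0.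
rewrite -linearB /=; apply: le_lt_trans (dot_norm _ _) _.
apply: (@le_lt_trans _ _ (B * `|z - y|)); last by rewrite mulrC -ltr_pdivlMr.
rewrite ler_wpM2r // /B (bigD1 i) //= -addrA lerDl addr_ge0 // sumr_ge0 // => l _.
by rewrite sumr_ge0.
Qed.

Lemma common_denominator n (v : 'rV[rat]_n) : exists (D : int) (k : 'rV[int]_n),
  0 < D /\ forall j, v 0 j * D%:~R = (k 0 j)%:~R.
Proof.
pose D : int := \prod_j denq (v 0 j).
exists D, (\row_j (numq (v 0 j) * \prod_(l | l != j) denq (v 0 l))).
split=> [|j]; first by rewrite prodr_gt0 // => j _; exact: denq_gt0.
rewrite mxE /D (bigD1 j) //= !intrM mulrA; congr (_ * _).
by rewrite -{1}[v 0 j]divq_num_den divfK // intr_eq0 denq_neq0.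
Qed.

Lemma finite_int_bounded (R : realType) (M : R) :
  finite_set [set z : int | `|z%:~R| <= M :> R].
Proof.
have [M0|M0] := ltrP M 0.
  apply: (@sub_finite_set _ _ set0) => // z /=.
  by rewrite leNgt (lt_le_trans M0) // normr_ge0.
pose N := Num.bound M; have NM : M < N%:R := archi_boundP M0.
apply: (@sub_finite_set _ _ ((fun m : nat => m%:Z - N%:Z) @` `I_(N + N).+1)).
  move=> z /= zM; have : `|z%:~R| < N%:R :> R by exact: le_lt_trans NM.
  rewrite -intr_norm -[N%:R]/(N%:Z%:~R) ltr_int => zN.
  exists (absz (z + N%:Z)); rewrite /=; lia.
exact/finite_image/finite_II.
Qed.

Section ToricData.
Variables (R : realType) (n : nat) (I : finType).
Variables (aQ : I -> 'rV[rat]_n) (b : I -> R).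
Hypothesis aQ_neq0 : forall i, aQ i != 0.
Implicit Types (x y z u v p q : 'rV[R]_n) (k m : 'rV[int]_n) (P Q : torus R n).
Implicit Types (S T : {set I}).
Local Notation pr := (@torus_proj R n).
Local Notation Zv := (@Zv R n).

Definition rvec i : 'rV[R]_n := map_mx ratr (aQ i).
Local Notation a := rvec.

Definition hyp i : set (torus R n) := pr @` [set x | dot (a i) x = b i].

(** The preimage of the toric hyperplane i in R^n is the union of the parallel hyperplanes on which
    [a i] takes these values. *)
Definition levels i : set R := [set g | exists k, g = b i + dot (a i) (Zv k)].
Local Notation G := levels.

Local Notation "x ~~ y" := (sim a G x y) (at level 70).
Local Notation "x ==> y" := (leface a G x y).
Local Notation cell := (cell a G).
Local Notation dirs := (dirs a G).
Local Notation aflat := (aflat a).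
Local Notation aflat_dir := (aflat_dir a).

Lemma hypP i x : hyp i (pr x) <-> G i (dot (a i) x).
Proof.
split=> [[y yb /torus_projP[k yx]]|[k xk]].
  exists (- k); rewrite ZvN linearN /= -yx linearB /= yb opprB addrCA subrr addr0 //.
exists (x - Zv k); last by rewrite -ZvN torus_projD.
by rewrite /= linearB /= xk addrK.
Qed.

Lemma levels_periodic : periodic a G.
Proof.
by move=> i g k [m ->]; exists (m + k); rewrite ZvD linearD /= addrA.
Qed.

(** The normal is rational with a common denominator D, so that its values on lattice vectors lie in
    the discrete set (1/D) Z. *)
Lemma levels_locally_finite : locally_finite G.
Proof.
move=> i M; have [D [w [D0 wE]]] := common_denominator (aQ i).
have DR0 : 0 < D%:~R :> R by rewrite ltr0z.
have dotZ k : dot (a i) (Zv k) = (\sum_j w 0 j * k 0 j)%:~R / D%:~R.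
  apply: (canRL (mulfK (lt0r_neq0 DR0))); rewrite mulr_suml rmorph_sum.
  apply: eq_bigr => j _; rewrite !mxE mulrAC rmorphM /=; congr (_ * _).
  have := congr1 (@ratr R) (wE j).
  by rewrite rmorphM /= !ratr_int.
have := finite_image (fun z : int => b i + z%:~R / D%:~R)
  (finite_int_bounded (D%:~R * (M + `|b i|) : R)).
apply: sub_finite_set => g [[k gE] gM]; exists (\sum_j w 0 j * k 0 j).
  rewrite /= -[X in `|X|](divfK (lt0r_neq0 DR0)) normrM (gtr0_norm DR0) mulrC.
  rewrite ler_pM2l // -dotZ.
  have -> : dot (a i) (Zv k) = g - b i by rewrite gE addrC addKr.
  by apply: le_trans (ler_normB _ _) _; rewrite lerD2r.
by rewrite gE dotZ.
Qed.

Lemma levels_unbounded : unbounded G.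
Proof.
move=> i M.
have [j aj] : exists j, aQ i 0 j != 0.
  apply/existsP; apply: contraNT (aQ_neq0 i); rewrite negb_exists => /forallP a0.
  by apply/eqP/rowP => j; rewrite mxE; apply/eqP; have := a0 j; rewrite negbK.
pose r : R := ratr (aQ i 0 j).
have r0 : r != 0 by rewrite fmorph_eq0.
have dotd (z : int) : dot (a i) (Zv (\row_l (if l == j then z else 0))) = r * z%:~R.
  rewrite /dot (bigD1 j) //= !mxE eqxx big1 ?addr0 // => l lj.
  by rewrite !mxE (negPf lj) mulr0.
have lev (z : int) : G i (b i + r * z%:~R).
  by exists (\row_l (if l == j then z else 0)); rewrite dotd.
have [N NP] : exists N : nat, `|M - b i| < `|r| * N%:R.
  exists (Num.bound (`|M - b i| / `|r|)).
  by rewrite mulrC -ltr_pdivrMr ?normr_gt0 // archi_boundP // divr_ge0.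
have hi := ler_norm (M - b i); have lo := ler_norm (- (M - b i)); rewrite normrN in lo.
have NN : (- N%:Z)%:~R = - N%:R :> R by rewrite intrN.
case: (ltrgt0P r) r0 NP => [rp|rn|//] _.
  move=> NP; split.
    by exists (b i + r * (N%:Z)%:~R) => //; rewrite -[(N%:Z)%:~R]/(N%:R); lra.
  by exists (b i + r * (- N%:Z)%:~R) => //; rewrite NN mulrN; lra.
rewrite mulNr => NP; split.
  by exists (b i + r * (- N%:Z)%:~R) => //; rewrite NN mulrN; lra.
by exists (b i + r * (N%:Z)%:~R) => //; rewrite -[(N%:Z)%:~R]/(N%:R); lra.
Qed.

Local Notation Gp := levels_periodic.
Local Notation Glf := levels_locally_finite.
Local Notation Gu := levels_unbounded.

Lemma cell_convex x : segment_convex (cell x).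
Proof. by have [] := relopen_cell a Glf x. Qed.

Lemma sim_levels x y i : x ~~ y -> (G i (dot (a i) x) <-> G i (dot (a i) y)).
Proof.
move=> xy; split=> [Gx|Gy]; first by rewrite (sim_on xy).
by rewrite (sim_on (sim_sym xy)).
Qed.

Lemma cell_image_eq x y : pr @` cell x = pr @` cell y <-> exists k, y ~~ x + Zv k.
Proof.
split=> [xy|[k yx]].
  have [z xz /torus_projP[k zy]] : (pr @` cell x) (pr y).
    by rewrite xy; exists y => //; exact: sim_refl.
  exists (- k); apply: sim_sym; have := sim_shift (- k) Gp xz.
  by rewrite [X in sim _ _ _ X](_ : _ = y) // ZvN -zy opprB addrCA subrr addr0.
have sub w z m : z ~~ w + Zv m -> pr @` cell z `<=` pr @` cell w.
  move=> zw _ [p zp <-]; exists (p - Zv m); last by rewrite -ZvN torus_projD.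
  apply: sim_sym; apply: sim_shiftN Gp _; apply: sim_trans (sim_sym zp) zw.
apply/seteqP; split; last exact: sub yx.
by apply: (sub y x (- k)); rewrite ZvN; apply: sim_sym; exact: sim_shiftN Gp yx.
Qed.

Lemma levels_near y : exists2 d, 0 < d & forall z, `|z - y| < d ->
  (y ==> z) /\ forall i, G i (dot (a i) z) -> dot (a i) z = dot (a i) y.
Proof.
have [e e0 eP] := separation Glf (fun i => dot (a i) y).
have [e' e'0 eP'] := leface_near a Glf y.
have m0 : 0 < Num.min e e' by rewrite lt_min e0.
have [d d0 dP] := dot_near a m0.
exists d => // z zy; split.
  by apply: eP' => i; have := dP y z zy i; rewrite lt_min => /andP[].
move=> i Gz; apply/eqP; apply: contraPT (dP y z zy i) => zny.
apply/negP; rewrite -leNgt ge_min; apply/orP; left.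
by rewrite distrC; exact: eP.
Qed.

Lemma cell_component x :
  connected_component [set Q | forall i, hyp i Q <-> hyp i (pr x)] (pr x)
  = pr @` cell x.
Proof.
apply: component_clopen.
- apply: (connected_convex_image (x := x)); [exact: cell_convex|exact: sim_refl].
- by move=> _ [y xy <-] i; rewrite !hypP; apply: iff_sym; exact: sim_levels.
- by exists x => //; exact: sim_refl.
move=> P; have [y ->] := torus_proj_surj P => Ey; apply/nbhs_torusP.
have [d d0 dP] := levels_near y; exists d => // z zy Ez.
have [yz Gz] := dP z zy.
(* If y lies on a level of i, then z lies on hyperplane i too, hence on some level of i; this close
   to y it can only be the level of y. *)
have yz' : y ~~ z.
  move=> i g Gg; have [yg|//] := yz i g Gg.
  have : G i (dot (a i) z) by apply/hypP/(Ez i)/(Ey i)/hypP; rewrite yg.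
  by move=> /Gz ->.
have E : pr @` cell z = pr @` cell y.
  by apply/cell_image_eq; exists 0; rewrite Zv0 addr0.
have mem w : (pr @` cell x) (pr w) <-> pr @` cell x = pr @` cell w.
  split=> [[v xv /torus_projP[k vw]]|->]; last by exists w => //; exact: sim_refl.
  apply/cell_image_eq; exists (- k); apply: sim_sym.
  have := sim_shift (- k) Gp xv.
  by rewrite [X in sim _ _ _ X](_ : _ = w) // ZvN -vw opprB addrCA subrr addr0.
by rewrite !mem E.
Qed.

Lemma aflat_convex S x : segment_convex (aflat S x).
Proof.
move=> y z t yA zA _ i iS; rewrite linearD linearZ linearB /= yA ?zA // subrr.
by rewrite scaler0 addr0.
Qed.

Definition in_levels S x := forall i, i \in S -> G i (dot (a i) x).

Lemma aflat_component S x : in_levels S x ->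
  connected_component [set Q | forall i, i \in S -> hyp i Q] (pr x)
  = pr @` aflat S x.
Proof.
move=> Sx; apply: component_clopen.
- apply: (connected_convex_image (x := x)); [exact: aflat_convex|by []].
- by move=> _ [y xy <-] i iS; apply/hypP; rewrite xy //; exact: Sx.
- by exists x.
move=> P; have [y ->] := torus_proj_surj P => Ey; apply/nbhs_torusP.
have [d d0 dP] := levels_near y; exists d => // z zy Ez.
have [_ Gz] := dP z zy.
have zE i : i \in S -> dot (a i) z = dot (a i) y by move=> iS; apply: Gz; apply/hypP/Ez.
have mem w v : (forall i, i \in S -> dot (a i) w = dot (a i) v) ->
    (pr @` aflat S x) (pr w) -> (pr @` aflat S x) (pr v).
  move=> wv [u uA /torus_projP[k uw]]; exists (v + Zv k).
    by move=> i iS; rewrite linearD /= -wv // -uA // -uw linearB /= addrC subrK.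
  by rewrite torus_projD.
by split; apply: mem => i iS; rewrite zE.
Qed.

Lemma closure_cell p q : p ==> q -> closure (pr @` cell q) (pr p).
Proof.
move=> pq W /nbhs_torusP[e e0 eW].
(* The point at parameter t lies in the open cell of q and at distance at most e / 2 from p; the + 1
   guards the division. *)
pose t := Num.min 1 (e / (`|q - p| + 1) / 2).
have B0 : 0 < `|q - p| + 1 by rewrite ltr_wpDl.
have t0 : 0 < t by rewrite lt_min ltr01 divr_gt0 // divr_gt0.
have t1 : t <= 1 by rewrite ge_min lexx.
exists (pr (p + t *: (q - p))); split.
  by exists (p + t *: (q - p)) => //; exact: leface_segment.
apply: eW; rewrite addrC addKr normrZ gtr0_norm //.
apply: (@le_lt_trans _ _ (e / (`|q - p| + 1) / 2 * `|q - p|)).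
  by rewrite ler_wpM2r // ge_min lexx orbT.
have q1 : `|q - p| / (`|q - p| + 1) <= 1 by rewrite ler_pdivrMr // mul1r lerDl.
move: q1; set w := (_ + 1)^-1; set D := `|q - p| => q1.
have -> : e * w / 2 * D = e / 2 * (D * w) by lra.
apply: (@le_lt_trans _ _ (e / 2)); last by lra.
by rewrite ler_piMr //; lra.
Qed.

(** The cell of q may come close to p only through one of its lattice translates, whence the passage
    to another lift q'. *)
Lemma closure_cellP p q : pr @` cell p `<=` closure (pr @` cell q) <->
  exists2 q', pr @` cell q = pr @` cell q' & p ==> q'.
Proof.
split=> [pq|[q' -> pq']].
  have [d d0 dP] := levels_near p.
  have : closure (pr @` cell q) (pr p) by apply: pq; exists p => //; exact: sim_refl.
  move=> /(_ [set Q | exists2 z, Q = pr z & p ==> z])[].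
    apply/nbhs_torusP; exists d => // z /dP[pz _]; by exists z.
  move=> _ [[y qy <-] [z /torus_projP[k yz] pz]]; exists z => //.
  apply/cell_image_eq; exists (- k); apply: sim_sym; have := sim_shift (- k) Gp qy.
  by rewrite [X in sim _ _ _ X](_ : _ = z) // ZvN -yz opprB addrCA subrr addr0.
move=> _ [y py <-]; apply: closure_cell => i g Gg.
have [pg|<-] := pq' i g Gg; last by right; apply/esym/py.
by left; apply/sgr_sub_eq0; rewrite -py // pg subrr sgr0.
Qed.

Lemma dim_cell x : torus_dim (pr @` cell x) = \dim (dirs x).
Proof.
apply: torus_dimE; first exact: cell_convex.
have [cV copen _] := relopen_cell a Glf x.
have xx : cell x x by exact: sim_refl.
exists x, (dirs x); split=> // [y xy|W HW]; first exact: cV.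
apply/subvP => u ux; have [e e0 eP] := copen x u xx ux.
have e2 : 0 < e / 2 by lra.
have := HW _ (eP (e / 2) _); rewrite gtr0_norm // addrC addKr => /(_ _)/(rpredZ (e / 2)^-1).
rewrite scalerA mulVf ?scale1r ?lt0r_neq0 //; apply; lra.
Qed.

Lemma dim_aflat S x : torus_dim (pr @` aflat S x) = \dim (aflat_dir S).
Proof.
apply: torus_dimE; first exact: aflat_convex.
exists x, (aflat_dir S); split=> // [y xy|W HW]; first exact: aflat_sub.
apply/subvP => u uS; have xu : aflat S x (x + u) by exact: aflat_add.
by have := HW _ xu; rewrite addrAC subrr add0r.
Qed.

Definition on x : {set I} := [set i | `[< G i (dot (a i) x) >]].

Lemma on_levels x : in_levels (on x) x.
Proof. by move=> i; rewrite inE => /asboolP. Qed.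

Lemma aflat_dir_on x : aflat_dir (on x) = dirs x.
Proof.
apply/vspaceP => u; apply/mem_aflat_dir/mem_dirs => H i Gi; apply: H.
  by rewrite inE; apply/asboolP.
exact: on_levels.
Qed.

Lemma aflat_shift S x y : aflat S x y -> aflat S x = aflat S y.
Proof.
by move=> xy; apply/seteqP; split=> z xz i iS; rewrite xz // xy.
Qed.

Lemma aflat_image_shift S x k : pr @` aflat S (x + Zv k) = pr @` aflat S x.
Proof.
apply/seteqP; split=> [_ [y yA <-]|_ [y yA <-]].
  exists (y - Zv k); last by rewrite -ZvN torus_projD.
  by move=> i iS; rewrite linearB /= yA // linearD /= addrK.
exists (y + Zv k); last by rewrite torus_projD.
by move=> i iS; rewrite !linearD /= yA.
Qed.

Lemma aflat_image_mem S x y : (pr @` aflat S x) (pr y) ->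
  pr @` aflat S x = pr @` aflat S y.
Proof.
move=> [z zA /torus_projP[k zy]]; rewrite (aflat_shift zA) -(aflat_image_shift S y k).
by rewrite -zy addrC subrK.
Qed.

Lemma in_levels_mem S x y : in_levels S x -> (pr @` aflat S x) (pr y) -> in_levels S y.
Proof.
move=> Sx [z zA /torus_projP[k zy]] i iS.
have := Gp (- k) (Sx i iS); rewrite -(zA i iS) -linearD /= ZvN -zy.
by rewrite opprB addrCA subrr addr0.
Qed.

Lemma supp_sub S x y : in_levels S x -> (pr @` aflat S x) (pr y) ->
  pr @` aflat (on y) y `<=` pr @` aflat S x.
Proof.
move=> Sx yX; rewrite (aflat_image_mem yX) => _ [z zA <-]; exists z => // i iS.
by apply: zA; rewrite inE; apply/asboolP; exact: in_levels_mem Sx yX _ iS.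
Qed.

(** After a small move along u the point still lies on a level of each i in T. The levels are
    separated, so it is the level of x, and u is tangent to it. *)
Lemma aflat_image_sub S T x : in_levels T x ->
  pr @` aflat S x `<=` pr @` aflat T x -> (aflat_dir S <= aflat_dir T)%VS.
Proof.
move=> Tx ST; apply/subvP => u uS; apply/mem_aflat_dir => i iT.
have [e e0 eP] := separation Glf (fun i => dot (a i) x).
have [B B0 uB] := dot_bound a u.
pose t := e / B; have t0 : 0 < t by exact: divr_gt0.
have : (pr @` aflat T x) (pr (x + t *: u)).
  apply: ST; exists (x + t *: u) => //; apply: aflat_add => //; exact: rpredZ.
move=> /(in_levels_mem Tx)/(_ i iT); rewrite linearD linearZ /= => Gi.
have [/eqP|ne] := eqVneq (dot (a i) x + t *: dot (a i) u) (dot (a i) x).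
  rewrite -subr_eq0 addrC addKr => /eqP/eqP; rewrite scaler_eq0.
  by rewrite (gt_eqF t0) => /eqP.
have := eP i _ Gi ne; rewrite opprD addrA subrr sub0r normrN normrZ gtr0_norm //.
rewrite leNgt => /negP; case; rewrite /t mulrAC ltr_pdivrMr // ltr_pM2l //.
Qed.

Lemma aflat_image_dim S T x y : in_levels S x -> in_levels T y ->
  pr @` aflat S x `<=` pr @` aflat T y -> pr @` aflat S x <> pr @` aflat T y ->
  (\dim (aflat_dir S) < \dim (aflat_dir T))%N.
Proof.
move=> Sx Ty ST neST.
have xT : (pr @` aflat T y) (pr x) by apply: ST; exists x.
rewrite (aflat_image_mem xT) in ST neST; have Tx := in_levels_mem Ty xT.
have dST := aflat_image_sub Tx ST.
rewrite ltn_neqAle dimvS // andbT; apply/eqP => dE; apply: neST.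
have E : aflat_dir S = aflat_dir T by apply/eqP; rewrite eqEdim dST dE leqnn.
congr (_ @` _); apply/seteqP; split=> z xz.
  have := aflat_sub (@aflat_base _ _ _ a S x) xz; rewrite E => zT.
  by rewrite -[z](subrK x) addrC; apply: aflat_add.
have := aflat_sub (@aflat_base _ _ _ a T x) xz; rewrite -E => zT.
by rewrite -[z](subrK x) addrC; apply: aflat_add.
Qed.

(** A linear system over the rationals with a nonzero real solution has a nonzero rational one;
    clearing denominators makes it integral. *)
Lemma rational_direction S : (0 < \dim (aflat_dir S))%N ->
  exists2 k, k != 0 & Zv k \in aflat_dir S.
Proof.
(* The columns outside S are set to zero, so that all of I can index the columns. *)
move=> dS; pose M : 'M[rat]_(n, #|I|) :=
  \matrix_(j, c) (if enum_val c \in S then aQ (enum_val c) 0 j else 0).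
have [u uS u0] : exists2 u : 'rV[R]_n, u \in aflat_dir S & u != 0.
  by exists (vpick (aflat_dir S)); rewrite ?memv_pick // vpick0 -dimv_eq0 -lt0n.
have uM : u *m map_mx (@ratr R) M = 0.
  apply/rowP => c; rewrite !mxE; case: (boolP (enum_val c \in S)) => cS.
    rewrite -[RHS](mem_aflat_dir _ _ _ uS _ cS); apply: eq_bigr => j _.
    by rewrite !mxE cS mulrC.
  by rewrite big1 // => j _; rewrite !mxE (negPf cS) raddf0 mulr0.
have kM : kermx M != 0.
  rewrite -(map_mx_eq0 (@ratr R)) map_kermx; apply: contraNneq u0 => k0.
  by have /sub_kermxP := uM; rewrite k0 submx0.
have [v vM v0] : exists2 v : 'rV[rat]_n, v *m M = 0 & v != 0.
  have [r r0] : exists r, row r (kermx M) != 0.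
    apply/existsP; apply: contraNT kM; rewrite negb_exists => /forallP k0.
    by apply/eqP/row_matrixP => r; rewrite row0; apply/eqP; have := k0 r; rewrite negbK.
  by exists (row r (kermx M)) => //; apply/sub_kermxP; exact: row_sub.
have [D [k [D0 kE]]] := common_denominator v.
exists k.
  apply: contraNneq v0 => k0; apply/eqP/rowP => j; have := kE j.
  rewrite k0 !mxE => /eqP; rewrite mulf_eq0 intr_eq0 (gt_eqF D0) orbF => /eqP //.
apply/mem_aflat_dir => i iS.
have := congr1 (fun w : 'rV[rat]_#|I| => ratr (w 0 (enum_rank i)) * D%:~R : R) vM.
rewrite !mxE raddf0 mul0r => <-; rewrite rmorph_sum mulr_suml; apply: eq_bigr => j _.
have kjE : ratr (v 0 j) * D%:~R = (k 0 j)%:~R :> R.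
  by have := congr1 (@ratr R) (kE j); rewrite rmorphM /= !ratr_int.
rewrite !mxE enum_rankK iS rmorphM /= [RHS]mulrAC kjE; exact: mulrC.
Qed.

(** * Euler relations for the cells of the torus *)

Section FreeCells.
Hypothesis cells_ball : forall x, exists d, ball_cell R d (pr @` cell x).

(** The closed cell of q contains the segment from p to [p + Zv k], which projects to a loop in a
    closed ball. *)
Lemma leface_shift_trivial p q k : p ==> q -> p + Zv k ==> q -> k = 0.
Proof.
move=> pq pkq; have [d dq] := cells_ball q.
apply: (@contract_loop _ _ (pr @` cell q) d p k) => // t t01; apply: closure_cell.
by have := leface_convex pq pkq t01; rewrite [p + Zv k - p]addrAC subrr add0r.
Qed.

Lemma levels_free : free_translations a G.
Proof.
move=> x k xk; apply: (@leface_shift_trivial x x).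
  exact/sim_leface/sim_refl.
exact/sim_leface/sim_sym.
Qed.

Variable Cs : seq (set (torus R n)).
Hypothesis Cs_uniq : uniq Cs.
Hypothesis CsP : forall C, C \in Cs <-> exists x, C = pr @` cell x.

(** Near p the flat is a relatively open convex set met only by levels through p, so that it is cut
    into the faces around p. Different pieces project to different cells by
    [leface_shift_trivial]. *)
Lemma euler_star S x0 p : in_levels S x0 -> (pr @` aflat S x0) (pr p) ->
  \sum_(D <- Cs | `[< pr @` cell p `<=` closure D >]
                  && `[< D `<=` pr @` aflat S x0 >]) (-1) ^+ torus_dim D
  = (-1) ^+ \dim (aflat_dir S) :> int.
Proof.
move=> Sx pX; rewrite (aflat_image_mem pX); have Sp := in_levels_mem Sx pX.
have [e e0 eP] := separation Glf (fun i => dot (a i) p).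
pose K := [set z | aflat S p z /\ forall i, `|dot (a i) z - dot (a i) p| < e].
have Kp : K p by split=> // i; rewrite subrr normr0.
have KS : relopen K (aflat_dir S).
  split=> [y z [yA _] [zA _]|y u [yA ye] uS|y z t [yA ye] [zA ze] /andP[t0 t1]].
  - exact: aflat_sub yA zA.
  - have [B B0 uB] := dot_bound a u.
    have [|d d0 dP] := @seq_lower_bound R _ (enum I)
      (fun i => e - `|dot (a i) y - dot (a i) p|).
      by move=> i; rewrite subr_gt0.
    exists (d / B) => [|t tB]; first exact: divr_gt0.
    split; first by apply: aflat_add => //; exact: rpredZ.
    move=> i; rewrite linearD linearZ /= addrAC.
    apply: le_lt_trans (ler_normD _ _) _.
    have di := dP i (mem_enum _ i); rewrite normrM.
    have tu : `|t| * `|dot (a i) u| < d.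
      apply: (@le_lt_trans _ _ (`|t| * B)); last by rewrite -ltr_pdivlMr.
      by rewrite ler_wpM2l // ltW.
    by move: di tu; set c1 := `|dot (a i) y - _|; set c2 := `|t| * _; lra.
  - split; first by apply: aflat_convex => //; rewrite t0.
    move=> i; rewrite linearD linearZ linearB /=; have := ye i; have := ze i.
    set dy : R := dot (a i) y; set dz : R := dot (a i) z; set dp : R := dot (a i) p.
    have -> : dy + t *: (dz - dy) - dp = (1 - t) * (dy - dp) + t * (dz - dp).
      by rewrite /GRing.scale /=; lra.
    move=> ze' ye'; apply: le_lt_trans (ler_normD _ _) _; rewrite !normrM.
    rewrite (ger0_norm t0) ger0_norm ?subr_ge0 //.
    have : Num.max `|dz - dp| `|dy - dp| < e by rewrite gt_max ze' ye'.
    apply: le_lt_trans; set c := Num.max _ _.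
    have c1 : 0 <= t * (c - `|dz - dp|) by rewrite mulr_ge0 // subr_ge0 le_max lexx.
    have c2 : 0 <= (1 - t) * (c - `|dy - dp|).
      by rewrite mulr_ge0 ?subr_ge0 // le_max lexx orbT.
    lra.
have Kb i : exists M, forall y, K y -> `|dot (a i) y| <= M.
  exists (e + `|dot (a i) p|) => y [_ /(_ i) yp].
  rewrite -[dot (a i) y](subrK (dot (a i) p)).
  by apply: le_trans (ler_normD _ _) _; rewrite lerD2r ltW.
have [s str ssum] := euler_cells Glf KS (ex_intro _ p Kp) Kb.
have [sK scov sinj s_uniq] := str.
have Kle y : K y -> p ==> y.
  move=> [_ ye] i g Gg; have [->|gp] := eqVneq g (dot (a i) p); first by left.
  right; have -> : dot (a i) y - g = dot (a i) p - g + (dot (a i) y - dot (a i) p).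
    by rewrite [RHS]addrC subrKA.
  by rewrite [RHS]sgr_stable //; apply: lt_le_trans (ye i) (eP i g Gg gp).
rewrite -ssum -big_filter.
transitivity (\sum_(D <- [seq pr @` cell y | y <- s]) (-1) ^+ torus_dim D : int); last first.
  rewrite big_map big_seq [RHS]big_seq; apply: eq_bigr => y ys.
  have [yA _] := sK y ys; rewrite dim_cell; congr (_ ^+ \dim _); apply/esym/capv_idPr.
  exact: dirs_aflat Sp yA.
apply: perm_big; apply: uniq_perm; first exact: filter_uniq.
  rewrite map_inj_in_uniq // => y z ys zs /cell_image_eq[k zy].
  have py := Kle y (sK y ys); have pz := Kle z (sK z zs).
  have pk : p + Zv (- k) ==> y.
    move=> i g Gg; have := leface_shift (- k) Gp pz => /(_ i g Gg).
    have := sim_shiftN Gp zy; rewrite -ZvN => <- //.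
  have k0 := leface_shift_trivial py pk; apply: sinj => //.
  apply: sim_sym; move: zy; rewrite -[k]opprK k0 oppr0 Zv0 addr0 //.
move=> D; rewrite mem_filter; apply/idP/mapP => [|[y ys ->]]; last first.
  have Ky := sK y ys; apply/andP; split; last by apply/CsP; exists y.
  apply/andP; split; apply/asboolP.
    by apply/closure_cellP; exists y => //; exact: Kle.
  move=> _ [z yz <-]; exists z => //; have [yA _] := Ky.
  exact: aflat_cell Sp yA yz.
move=> /andP[/andP[/asboolP pD /asboolP DX] /CsP[q qE]].
rewrite qE in pD DX *; have [q' qq' pq'] := (closure_cellP _ _).1 pD.
rewrite qq' in DX *.
have q'A : aflat S p q'.
  have : (pr @` aflat S p) (pr q') by apply: DX; exists q' => //; exact: sim_refl.
  move=> q'X i iS; apply/esym; apply: (leface_on pq').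
  exact: in_levels_mem Sp q'X _ iS.
have [B B0 uB] := dot_bound a (q' - p).
(* Sliding q' towards p keeps it in its cell and brings it into K. *)
pose t := Num.min 1 (e / B).
have t0 : 0 < t by rewrite lt_min ltr01 divr_gt0.
have t1 : t <= 1 by rewrite ge_min lexx.
have zq : q' ~~ p + t *: (q' - p) by exact: leface_segment.
have Kz : K (p + t *: (q' - p)).
  split; first by apply: aflat_convex; rewrite ?(ltW t0).
  move=> i; rewrite linearD linearZ /= addrAC subrr add0r normrM gtr0_norm //.
  apply: (@lt_le_trans _ _ (t * B)); first by rewrite ltr_pM2l.
  by rewrite -ler_pdivlMr // ge_min lexx orbT.
have [y ys zy] := scov _ Kz; exists y => //; apply/cell_image_eq; exists 0.
by rewrite Zv0 addr0; apply: sim_sym; exact: sim_trans zq zy.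
Qed.

Lemma euler_flat S x0 : in_levels S x0 ->
  \sum_(D <- Cs | `[< D `<=` pr @` aflat S x0 >]) (-1) ^+ torus_dim D
  = (\dim (aflat_dir S) == 0)%N%:R :> int.
Proof.
move=> Sx; set X := pr @` aflat S x0.
have /choice[r rP] : forall D, exists y, D \in Cs /\ D `<=` X ->
    aflat S x0 y /\ D = pr @` cell y.
  move=> D; have [[/CsP[x ->] DX]|nD] := pselect (D \in Cs /\ D `<=` X).
    have [y yA /torus_projP[k yx]] : X (pr x) by apply: DX; exists x => //; exact: sim_refl.
    exists y => _; split=> //; apply/cell_image_eq; exists k.
    by rewrite -yx addrC subrK; exact: sim_refl.
  by exists 0 => /nD.
pose l := [seq D <- Cs | `[< D `<=` X >]].
have lP D : D \in l -> aflat S x0 (r D) /\ D = pr @` cell (r D).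
  by rewrite mem_filter => /andP[/asboolP DX DC]; exact: rP.
pose s := map r l.
have str : transv (orb a G) (aflat S x0) s.
  split.
  - by move=> _ /mapP[D /lP[rA _] ->].
  - move=> y yA; have yl : pr @` cell y \in l.
      rewrite mem_filter; apply/andP; split; last by apply/CsP; exists y.
      by apply/asboolP => _ [z yz <-]; exists z => //; exact: aflat_cell Sx yA yz.
    have [_ /esym/cell_image_eq[k yr]] := lP _ yl.
    by exists (r (pr @` cell y)); [exact: map_f|exists k].
  - move=> _ _ /mapP[D Dl ->] /mapP[E El ->] [k DE].
    have [_ DE1] := lP _ Dl; have [_ EE1] := lP _ El.
    suff -> : D = E by [].
    by rewrite DE1 EE1; apply/esym/cell_image_eq; exists k.
  - rewrite map_inj_in_uniq ?filter_uniq // => D E Dl El rDE.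
    by have [_ DE] := lP _ Dl; have [_ EE] := lP _ El; rewrite DE EE rDE.
have -> : \sum_(D <- Cs | `[< D `<=` X >]) (-1) ^+ torus_dim D =
    \sum_(y <- s) (-1) ^+ \dim (dirs y) :> int.
  rewrite -big_filter -/l big_map [LHS]big_seq [RHS]big_seq; apply: eq_bigr => D Dl.
  by have [_ {1}->] := lP _ Dl; rewrite dim_cell.
case: (posnP (\dim (aflat_dir S))) => [d0|dgt0]; last first.
  apply: (euler_torus Glf Gp Gu levels_free Sx str).
  exact: rational_direction.
(* A flat of dimension 0 is a point, and this point is its only cell, with sign 1. *)
have Ax y : aflat S x0 y -> y = x0.
  move=> yA; have := aflat_sub (@aflat_base _ _ _ a S x0) yA.
  by move/eqP: d0; rewrite dimv_eq0 => /eqP ->; rewrite memv0 subr_eq0 => /eqP.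
have [sA scov _ s_uniq] := str.
have [y ys _] := scov x0 (@aflat_base _ _ _ a S x0).
rewrite (big_rem y) //= (_ : rem y s = [::]) ?big_nil ?addr0.
  have := dirs_aflat Sx (sA y ys) => /dimvS; rewrite d0 leqn0 => /eqP ->.
  by rewrite expr0.
apply/eqP; rewrite -size_eq0 -leqn0 leqNgt; apply/negP.
case E : (rem y s) => [//|z t] _.
have := mem_head z t; rewrite -E mem_rem_uniq // inE => /andP[/eqP zy zs].
by apply: zy; rewrite (Ax z (sA z zs)) (Ax y (sA y ys)).
Qed.

End FreeCells.
End ToricData.

(** * Flats, cells and their posets *)


Lemma chain_sum_rec (A : pzRingType) (b c : A) (T X : eqType) (lt : rel T)
    (f : X -> T) (L : seq X) (rho : T -> nat) (N : nat) (x : T) (r : nat) :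
  (r <= N)%N -> {in L, forall y, rho (f y) <= N}%N ->
  {in L, forall y, lt x (f y) -> r < rho (f y)}%N ->
  chain_sum b c lt (map f L) rho (N - r) x r = c ^+ (N - r)
    + \sum_(y <- L | lt x (f y)) c ^+ (rho (f y) - r).-1 * b
        * chain_sum b c lt (map f L) rho (N - rho (f y)) (f y) (rho (f y)).
Proof.
move=> rN LN Lr; rewrite (@chain_sumE _ _ _ _ _ _ _ N); last 2 first.
- by rewrite addnC subnK.
- by move=> _ /mapP[y yL ->]; exact: LN.
rewrite big_map; congr (_ + _); rewrite big_seq_cond [RHS]big_seq_cond.
apply: eq_bigl => y; case: (boolP (y \in L)) => //= yL.
by case: (boolP (lt x (f y))) => //= /(Lr y yL) ->.
Qed.

Lemma sign_codim (N d : nat) : (d <= N)%N ->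
  (-1) ^+ (N - d) = (-1) ^+ N * (-1) ^+ d :> int.
Proof. by move=> dN; rewrite -[in RHS](subnK dN) exprD -mulrA -expr2 sqrr_sign mulr1. Qed.

Section Regular.
Variables (R : realType) (n : nat) (H : set (set (torus R n))).
Hypothesis H_arr : toric_arrangement H.
Hypothesis H_reg : regular_cell_complex R (toric_cells H) (@torus_dim R n).
Implicit Types (x y z p q : 'rV[R]_n) (C D E X Y : set (torus R n)).
Local Notation pr := (@torus_proj R n).

Let I : finType := fset_set H.

Lemma arrangement_data : exists (aQ : I -> 'rV[rat]_n) (b : I -> R),
  (forall i, aQ i != 0) /\ (forall i, val i = hyp aQ b i).
Proof.
have [Hfin Hhyp] := H_arr.
have /choice[f fP] : forall i : I, exists ab : 'rV[rat]_n * R, ab.1 != 0 /\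
    val i = pr @` [set x : 'rV[R]_n | \sum_(j < n) ratr (ab.1 0 j) * x 0 j = ab.2].
  move=> i; have : H (val i) by have := valP i; rewrite in_fset_set // inE.
  by move=> /Hhyp[a [b [a0 iE]]]; exists (a, b).
exists (fun i => (f i).1), (fun i => (f i).2); split=> i; have [a0 iE] := fP i => //.
rewrite iE /hyp; congr (_ @` _); apply/seteqP; split=> x /= <-;
  by apply: eq_bigr => j _; rewrite mxE.
Qed.

Section Data.
Variables (aQ : I -> 'rV[rat]_n) (b : I -> R).
Hypothesis aQ_neq0 : forall i, aQ i != 0.
Hypothesis hypE : forall i, val i = hyp aQ b i.
Local Notation a := (@rvec R n I aQ).
Local Notation G := (levels aQ b).
Local Notation cell := (cell a G).
Local Notation dirs := (dirs a G).
Local Notation aflat := (aflat a).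
Local Notation aflat_dir := (aflat_dir a).
Local Notation in_levels := (in_levels aQ b).
Local Notation on := (on aQ b).

Lemma arrangementP h : H h <-> exists i : I, h = hyp aQ b i.
Proof.
have [Hfin _] := H_arr; split=> [Hh|[i ->]]; last first.
  by rewrite -hypE; have := valP i; rewrite in_fset_set // inE.
have hH : h \in fset_set H by rewrite in_fset_set // inE.
by exists [` hH]%fset; rewrite -hypE.
Qed.

Lemma toric_cellsP C : toric_cells H C <-> exists x, C = pr @` cell x.
Proof.
have E P : [set y | forall h, H h -> (h y <-> h P)] =
    [set Q | forall i, hyp aQ b i Q <-> hyp aQ b i P].
  apply/seteqP; split=> Q QP; first by move=> i; apply: QP; apply/arrangementP; exists i.
  by move=> h /arrangementP[i ->].
split=> [[P ->]|[x ->]].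
  by have [x ->] := torus_proj_surj P; exists x; rewrite E cell_component.
by exists (pr x); rewrite E cell_component.
Qed.

Lemma flatsP X : flats H X <->
  exists S x, in_levels S x /\ X = pr @` aflat S x.
Proof.
have E (B : set (set (torus R n))) (S : {set I}) :
    (forall i, i \in S <-> B (hyp aQ b i)) -> B `<=` H ->
    \bigcap_(h in B) h = [set Q | forall i, i \in S -> hyp aQ b i Q].
  move=> SB BH; apply/seteqP; split=> Q QB; first by move=> i /SB; exact: QB.
  move=> h Bh; have /arrangementP[i hE] := BH h Bh; rewrite hE in Bh *.
  by apply: QB; apply/SB.
split=> [[B BH [P PB ->]]|[S [x [Sx ->]]]].
  pose S : {set I} := [set i | `[< B (hyp aQ b i) >]]%SET.
  have SB i : i \in S <-> B (hyp aQ b i) by rewrite inE; split=> /asboolP.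
  have [x xE] := torus_proj_surj P; subst P; exists S, x.
  have Sx : in_levels S x by move=> i /SB Bi; apply/hypP; exact: PB.
  by split=> //; rewrite (E _ _ SB BH) aflat_component.
exists (hyp aQ b @` [set` S]); first by move=> _ [i _ <-]; apply/arrangementP; exists i.
have ES : \bigcap_(h in hyp aQ b @` [set` S]) h =
    [set Q | forall i, i \in S -> hyp aQ b i Q].
  apply/seteqP; split=> Q QB; first by move=> i iS; apply: QB; exists i.
  by move=> _ [i iS <-]; exact: QB.
exists (pr x); last by rewrite ES aflat_component.
by rewrite ES => i iS; apply/hypP; exact: Sx.
Qed.

Lemma cells_finite : finite_set (toric_cells H).
Proof. by have [] := H_reg. Qed.

Lemma cells_ball x : exists d, ball_cell R d (pr @` cell x).
Proof.
have [_ _ _ _ Hb] := H_reg.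
by have [|Hx _] := Hb (pr @` cell x); [apply/toric_cellsP; exists x|eexists; exact: Hx].
Qed.

Let Cs : seq (set (torus R n)) := fset_set (toric_cells H).

Lemma CsP C : C \in Cs <-> exists x, C = pr @` cell x.
Proof.
rewrite in_fset_set; last exact: cells_finite.
by rewrite inE; exact: toric_cellsP.
Qed.

Lemma cell_sub_flat S x y : in_levels S x -> (pr @` aflat S x) (pr y) ->
  pr @` cell y `<=` pr @` aflat S x.
Proof.
move=> Sx yX; rewrite (aflat_image_mem yX) => _ [z yz <-]; exists z => //.
exact: aflat_cell (in_levels_mem Sx yX) (@aflat_base _ _ _ a S y) yz.
Qed.

(** A flat is the union of the cells it contains, and there are finitely many sets of cells. *)
Lemma flats_finite : finite_set (flats H).
Proof.
pose f (B : {set fset_set (toric_cells H)}) : set (torus R n) :=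
  \bigcup_(C in [set C | C \in B]) val C.
apply: (@sub_finite_set _ _ (range f)); last exact/finite_image/finite_finset.
move=> X /flatsP[S [x [Sx ->]]].
exists [set C | `[< val C `<=` pr @` aflat S x >]]%SET => //.
apply/seteqP; split=> [P [C /=]|P]; first by rewrite inE => /asboolP; exact.
have [y ->] := torus_proj_surj P => yX.
have yC : pr @` cell y \in fset_set (toric_cells H) by apply/CsP; exists y.
exists [` yC]%fset; last by exists y => //; exact: sim_refl.
by rewrite /= inE; apply/asboolP; exact: cell_sub_flat.
Qed.

Let L : seq (set (torus R n)) := fset_set (flats H).

Lemma LP X : X \in L <-> exists S x, in_levels S x /\ X = pr @` aflat S x.
Proof.
rewrite in_fset_set; last exact: flats_finite.
by rewrite inE; exact: flatsP.
Qed.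

Definition lift C : 'rV[R]_n := xget 0 [set x | C = pr @` cell x].

Lemma liftP C : C \in Cs -> C = pr @` cell (lift C).
Proof. by move=> /CsP Cx; rewrite /lift; exact: (xgetPex 0 Cx). Qed.

(** The smallest flat through x, as it uses all the hyperplanes through x. *)
Definition suppx x : set (torus R n) := pr @` aflat (on x) x.
Definition supp C := suppx (lift C).

Lemma suppx_mem x y : pr @` cell x = pr @` cell y -> suppx x (pr y).
Proof.
move=> xy; have : (pr @` cell x) (pr y) by rewrite xy; exists y => //; exact: sim_refl.
move=> [z xz zy]; rewrite -zy; exists z => //.
exact: aflat_cell (@on_levels R n I aQ b x) (@aflat_base _ _ _ a (on x) x) xz.
Qed.

Lemma suppx_eq x y : pr @` cell x = pr @` cell y -> suppx x = suppx y.
Proof.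
move=> xy; apply/seteqP; split; apply: supp_sub; try exact: on_levels.
  by apply: suppx_mem; rewrite xy.
exact: suppx_mem.
Qed.

Lemma suppE x : supp (pr @` cell x) = suppx x.
Proof. by apply: suppx_eq; rewrite -liftP //; apply/CsP; exists x. Qed.

Lemma dim_suppx x : torus_dim (suppx x) = \dim (dirs x).
Proof. by rewrite /suppx dim_aflat aflat_dir_on. Qed.

Lemma dimv_le_n (V : {vspace 'rV[R]_n}) : (\dim V <= n)%N.
Proof. by apply: leq_trans (dimvS (subvf V)) _; rewrite dimvf /dim /= mul1n. Qed.

Lemma supp_flat C : C \in Cs -> supp C \in L.
Proof.
move=> /CsP[x ->]; rewrite suppE; apply/LP; exists (on x), x; split=> //.
exact: on_levels.
Qed.

Lemma dim_supp C : C \in Cs -> torus_dim (supp C) = torus_dim C.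
Proof. by move=> /CsP[x ->]; rewrite suppE dim_suppx (dim_cell aQ b). Qed.

Lemma dim_cells_le C : C \in Cs -> (torus_dim C <= n)%N.
Proof. by move=> /CsP[x ->]; rewrite (dim_cell aQ b) dimv_le_n. Qed.

Lemma dim_flats_le X : X \in L -> (torus_dim X <= n)%N.
Proof. by move=> /LP[S [x [_ ->]]]; rewrite dim_aflat dimv_le_n. Qed.

Lemma flat_neq0 X : X \in L -> X != set0.
Proof. by move=> /LP[S [x [_ ->]]]; apply/set0P; exists (pr x), x. Qed.

Lemma dim_flats_lt X Y : X \in L -> Y \in L -> X != Y -> Y `<=` X ->
  (torus_dim Y < torus_dim X)%N.
Proof.
move=> /LP[S [x [Sx ->]]] /LP[T [y [Ty ->]]] /eqP XY YX; rewrite !dim_aflat.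
by apply: aflat_image_dim Ty Sx YX _ => E; apply: XY.
Qed.

Lemma supp_subP C X : C \in Cs -> X \in L -> supp C `<=` X <-> C `<=` X.
Proof.
move=> /CsP[y ->] /LP[S [x [Sx ->]]]; rewrite suppE; split=> [yX|yX].
  by apply: cell_sub_flat => //; apply: yX; exists y.
by apply: supp_sub => //; apply: yX; exists y => //; exact: sim_refl.
Qed.

(** A cell has the dimension of the flat it spans; equal flats would thus give equal dimensions, and
    [leface_dim] would identify the cells. *)
Lemma cells_lt_supp C D : C \in Cs -> D \in Cs -> D != C ->
  closure D `<=` closure C -> supp D `<=` supp C /\ supp C != supp D.
Proof.
move=> /CsP[q ->] /CsP[p ->] /eqP DC clDC.
have [q' qq' pq'] : exists2 q', pr @` cell q = pr @` cell q' & leface a G p q'.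
  by apply/closure_cellP; apply: subset_trans clDC; exact: subset_closure.
rewrite qq' in DC clDC *; rewrite !suppE; split.
  apply: supp_sub; first exact: on_levels.
  by exists p => // i iq; apply: (leface_on pq'); exact: on_levels iq.
apply/eqP => E; apply: DC; apply/esym/cell_image_eq; exists 0; rewrite Zv0 addr0.
by apply: leface_dim pq' _; rewrite -!dim_suppx E.
Qed.

Lemma closure_subP C D : closure D `<=` closure C <-> D `<=` closure C.
Proof.
split=> [DC|DC]; first exact: subset_trans (@subset_closure _ D) DC.
by have := closureS DC; rewrite -(closure_id (closure C)).1 //; exact: closed_closure.
Qed.

(** * The two posets and their chains *)

Local Notation PP := (intersection_poset_bot H).
Local Notation TT := (toric_face_poset H).

Let ltX X Y := @rp_lt PP (Some X) (Some Y).
Let gtY C D := @rp_lt TT (Cell D) (Cell C).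
Let rX X := @rp_rank PP (Some X).
(** The corank in T_t. Like the rank of a flat it is n + 1 minus the dimension, which is why the
    face poset is read from the top. *)
Let rY C := ((rp_N TT).+1 - @rp_rank TT (Cell C))%N.

Lemma ltXE X Y : ltX X Y = (X != Y) && `[< Y `<=` X >].
Proof. by rewrite /ltX /rp_lt /= (inj_eq Some_inj). Qed.

Lemma gtYE C D : gtY C D = (D != C) && `[< closure D `<=` closure C >].
Proof.
rewrite /gtY /rp_lt /=; congr (~~ _ && _).
by apply/eqP/eqP => [[]|->].
Qed.

Lemma rXE X : X \in L -> rX X = (n.+1 - torus_dim X)%N.
Proof.
move=> XL; rewrite /rX /= /intersection_rank (negPf (flat_neq0 XL)) subSn //.
exact: dim_flats_le.
Qed.

Lemma rYE C : rY C = (n.+1 - torus_dim C)%N.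
Proof. by rewrite /rY /rp_N /= subSS. Qed.

Lemma ltX_rank X Y : X \in L -> Y \in L -> ltX X Y -> (rX X < rX Y)%N.
Proof.
move=> XL YL; rewrite ltXE => /andP[XY /asboolP YX]; rewrite !rXE //.
by have := dim_flats_lt XL YL XY YX; have := dim_flats_le XL; lia.
Qed.

Lemma ltX_trans : transitive ltX.
Proof.
move=> Y X Z; rewrite !ltXE => /andP[XY /asboolP YX] /andP[YZ /asboolP ZY].
apply/andP; split; last by apply/asboolP; exact: subset_trans ZY YX.
apply: contraNneq XY => XZ; apply/eqP/seteqP; split=> //.
by rewrite XZ.
Qed.

Lemma gtY_supp C D : C \in Cs -> D \in Cs -> gtY C D -> ltX (supp C) (supp D).
Proof.
move=> CC DC; rewrite gtYE ltXE => /andP[ne /asboolP clo].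
have [sub ->] := cells_lt_supp CC DC ne clo.
exact/asboolP.
Qed.

Lemma gtY_rank C D : C \in Cs -> D \in Cs -> gtY C D -> (rY C < rY D)%N.
Proof.
move=> CC DC /(gtY_supp CC DC)/(ltX_rank (supp_flat CC) (supp_flat DC)).
by rewrite !rXE ?supp_flat // !dim_supp // !rYE.
Qed.

Lemma le_suppE X C : X \in L -> C \in Cs ->
  (X == supp C) || ltX X (supp C) = `[< C `<=` X >].
Proof.
move=> XL CC; rewrite ltXE; apply/idP/asboolP => [|CX].
  move=> XC; apply/supp_subP => //.
  by case/orP: XC => [/eqP ->|/andP[_ /asboolP]].
case: eqVneq => //= XC; apply/asboolP; exact/supp_subP.
Qed.

Lemma le_cellE C E : (C == E) || gtY C E = `[< E `<=` closure C >].
Proof.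
rewrite gtYE; apply/idP/asboolP => [/orP[/eqP ->|/andP[_ /asboolP]]|EC].
- exact: subset_closure.
- by move=> /closure_subP.
by rewrite eq_sym; case: eqVneq => //= _; apply/asboolP/closure_subP.
Qed.

Lemma euler_local X E : X \in L -> E \in Cs -> ltX X (supp E) ->
  \sum_(C <- Cs | ((C == E) || gtY C E) && ((X == supp C) || ltX X (supp C)))
     (-1) ^+ rY C = (-1) ^+ rX X :> int.
Proof.
move=> XL EC XE.
have EX : E `<=` X by apply/asboolP; rewrite -le_suppE // XE orbT.
rewrite rXE // sign_codim ?(leqW (dim_flats_le XL)) //.
move/LP: (XL) => [S [x [Sx XE']]]; move/CsP: (EC) => [p pE].
(* Every exponent is n + 1 minus a dimension, so that both sides of [euler_star] acquire the same
   sign. *)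
transitivity ((-1) ^+ n.+1 * \sum_(C <- Cs | `[< pr @` cell p `<=` closure C >]
    && `[< C `<=` pr @` aflat S x >]) (-1) ^+ torus_dim C : int).
  rewrite mulr_sumr big_seq_cond [RHS]big_seq_cond; apply: eq_big => [C|C /andP[CC _]].
    by case: (boolP (C \in Cs)) => //= CC; rewrite le_cellE le_suppE // -XE' -pE.
  by rewrite rYE sign_codim // leqW // dim_cells_le.
rewrite (@euler_star _ _ _ aQ b cells_ball Cs (fset_uniq _) CsP S x p Sx).
  by rewrite XE' dim_aflat.
by rewrite -XE'; apply: EX; rewrite pE; exists p => //; exact: sim_refl.
Qed.

Lemma euler_global X : X \in L ->
  \sum_(C <- Cs | (X == supp C) || ltX X (supp C)) (-1) ^+ rY C
  = (if rX X == n.+1 then (-1) ^+ n.+1 else 0) :> int.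
Proof.
move=> XL; move/LP: (XL) => [S [x [Sx XE']]].
transitivity ((-1) ^+ n.+1 * \sum_(C <- Cs | `[< C `<=` pr @` aflat S x >])
    (-1) ^+ torus_dim C : int).
  rewrite mulr_sumr big_seq_cond [RHS]big_seq_cond; apply: eq_big => [C|C /andP[CC _]].
    by case: (boolP (C \in Cs)) => //= CC; rewrite le_suppE // -XE'.
  by rewrite rYE sign_codim // leqW // dim_cells_le.
rewrite (@euler_flat _ _ _ aQ b aQ_neq0 cells_ball Cs (fset_uniq _) CsP S x Sx).
have -> : (rX X == n.+1) = (\dim (aflat_dir S) == 0)%N.
  have := dim_flats_le XL; rewrite rXE // XE' dim_aflat; lia.
by case: eqP; rewrite ?mulr1 ?mulr0.
Qed.

(* The rank of the maximum is computed through a classical test of equality,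
   so that this equation does not hold by conversion. *)
Lemma rp_N_flats : rp_N PP = n.+1.
Proof. by rewrite /rp_N /= /intersection_rank eqxx. Qed.

Lemma flat_chainsP s c : all (fun k => 0 < k <= rp_N PP)%N s -> rp_chains s c <->
  [/\ path (@rp_lt PP) (rp_bot PP) c, {subset c <= [seq Some X | X <- L]}
    & map (@rp_rank PP) c = s].
Proof.
rewrite rp_N_flats => /allP s_le; rewrite /rp_chains /=; split=> [[ce]|[pc ce cs]].
  rewrite rcons_path => /andP[pc _] cs; split=> // y yc.
  have yr : (0 < @rp_rank PP y <= n.+1)%N.
    by apply: (s_le (@rp_rank PP y)); rewrite -cs; exact: (map_f (@rp_rank PP)).
  (* The bounds on the rank exclude the adjoined minimum, of rank 0, and the empty set, of rank n +
     2. *)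
  case: y yc yr (ce y yc) => [X|//] _ /andP[_] /=; rewrite /intersection_rank.
  case: ifPn => [_|X0 _]; first by rewrite ltnn.
  case=> [XF|X0']; last by rewrite X0' eqxx in X0.
  apply: map_f; rewrite in_fset_set ?inE //; exact: flats_finite.
split=> // [y /ce /mapP[X XL ->]|].
  left; move: XL; rewrite in_fset_set ?inE //; exact: flats_finite.
rewrite rcons_path pc /=.
have : last None c \in None :: c by exact: mem_last.
rewrite inE => /predU1P[->|/ce /mapP[X XL ->]].
  by rewrite /rp_lt /=; apply/asboolP.
rewrite /rp_lt /= (inj_eq Some_inj) flat_neq0 //=.
by apply/asboolP; exact: sub0set.
Qed.

Let gtT : rel (rp_type TT) := fun u v => @rp_lt TT v u.

(** Ranks from 1 to n + 1 belong to cells only, and the empty face lies below every cell, so that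
    closing a chain of cells with it adds no condition. *)
Lemma cell_chainsP s (c : seq (rp_type TT)) : all (fun k => 0 < k <= rp_N TT)%N s -> rp_chains s c <->
  [/\ path gtT (rp_top TT) (rev c),
      {subset c <= [seq Cell C | C <- Cs]} & map (@rp_rank TT) c = s].
Proof.
have pathE (d : seq (rp_type TT)) : {subset d <= [seq Cell C | C <- Cs]} ->
    path (@rp_lt TT) (rp_bot TT) (rcons d (rp_top TT)) =
    path gtT (rp_top TT) (rev d).
  move=> dC; rewrite -cats1.
  have -> : path (@rp_lt TT) (rp_bot TT) (d ++ [:: rp_top TT]) =
      sorted gtT (rp_top TT :: rcons (rev d) (rp_bot TT)).
    rewrite -[LHS]/(sorted (@rp_lt TT) (rp_bot TT :: d ++ [:: rp_top TT])).
    by rewrite -rev_sorted rev_cons rev_cat.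
  rewrite /= rcons_path; case: (path _ _ _) => //=.
  have : last WholeSpace (rev d) \in WholeSpace :: rev d by exact: mem_last.
  rewrite inE mem_rev => /predU1P[->|/dC /mapP[C _ ->]].
    by rewrite /rp_lt /=; apply/andP; split; [apply/eqP|apply/asboolP].
  by rewrite /rp_lt /=; apply/andP; split; [apply/eqP|apply/asboolP].
move=> /allP s_le; rewrite /rp_chains /=; split=> [[ce pc cs]|[pc ce cs]].
  have ce' : {subset c <= [seq Cell C | C <- Cs]}.
    move=> y yc; have := ce y yc; have : @rp_rank TT y \in s.
      by rewrite -cs; exact: (map_f (@rp_rank TT)).
    move=> /s_le; case: y yc => //= [C Cc _ CC|_].
      by apply: map_f; apply/CsP/toric_cellsP.
    by rewrite /rp_N /= ltnn.
  by split=> //; rewrite -pathE.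
split=> //; last by rewrite pathE.
by move=> y /ce /mapP[C /CsP/toric_cellsP CC ->].
Qed.

Lemma index_identity : ab_rev (ab_index TT) = phi_t (ab_index PP).
Proof.
have L_rank X : X \in L -> (rX X <= n.+1)%N by move=> XL; rewrite rXE // leq_subr.
have C_rank C : (rY C <= n.+1)%N by rewrite rYE leq_subr.
(* Q sums the chains of flats above X, and U the chains of cells below C read downwards; their first
   elements give the recursions required by [ph_flats]. *)
pose Q X : abpoly := @chain_sum abpoly ab_b ab_c _ (@rp_lt PP) [seq Some Y | Y <- L]
  (@rp_rank PP) (n.+1 - rX X) (Some X) (rX X).
pose U C : abpoly := @chain_sum abpoly ab_b ab_c _ gtT [seq Cell D | D <- Cs]
  (fun u => (rp_N TT).+1 - @rp_rank TT u)%N (n.+1 - rY C) (Cell C) (rY C).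
have recP u r rN := @chain_sum_rec abpoly ab_b ab_c (rp_type PP) _ (@rp_lt PP)
  Some L (@rp_rank PP) n.+1 u r rN L_rank.
have recT u r rN := @chain_sum_rec abpoly ab_b ab_c (rp_type TT) _ gtT
  (@Cell _) Cs (fun u => (rp_N TT).+1 - @rp_rank TT u)%N n.+1 u r rN
  (fun C _ => C_rank C).
have PE : ab_index PP = ab_c ^+ n.+1 + \sum_(X <- L) ab_c ^+ (rX X).-1 * ab_b * Q X.
  have SL_uniq : uniq [seq Some X | X <- L].
    by rewrite map_inj_uniq ?fset_uniq //; exact: Some_inj.
  have L_pos : {in L, forall X, @rp_lt PP None (Some X) -> 0 < rX X}%N.
    by move=> X XL _; rewrite rXE // subn_gt0 ltnS dim_flats_le.
  have E := recP None 0 (leq0n _) L_pos.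
  apply: etrans (@ab_index_chains PP _ SL_uniq _ flat_chainsP) _.
  apply: etrans (congr1 (fun N => @chain_sum abpoly ab_b ab_c _ (@rp_lt PP) _ _ N _ 0)
    rp_N_flats) (etrans E _).
  apply: (congr1 (+%R _)); apply: eq_big => [X|X _].
    by rewrite /rp_lt /=; apply/asboolP.
  by rewrite subn0.
have TE : ab_rev (ab_index TT) =
    ab_c ^+ n.+1 + \sum_(C <- Cs) ab_c ^+ (rY C).-1 * ab_b * U C.
  have SC_uniq : uniq [seq Cell C | C <- Cs].
    by rewrite map_inj_uniq ?fset_uniq // => C D [].
  have C_pos : {in Cs, forall C, gtT WholeSpace (Cell C) -> 0 < rY C}%N.
    by move=> C CC _; rewrite rYE subn_gt0 ltnS dim_cells_le.
  have E := recT WholeSpace 0 (leq0n _) C_pos.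
  apply: etrans (@ab_rev_index_chains TT _ SC_uniq _ cell_chainsP) (etrans E _).
  apply: (congr1 (+%R _)); apply: eq_big => [C|C _].
    by rewrite /gtT /rp_lt /=; apply/andP; split; [apply/eqP|apply/asboolP].
  by rewrite subn0.
rewrite TE PE phi_tE; apply/esym.
pose tl s : {additive abpoly -> abpoly} := lin_ext (tail_w ab_b ab_c s).
pose ph : {additive abpoly -> abpoly} := lin_ext (phi_w ab_b ab_c).
apply: (@ph_flats abpoly ab_b ab_c tl ph tail0_b tailS_b tail0_c tailS_c tail_nil
  phi_b phi_c phi_nil _ _ L Cs n.+1 ltX gtY supp rX rY).
- exact: fset_uniq.
- exact: fset_uniq.
- exact: L_rank.
- exact: ltX_rank.
- exact: ltX_trans.
- exact: supp_flat.
- by move=> C CC; rewrite rYE rXE ?supp_flat // dim_supp.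
- exact: gtY_supp.
- exact: euler_local.
- exact: euler_global.
- by move=> X XL; apply: (recP (Some X) (rX X) (L_rank X XL)) => Y YL; exact: ltX_rank.
- by move=> C CC; apply: (recT (Cell C) (rY C) (C_rank C)) => D DC; exact: gtY_rank.
Qed.

End Data.
End Regular.

Theorem theorem3p17 (R : realType) (n : nat) (H : set (set (torus R n))) :
  toric_arrangement H ->
  regular_cell_complex R (toric_cells H) (@torus_dim R n) ->
  ab_rev (ab_index (toric_face_poset H))
  = phi_t (ab_index (intersection_poset_bot H)).
Proof.
move=> H_arr H_reg; have [aQ [b [aQ_neq0 hypE]]] := arrangement_data H_arr.
exact: index_identity H_arr H_reg aQ b aQ_neq0 hypE.
Qed.
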